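(* Let $M=\Lambda^2_-(T^*\mathcal{S}^4)$ with the Bryant--Salamon $\mathrm{G}_2$-structure $\varphi_c$ ($c>0$), $M_0=M\setminus\mathcal{S}^4$ with $\varphi_0$, and consider the coassociative fibrations $\pi_c:M\to\mathbb{R}^3$ and $\pi_0:M_0\to\mathbb{R}^3$, whose fibres carry the metric induced by $g_c$, respectively $g_0$. Let $\sigma_1,\sigma_2,\sigma_3$ be the standard left-invariant coframe on $\mathrm{SO}(3)\cong\mathbb{RP}^3$. (a) All the coassociative fibres (both smooth and singular) in $M$ or $M_0$ are asymptotically conical with rate at least $-2$ (that is, they converge to the cone at least as fast as rate $-2$), and their asymptotic cone is topologically $\mathbb{R}^+\times\mathbb{RP}^3$, equipped with the particular cone metric $$g_{AC}=dR^2+\frac{R^2}{4}\sigma_1^2+\frac{R^2}{2}(\sigma_2^2+\sigma_3^2).$$ (b) All the singular coassociative fibres in $M$ are conically singular with asymptotic cone (at the singularity) which is topologically $\mathbb{R}^+\times\mathbb{RP}^3$, equipped with the particular cone metric $$g_{CS}=dR^2+\frac{R^2}{2}(\sigma_1^2+\sigma_2^2)+R^2\sigma_3^2.$$ (c) The unique singular coassociative fibre in $M_0$ is exactly a Riemannian cone, equipped with the cone metric $g_{AC}$.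
   Context: Ambient structure. On the round $\mathcal{S}^4$ of curvature $1$, with local oriented orthonormal coframe $b_0,\dots,b_3$, put $\Omega_1=b_0\wedge b_1-b_2\wedge b_3$, $\Omega_2=b_0\wedge b_2-b_3\wedge b_1$, $\Omega_3=b_0\wedge b_3-b_1\wedge b_2$, let $\rho_i$ be the 1-forms of the induced connection, $d\Omega_1=2\rho_3\wedge\Omega_2-2\rho_2\wedge\Omega_3$, $d\Omega_2=2\rho_1\wedge\Omega_3-2\rho_3\wedge\Omega_1$, $d\Omega_3=2\rho_2\wedge\Omega_1-2\rho_1\wedge\Omega_2$, let $(a_1,a_2,a_3)$ be fibre coordinates with respect to $\Omega_i$, $r^2=\sum a_i^2$, and $\zeta_1=da_1-2a_2\rho_3+2a_3\rho_2$, $\zeta_2=da_2-2a_3\rho_1+2a_1\rho_3$, $\zeta_3=da_3-2a_1\rho_2+2a_2\rho_1$. Then $\varphi_c=(c+r^2)^{-3/4}\zeta_1\wedge\zeta_2\wedge\zeta_3+2(c+r^2)^{1/4}\sum_i\zeta_i\wedge\Omega_i$ and its metric is $g_c=(c+r^2)^{-1/2}(\zeta_1^2+\zeta_2^2+\zeta_3^2)+2(c+r^2)^{1/2}(b_0^2+b_1^2+b_2^2+b_3^2)$. Coordinates. With $\mathbb{R}^5=\mathbb{R}^3\oplus\mathbb{R}^2$, write points of $\mathcal{S}^4$ as $(\cos\alpha\cos\theta,\cos\alpha\sin\theta\cos\phi,\cos\alpha\sin\theta\sin\phi,\sin\alpha\cos\beta,\sin\alpha\sin\beta)$, $\alpha\in[0,\frac\pi2]$,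 and use the coframe $b_0=d\alpha$, $b_1=\sin\alpha\,d\beta$, $b_2=\cos\alpha\,d\theta$, $b_3=\cos\alpha\sin\theta\,d\phi$. Write $a_1=t$, $a_2=s\cos\gamma$, $a_3=s\sin\gamma$ with $s\ge0$ (so $r^2=s^2+t^2$), and $\sigma_1=d\gamma+\cos\theta\,d\phi$, $\sigma_2=\cos\gamma\,d\theta+\sin\gamma\sin\theta\,d\phi$, $\sigma_3=\sin\gamma\,d\theta-\cos\gamma\sin\theta\,d\phi$, the standard left-invariant coframe on the generic orbits $\mathrm{SO}(3)\cong\mathbb{RP}^3$ of the $\mathrm{SO}(3)$ acting on the factor $\mathbb{R}^3$. Fibration. For $c\ge0$, $\pi_c=(t\cos\alpha,\;2(c+s^2+t^2)^{1/4}\sin\alpha\cos\beta,\;2(c+s^2+t^2)^{1/4}\sin\alpha\sin\beta)=(u,v\cos\beta,v\sin\beta)$ (well defined on all of $M$, resp. $M_0$, also where the coordinates degenerate). Its fibres are coassociative and diffeomorphic to $T^*\mathcal{S}^2$, except for the singular fibres: for $c>0$, those over the circle $u=0$, $v=2c^{1/4}$, each topologically $(\mathbb{R}^+\times\mathbb{RP}^3)\cup\{0\}$; for $c=0$, the one over the origin, topologically $\mathbb{R}^+\times\mathbb{RP}^3$. Asymptotically conical / conically singular. $(N,g)$ is asymptotically conical with rate $\lambda<0$ to the cone $(\mathbb{R}^+\times\Sigma,g_0=dR^2+R^2g_\Sigma)$ if there are compact $K\subset N$ and a diffeomorphism $\Psi:(R_0,\infty)\times\Sigma\to N\setminus K$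 with $|\nabla^j(\Psi^*g-g_0)|=O(R^{\lambda-j})$ as $R\to\infty$ for all $j$. It is conically singular with rate $\mu>0$ if there is a diffeomorphism $\Psi:(0,\epsilon)\times\Sigma\to N\setminus K$ with $|\nabla^j(\Psi^*g-g_0)|=O(R^{\mu-j})$ as $R\to0$ for all $j$. For a fibre that has both an infinite end and a singular point, each condition refers to the corresponding end (the singular point being removed). *)

(* Defs.v *)
From HB Require Import structures.
From mathcomp Require Import all_boot all_order all_algebra.
From mathcomp Require Import all_classical all_reals all_analysis.
From mathcomp Require Import ring lra.

Set Implicit Arguments.
Unset Strict Implicit.
Unset Printing Implicit Defensive.

Import Order.TTheory GRing.Theory Num.Theory.
Import numFieldNormedType.Exports.

Local Open Scope classical_set_scope.
Local Open Scope ring_scope.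

(** * Smooth maps and diffeomorphisms between subsets of normed spaces *)

Section Smooth.
Context {R : realType}.

(* Class C^k on an open set U of a finite dimensional space. *)
Fixpoint Ck (k : nat) (V W : normedModType R) (U : set V) (f : V -> W) : Prop :=
  (forall x, U x -> {for x, continuous f}) /\
  (if k is k'.+1 then
     forall v : V,
       (forall x, U x -> derivable f x v) /\ Ck k' U (fun x => 'D_v f x)
   else True).

(* Smoothness on an arbitrary subset X: local existence of smooth extensions to
   open subsets of the ambient space. *)
Definition smooth_on (V W : normedModType R) (X : set V) (f : V -> W) : Prop :=
  forall x, X x -> exists (U : set V) (F : V -> W),
    [/\ open U, U x, (forall k, Ck k U F) &
        forall y, X y -> U y -> F y = f y].

Definition diffeomorphism (V W : normedModType R) (X : set V) (Y : set W)
    (f : V -> W) : Prop :=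
  exists g : W -> V,
    [/\ forall x, X x -> Y (f x) /\ g (f x) = x,
        forall y, Y y -> X (g y) /\ f (g y) = y,
        smooth_on X f & smooth_on Y g].

End Smooth.

(** * Riemannian geometry of (r0, r1) x SO(3) in a left-invariant frame *)

Section Cone.
Context {R : realType}.

Definition SO3 : set 'M[R]_3 := [set A | A *m A^T = 1%:M /\ \det A = 1].

(* Points of R x SO(3), inside the ambient space R x M_3(R). *)
Definition cylpt := (R * 'M[R]_3)%type.

(* Basis F_1, F_2, F_3 of so(3), indexed by 'I_3 with indices modulo 3: the
   entry (j, k) of F_i is the Levi-Civita symbol eps_(ijk), and
   [F_i, F_(i+1)] = - F_(i+2).  The left-invariant coframe sigma_1, sigma_2,
   sigma_3 on SO(3) is defined by A^-1 dA = \sum_i sigma_i F_i; by the sign of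
   the brackets, d sigma_1 = sigma_2 /\ sigma_3 and cyclically, as for
     sigma_1 = d gamma + cos theta d phi,
     sigma_2 = cos gamma d theta + sin gamma sin theta d phi,
     sigma_3 = sin gamma d theta - cos gamma sin theta d phi. *)
Definition so3gen (i : 'I_3) : 'M[R]_3 :=
  delta_mx (i + 1) (i + 2) - delta_mx (i + 2) (i + 1).

(* exp (e F_i), by Rodrigues' formula. *)
Definition rot (i : 'I_3) (e : R) : 'M[R]_3 :=
  1%:M + sin e *: so3gen i + (1 - cos e) *: (so3gen i *m so3gen i).

(* The frame X_0 = d/dR, X_1, X_2, X_3 dual to dR, sigma_1, sigma_2, sigma_3,
   given by its flow; [frame_der a f p] is the derivative of f along X_a. *)
Definition flow (a : 'I_4) (e : R) (p : cylpt) : cylpt :=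
  if unlift ord0 a is Some i then (p.1, p.2 *m rot i e) else (p.1 + e, p.2).

Definition frame_der (V : normedModType R) (a : 'I_4) (f : cylpt -> V)
    (p : cylpt) : V :=
  derive1 (fun e : R => f (flow a e p)) 0.

(* [X_a, X_b] = \sum_d bracket_coef a b d X_d. *)
Definition bracket_coef (a b d : 'I_4) : R :=
  match unlift ord0 a, unlift ord0 b, unlift ord0 d with
  | Some i, Some j, Some k => - so3gen i j k
  | _, _, _ => 0
  end.

(* In the frame, a Riemannian metric is a field of symmetric matrices, and a
   covariant tensor of rank k is a family of functions indexed by the sequences
   of length k (the values at other lengths being irrelevant). *)
Definition metric_field := cylpt -> 'M[R]_4.
Definition tensor := seq 'I_4 -> cylpt -> R.

Definition metric_tensor (G : metric_field) : tensor :=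
  fun s p => if s is [:: a; b] then G p a b else 0.

(* G([X_a, X_b], X_d) *)
Definition bracket_metric (G : metric_field) (a b d : 'I_4) (p : cylpt) : R :=
  \sum_(f < 4) bracket_coef a b f * G p f d.

(* Koszul formula: G(nabla_(X_a) X_b, X_d), nabla the Levi-Civita connection. *)
Definition koszul (G : metric_field) (a b d : 'I_4) (p : cylpt) : R :=
  2^-1 * (frame_der a (fun q => G q b d) p
        + frame_der b (fun q => G q d a) p
        - frame_der d (fun q => G q a b) p
        + bracket_metric G a b d p
        - bracket_metric G b d a p
        + bracket_metric G d a b p).

(* nabla_(X_a) X_b = \sum_d christoffel G a b d X_d *)
Definition christoffel (G : metric_field) (a b d : 'I_4) (p : cylpt) : R :=
  \sum_(f < 4) invmx (G p) d f * koszul G a b f p.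

(* (nabla T)(X_a, X_t) = (nabla_(X_a) T)(X_t) *)
Definition nabla (G : metric_field) (T : tensor) : tensor :=
  fun s p =>
    if s is a :: t then
      frame_der a (T t) p
      - \sum_(m < size t) \sum_(d < 4)
          christoffel G a (nth ord0 t m) d p * T (set_nth ord0 t m d) p
    else 0.

(* Pointwise norm, with respect to G, of a tensor of rank k. *)
Definition tensor_norm (G : metric_field) (k : nat) (T : tensor) (p : cylpt) : R :=
  Num.sqrt (\sum_(s : k.-tuple 'I_4) \sum_(t : k.-tuple 'I_4)
    (\prod_(m < k) invmx (G p) (tnth s m) (tnth t m)) * T s p * T t p).

(* |nabla^j (G - G0)|, everything taken with respect to G0. *)
Definition metric_deviation (G G0 : metric_field) (j : nat) (p : cylpt) : R :=
  tensor_norm G0 j.+2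
    (iter j (nabla G0) (metric_tensor (fun q => G q - G0 q))) p.

(* dR^2 + R^2 (q1 sigma_1^2 + q2 sigma_2^2 + q3 sigma_3^2) *)
Definition cone_metric (q1 q2 q3 : R) : metric_field :=
  fun p => diag_mx (\row_(a < 4)
    nth 0 [:: 1; p.1 ^+ 2 * q1; p.1 ^+ 2 * q2; p.1 ^+ 2 * q3] a).

Definition g_AC : metric_field := cone_metric 4^-1 2^-1 2^-1.
Definition g_CS : metric_field := cone_metric 2^-1 2^-1 1.

Section Ends.
Variable E : normedModType R.

(* g x v w is the inner product of v and w, relevant only when x lies on the
   submanifold of E under consideration and v, w are tangent to it at x. *)
Definition ambient_metric := E -> E -> E -> R.

Definition pullback (g : ambient_metric) (Psi : cylpt -> E) : metric_field :=
  fun p => \matrix_(a < 4, b < 4)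
    g (Psi p) (frame_der a Psi p) (frame_der b Psi p).

(* N is a space with singular part Z, the metric g is considered on N `\` Z, and
   the link of the cone is SO(3), identified with RP^3. Z need not be contained
   in N. *)

(* N `\` Z `\` K is the infinite end. When N is smooth, Z is empty and K is
   compact; otherwise K is compact once the removed set Z is added back. *)
Definition asymptotically_conical (g : ambient_metric) (N Z : set E)
    (g0 : metric_field) (rate : R) : Prop :=
  exists (K : set E) (R0 : R) (Psi : cylpt -> E),
    let dom := [set p : cylpt | R0 < p.1 /\ SO3 p.2] in
    [/\ K `<=` N `\` Z, compact (K `|` Z), 0 < R0,
        diffeomorphism dom ((N `\` Z) `\` K) Psi &
        forall j : nat, exists C R1 : R, forall p, dom p -> R1 < p.1 ->
          metric_deviation (pullback g Psi) g0 j p <= C * p.1 `^ (rate - j%:R)].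

(* N `\` Z `\` K is the end of N `\` Z at Z: K is a closed set which does
   not meet Z, and Psi tends to Z as R tends to 0. *)
Definition conically_singular (g : ambient_metric) (N Z : set E)
    (g0 : metric_field) (rate : R) : Prop :=
  exists (K : set E) (eps : R) (Psi : cylpt -> E),
    let dom := [set p : cylpt | (0 < p.1 < eps) /\ SO3 p.2] in
    [/\ K `<=` N `\` Z /\ closed K, 0 < eps,
        diffeomorphism dom ((N `\` Z) `\` K) Psi,
        forall U : set E, open U -> Z `<=` U -> exists2 d : R, 0 < d &
          forall p, dom p -> p.1 < d -> U (Psi p) &
        forall j : nat, exists C d : R, 0 < d /\ forall p, dom p -> p.1 < d ->
          metric_deviation (pullback g Psi) g0 j p <= C * p.1 `^ (rate - j%:R)].

Definition isometric_to_cone (g : ambient_metric) (N : set E)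
    (g0 : metric_field) : Prop :=
  exists Psi : cylpt -> E,
    let dom := [set p : cylpt | 0 < p.1 /\ SO3 p.2] in
    diffeomorphism dom N Psi /\ forall p, dom p -> pullback g Psi p = g0 p.

End Ends.
End Cone.

(** * The Bryant-Salamon metrics on Lambda^2_- (T^* S^4) and the fibration *)

Section BryantSalamon.
Context {R : realType}.

(* A 2-form at x in S^4 is represented by a skew 5 x 5 matrix which annihilates
   x, hence Lambda^2 T^* S^4 lies in R^5 x M_5(R). *)
Definition BSamb := ('rV[R]_5 * 'M[R]_5)%type.

Definition inner (m n : nat) (A B : 'M[R]_(m, n)) : R :=
  \sum_i \sum_j A i j * B i j.

Definition wedge (u v : 'rV[R]_5) : 'M[R]_5 := u^T *m v - v^T *m u.

(* Hodge star of 2-forms on T_x S^4, S^4 being oriented as the boundary of the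
   unit ball: b_0, ..., b_3 is oriented iff det (x, b_0, ..., b_3) > 0. *)
Definition hodge (x : 'rV[R]_5) (w : 'M[R]_5) : 'M[R]_5 :=
  \matrix_(i, j) (2^-1 * \sum_k \sum_l
    \det (\matrix_(a < 5) nth (0 : 'rV[R]_5)
            [:: x; 'e_i; 'e_j; 'e_k; 'e_l] a) * w k l).

Definition Lambda2minus : set BSamb :=
  [set p | [/\ inner p.1 p.1 = 1, p.2^T = - p.2, p.1 *m p.2 = 0 &
               hodge p.1 p.2 = - p.2]].

Definition zero_section : set BSamb := Lambda2minus `&` [set p | p.2 = 0].

(* M for c > 0, and M_0 for c = 0. *)
Definition BSspace (c : R) : set BSamb :=
  if c == 0 then Lambda2minus `\` zero_section else Lambda2minus.

(* r^2 = a_1^2 + a_2^2 + a_3^2 for w = \sum_i a_i Omega_i: the matrices Omega_i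
   are orthogonal with inner Omega_i Omega_i = 4. *)
Definition rsq (w : 'M[R]_5) : R := 4^-1 * inner w w.

(* The connection on Lambda^2_- induced by the Levi-Civita connection of S^4:
   the covariant derivative along a curve (x, w) in Lambda2minus is the
   orthogonal projection of w' to the 2-forms on T_x S^4. It is
   \sum_i zeta_i Omega_i. *)
Definition covariant_part (x : 'rV[R]_5) (w' : 'M[R]_5) : 'M[R]_5 :=
  (1%:M - x^T *m x) *m w' *m (1%:M - x^T *m x).

(* g_c = (c + r^2)^(-1/2) \sum_i zeta_i^2 + 2 (c + r^2)^(1/2) \sum_i b_i^2 *)
Definition BSmetric (c : R) : ambient_metric BSamb := fun p v v' =>
  (c + rsq p.2) `^ (- 2^-1) *
    (4^-1 * inner (covariant_part p.1 v.2) (covariant_part p.1 v'.2))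
  + 2 * (c + rsq p.2) `^ 2^-1 * inner v.1 v'.1.

(* The last two coordinates on R^5. *)
Definition i4 : 'I_5 := inord 3.
Definition i5 : 'I_5 := inord 4.

(* pi_c, without degenerate coordinates. As
     cos alpha b_0 /\ b_1 = dx_4 /\ dx_5 on S^4,
   t cos alpha is the value of the 2-form on the last two coordinate vectors of
   R^5; see BSfibration_coordinates. *)
Definition BSfibration (c : R) (p : BSamb) : R * R * R :=
  (p.2 i4 i5,
   2 * (c + rsq p.2) `^ 4^-1 * p.1 ord0 i4,
   2 * (c + rsq p.2) `^ 4^-1 * p.1 ord0 i5).

Definition BSfibre (c : R) (b : R * R * R) : set BSamb :=
  BSspace c `&` [set p | BSfibration c p = b].

(* For c > 0, the circle u = 0, v = 2 c^(1/4); for c = 0, the origin. *)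
Definition singular_value (c : R) (b : R * R * R) : Prop :=
  b.1.1 = 0 /\ b.1.2 ^+ 2 + b.2 ^+ 2 = (2 * c `^ 4^-1) ^+ 2.

(* The singular part of the fibre over a singular value b. For c > 0 it is its
   only point on the zero section. For c = 0 it is disjoint from the fibre, and
   consists of the limits of the fibre on the zero section, which the completion
   of g_0 collapses to one point. *)
Definition singular_part (c : R) (b : R * R * R) : set BSamb :=
  [set p | singular_value c b /\ (closure (BSfibre c b) `&` zero_section) p].

(* The coordinates on the sphere, and the frame b_0, ..., b_3 (at points where
   they do not degenerate). *)
Definition sphere_pt (alpha beta theta phi : R) : 'rV[R]_5 :=
  \row_j nth 0 [:: cos alpha * cos theta; cos alpha * sin theta * cos phi;
    cos alpha * sin theta * sin phi; sin alpha * cos beta;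
    sin alpha * sin beta] j.

Definition frame_b (alpha beta theta phi : R) (m : nat) : 'rV[R]_5 :=
  \row_j nth 0 (nth [::] [::
    [:: - sin alpha * cos theta; - sin alpha * sin theta * cos phi;
        - sin alpha * sin theta * sin phi; cos alpha * cos beta;
        cos alpha * sin beta];
    [:: 0; 0; 0; - sin beta; cos beta];
    [:: - sin theta; cos theta * cos phi; cos theta * sin phi; 0; 0];
    [:: 0; - sin phi; cos phi; 0; 0]] m) j.

Definition chart (alpha beta theta phi a1 a2 a3 : R) : BSamb :=
  let b := frame_b alpha beta theta phi in
  (sphere_pt alpha beta theta phi,
   a1 *: (wedge (b 0) (b 1) - wedge (b 2) (b 3))
   + a2 *: (wedge (b 0) (b 2) - wedge (b 3) (b 1))
   + a3 *: (wedge (b 0) (b 3) - wedge (b 1) (b 2))).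

Lemma frame_b_orthonormal (alpha beta theta phi : R) (m n : nat) :
  (m < 4)%N -> (n < 4)%N ->
  inner (frame_b alpha beta theta phi m) (frame_b alpha beta theta phi n)
  = (m == n)%:R.
Proof.
have Ha := sin2cos2 alpha; have Hb := sin2cos2 beta.
have Ht := sin2cos2 theta; have Hp := sin2cos2 phi.
case: m => [|[|[|[|//]]]] _; case: n => [|[|[|[|//]]]] _;
  rewrite /inner big_ord1 !big_ord_recl big_ord0 !mxE /=; ring: Ha Hb Ht Hp.
Qed.

Lemma inner_wedge (u v w z : 'rV[R]_5) :
  inner (wedge u v) (wedge w z)
  = 2 * (inner u w * inner v z - inner u z * inner v w).
Proof.
rewrite /inner !big_ord1 !big_ord_recl !big_ord0 !mxE.
rewrite !big_ord_recl !big_ord0 !mxE.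
ring.
Qed.

Lemma innerC (m n : nat) (A B : 'M[R]_(m, n)) : inner A B = inner B A.
Proof. by apply: eq_bigr => i _; apply: eq_bigr => j _; rewrite mulrC. Qed.

Lemma innerDl (m n : nat) (A B C : 'M[R]_(m, n)) :
  inner (A + B) C = inner A C + inner B C.
Proof.
rewrite /inner -big_split; apply: eq_bigr => i _ /=.
by rewrite -big_split; apply: eq_bigr => j _ /=; rewrite mxE mulrDl.
Qed.

Lemma innerZl (m n : nat) (a : R) (A C : 'M[R]_(m, n)) :
  inner (a *: A) C = a * inner A C.
Proof.
rewrite /inner mulr_sumr; apply: eq_bigr => i _.
by rewrite mulr_sumr; apply: eq_bigr => j _; rewrite mxE mulrA.
Qed.

Lemma innerNl (m n : nat) (A C : 'M[R]_(m, n)) : inner (- A) C = - inner A C.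
Proof. by rewrite -scaleN1r innerZl mulN1r. Qed.

Lemma rsq_chart (alpha beta theta phi a1 a2 a3 : R) :
  rsq (chart alpha beta theta phi a1 a2 a3).2 = a1 ^+ 2 + a2 ^+ 2 + a3 ^+ 2.
Proof.
rewrite /rsq /chart /=.
set b := frame_b _ _ _ _; set w := (X in inner X X).
have wE C : inner w C = a1 * (inner (wedge (b 0) (b 1)) C
    - inner (wedge (b 2) (b 3)) C) + a2 * (inner (wedge (b 0) (b 2)) C
    - inner (wedge (b 3) (b 1)) C) + a3 * (inner (wedge (b 0) (b 3)) C
    - inner (wedge (b 1) (b 2)) C).
  rewrite /w; move: (wedge (b 0) (b 1)) (wedge (b 2) (b 3)) (wedge (b 0) (b 2))
    (wedge (b 3) (b 1)) (wedge (b 0) (b 3)) (wedge (b 1) (b 2)).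
  by move=> *; rewrite !innerDl !innerZl !innerDl !innerNl.
rewrite wE !(innerC _ w) !wE !inner_wedge /b !frame_b_orthonormal //=.
by field.
Qed.

Lemma BSfibration_coordinates (c alpha beta theta phi t s gamma : R) :
  BSfibration c (chart alpha beta theta phi t (s * cos gamma) (s * sin gamma)) =
  (t * cos alpha,
   2 * (c + s ^+ 2 + t ^+ 2) `^ 4^-1 * sin alpha * cos beta,
   2 * (c + s ^+ 2 + t ^+ 2) `^ 4^-1 * sin alpha * sin beta).
Proof.
have Hb := cos2Dsin2 beta; have Hg := cos2Dsin2 gamma.
rewrite /BSfibration rsq_chart.
have -> : c + (t ^+ 2 + (s * cos gamma) ^+ 2 + (s * sin gamma) ^+ 2)
        = c + s ^+ 2 + t ^+ 2.
  by rewrite -[X in c + X + _]mulr1 -Hg; ring.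
rewrite !mxE !big_ord_recl !big_ord0 !mxE /i4 /i5 !inordK //=.
congr (_, _, _).
- transitivity (t * cos alpha * (cos beta ^+ 2 + sin beta ^+ 2)); first by ring.
  by rewrite Hb mulr1.
- by ring.
- by ring.
Qed.

End BryantSalamon.

(* Main.v *)
Require Import Defs.
From mathcomp Require Import all_boot all_order all_algebra.
From mathcomp Require Import all_classical all_reals all_analysis.
From mathcomp Require Import ring lra.

(* Let q = (c + r^2)^(1/2) and b = (u, v n3, v n4) with (n3, n4) a unit vector.
   Along a fibre sin alpha = v / (2 sqrt q), t = u / cos alpha and
   s^2 = q^2 - c - t^2 are explicit functions of q, so that a fibre is an
   SO(3)-orbit of a curve parametrized by q. The substitution
   R^2 = 4 (q - m), with m = 0 at the infinite end and m = c^(1/2) at a singular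
   point, makes R asymptotic to the distance: the induced metric becomes a
   left-invariant metric whose coefficients are explicit functions of R. Their
   differences with those of the cone, and all the covariant derivatives of these
   differences, are estimated by a symbol calculus: a component of a tensor on
   which R has weight l is O(R^(l + w)) together with its derivatives, w being the
   number of indices tangent to SO(3), and the covariant derivative of the cone
   lowers l by one. For c = u = v = 0 the metric is the cone. *)

Import Order.TTheory GRing.Theory Num.Theory.
Import numFieldNormedType.Exports.

Set Implicit Arguments.
Unset Strict Implicit.
Unset Printing Implicit Defensive.

Local Open Scope classical_set_scope.
Local Open Scope ring_scope.

(** Origin of R^2 = 4 (q - m): at infinity s grows like q while t stays bounded, so the radial part
    of the metric is asymptotic to dq^2 / q, which is dR^2 for q = R^2 / 4. Over a singular value
    with c = m^2 > 0 one has u = 0 and v^2 = 4 m, hence cos^2 alpha = (q - m) / q and s^2 = q^2 -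
    m^2; near q = m the fibre part and the base part of the metric each contribute dq^2 / (2 (q -
    m)), and the sum is dR^2. Anti-self-duality is awkward entrywise. A point is therefore encoded
    by two scalars and four vectors of R^3, on which SO(3) acts simultaneously. The Hodge equations
    become relations between dot and cross products, to be checked only at A = 1, and the rotation
    of a given point of a fibre is read off as an explicit matrix. The inverse of the
    parametrization is thus a formula, smooth on an open subset of the ambient space. Smoothness and
    decay concern derivatives of all orders. Both are handled by classes closed under sums,
    products, derivatives and suitable powers, so that only first derivatives of the profile
    functions are ever computed. *)

Local Notation "''3_' k" := (@Ordinal 3 k isT) (at level 8, k at level 2, format "''3_' k").

Local Notation "''5_' k" := (@Ordinal 5 k isT) (at level 8, k at level 2, format "''5_' k").

(** * Directional calculus *)

Section DirectionalCalculus.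
Context {R : realType}.
Implicit Types V W : normedModType R.

(** Restriction to a line, which makes the one-variable chain rule applicable to directional
    derivatives. *)
Lemma derivable_lineE V W (f : V -> W) x v (d : W) :
  is_derive x v f d <-> is_derive (0 : R) 1 (fun h => f (h *: v + x)) d.
Proof.
have E : 'D_v f x = 'D_1 (fun h : R => f (h *: v + x)) 0.
  rewrite /derive; congr (lim (_ @ 0^')).
  by apply/funext => h /=; rewrite addr0 scale0r add0r [_%:A]mulr1.
split=> -[df dE].
  by apply: DeriveDef; [exact/(derivable1P f x v).1 | rewrite -E].
by apply: DeriveDef; [exact/(derivable1P f x v).2 | rewrite E].
Qed.

Lemma is_derive_comp_outer V (f : V -> R) (g : R -> R) x v (a b : R) :
  is_derive (f x) 1 g a -> is_derive x v f b ->
  is_derive x v (fun y => g (f y)) (a * b).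
Proof.
move=> dg /derivable_lineE df; apply/derivable_lineE.
by apply: (@is_derive1_comp R g (fun h : R => f (h *: v + x)));
  rewrite ?scale0r ?add0r.
Qed.

Lemma is_derive_pair V W W' (f : V -> W) (g : V -> W') x v df dg :
  is_derive x v f df -> is_derive x v g dg ->
  is_derive x v (fun y => (f y, g y)) (df, dg).
Proof.
move=> [/cvg_ex[a fa] <-] [/cvg_ex[b gb] <-].
have E : (fun h : R => h^-1 *: (((fun y => (f y, g y)) \o shift x) (h *: v)
    - (f x, g x))) @ 0^' --> (a, b).
  exact: (cvg_pair fa gb).
apply: DeriveDef; first by apply/cvg_ex; exists (a, b).
by rewrite /derive (cvg_lim _ E)// (cvg_lim _ fa)// (cvg_lim _ gb).
Qed.

Lemma is_derive_mx V m n (M : V -> 'M[R]_(m.+1, n.+1)) x v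
    (D : 'M[R]_(m.+1, n.+1)) :
  (forall i j, is_derive x v (fun y => M y i j) (D i j)) -> is_derive x v M D.
Proof.
move=> dM; have dM' : derivable M x v by apply/derivable_mxP => i j; case: (dM i j).
apply: DeriveDef => //; rewrite derive_mx//.
by apply/matrixP => i j; rewrite mxE; case: (dM i j).
Qed.

Lemma is_derive_near V W (f g : V -> W) (U : set V) x v df :
  open U -> U x -> (forall y, U y -> f y = g y) ->
  is_derive x v f df -> is_derive x v g df.
Proof.
move=> oU Ux fg; apply: near_eq_is_derive.
by near=> y; apply: fg; near: y; exact: open_nbhs_nbhs.
Unshelve. all: by end_near. Qed.

End DirectionalCalculus.

(** * Maps of class C^k *)

Section ClassCk.
Context {R : realType}.
Implicit Types V W : normedModType R.

Lemma Ck_eq k V W (U : set V) (f g : V -> W) :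
  open U -> (forall x, U x -> f x = g x) -> Ck k U f -> Ck k U g.
Proof.
elim: k f g => [|k IH] f g oU fg [cf df].
  split=> // x Ux; rewrite /prop_for/continuous_at -fg//.
  apply: cvg_trans (cf x Ux); apply: near_eq_cvg; near=> y.
  by apply: fg; near: y; exact: open_nbhs_nbhs.
have n x : U x -> \forall y \near x, f y = g y.
  by move=> Ux; near=> y; apply: fg; near: y; exact: open_nbhs_nbhs.
split=> [x Ux|v].
  rewrite /prop_for/continuous_at -fg//.
  by apply: cvg_trans (cf x Ux); apply: near_eq_cvg; exact: n.
have [dfU dfk] := df v; split=> [x Ux|].
  by apply: near_eq_derivable (dfU x Ux); exact: n.
by apply: IH dfk => // x Ux; apply: near_eq_derive; exact: n.
Unshelve. all: by end_near. Qed.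

Lemma CkS k V W (U : set V) (f : V -> W) : Ck k.+1 U f -> Ck k U f.
Proof.
elim: k f => [|k IH] f [cf df]; split=> // v.
by have [? /IH] := df v.
Qed.

(** Gains one order from any candidate [df] for the directional derivatives; it only has to agree
    with ['D_v f] on the open set [U]. *)
Lemma Ck_is_derive k V W (U : set V) (f : V -> W) (df : V -> V -> W) :
  open U -> (forall x, U x -> {for x, continuous f}) ->
  (forall v x, U x -> is_derive x v f (df v x)) ->
  (forall v, Ck k U (df v)) -> Ck k.+1 U f.
Proof.
move=> oU cf fE dfk; split=> // v; split=> [x Ux|]; first by case: (fE v x Ux).
by apply: Ck_eq (dfk v) => // x Ux; case: (fE v x Ux).
Qed.

Lemma Ck_cst k V W (U : set V) (w : W) : Ck k U (fun _ => w).
Proof.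
elim: k w => [|k IH] w; first by split=> // x _; exact: cst_continuous.
split=> [x _|v]; first exact: cst_continuous.
split=> [x _|]; first exact: derivable_cst.
have -> : (fun x => 'D_v (fun=> w) x) = (fun=> 0) :> (V -> W).
  by apply/funext => x; rewrite derive_cst.
exact: IH.
Qed.

Lemma CkD k V W (U : set V) (f g : V -> W) :
  open U -> Ck k U f -> Ck k U g -> Ck k U (fun x => f x + g x).
Proof.
move=> oU; elim: k f g => [|k IH] f g [cf df] [cg dg].
  by split=> // x Ux; apply: cvgD; [exact: cf | exact: cg].
apply: (@Ck_is_derive _ _ _ _ _ (fun v x => 'D_v f x + 'D_v g x)) => //.
- by move=> x Ux; apply: cvgD; [exact: cf | exact: cg].
- move=> v x Ux; apply: is_deriveD; apply: derivableP.
    by case: (df v) => + _; apply.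
  by case: (dg v) => + _; apply.
- by move=> v; apply: IH; [case: (df v) | case: (dg v)].
Qed.

Lemma CkM k V (U : set V) (f g : V -> R) :
  open U -> Ck k U f -> Ck k U g -> Ck k U (fun x => f x * g x).
Proof.
move=> oU; elim: k f g => [|k IH] f g.
  by move=> [cf _] [cg _]; split=> // x Ux; apply: cvgM; [exact: cf | exact: cg].
move=> fk gk; have [cf df] := fk; have [cg dg] := gk.
apply: (@Ck_is_derive _ _ _ _ _ (fun v x => f x * 'D_v g x + g x * 'D_v f x)) => //.
- by move=> x Ux; apply: cvgM; [exact: cf | exact: cg].
- move=> v x Ux; apply: is_deriveM; apply: derivableP.
    by case: (df v) => + _; apply.
  by case: (dg v) => + _; apply.
- move=> v; have [_ dfk] := df v; have [_ dgk] := dg v.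
  by apply: CkD => //; apply: IH => //; exact: CkS.
Qed.

Lemma CkN k V (U : set V) (f : V -> R) :
  open U -> Ck k U f -> Ck k U (fun x => - f x).
Proof.
move=> oU fk; apply: (@Ck_eq _ _ _ _ (fun x => (-1) * f x)) => //.
  by move=> x _; rewrite mulN1r.
by apply: CkM => //; exact: Ck_cst.
Qed.

(** All real exponents are treated at once, because differentiation replaces [a] by [a - 1];
    inverses and square roots are the cases [-1] and [2^-1]. *)
Lemma Ck_powR k V (U : set V) (f : V -> R) (a : R) :
  open U -> (forall x, U x -> 0 < f x) -> Ck k U f ->
  Ck k U (fun x => f x `^ a).
Proof.
move=> oU f0; elim: k a => [|k IH] a fk.
  have [cf _] := fk; split=> // x Ux.
  apply: (@continuous_comp _ _ _ f ((@powR R) ^~ a)); first exact: cf.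
  apply: differentiable_continuous; apply/derivable1_diffP.
  by have [] := is_derive1_powR a (f0 x Ux).
have [cf df] := fk.
apply: (@Ck_is_derive _ _ _ _ _
  (fun v x => a * f x `^ (a - 1) * 'D_v f x)) => //.
- move=> x Ux; apply: (@continuous_comp _ _ _ f ((@powR R) ^~ a)); first exact: cf.
  apply: differentiable_continuous; apply/derivable1_diffP.
  by have [] := is_derive1_powR a (f0 x Ux).
- move=> v x Ux; apply: (@is_derive_comp_outer _ _ f ((@powR R) ^~ a)).
    exact: is_derive1_powR (f0 x Ux).
  by apply: derivableP; case: (df v) => + _; apply.
- move=> v; apply: CkM => //; last by case: (df v).
  apply: CkM => //; first exact: Ck_cst.
  by apply: IH; exact: CkS.
Qed.

Lemma CkV k V (U : set V) (f : V -> R) :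
  open U -> (forall x, U x -> 0 < f x) -> Ck k U f -> Ck k U (fun x => (f x)^-1).
Proof.
move=> oU f0 fk; apply: Ck_eq (Ck_powR (-1) oU f0 fk) => // x /f0 fx.
by rewrite powR_inv1// ltW.
Qed.

Lemma Ck_sqrt k V (U : set V) (f : V -> R) :
  open U -> (forall x, U x -> 0 < f x) -> Ck k U f ->
  Ck k U (fun x => Num.sqrt (f x)).
Proof.
move=> oU f0 fk; apply: Ck_eq (Ck_powR 2^-1 oU f0 fk) => // x /f0 fx.
by rewrite powR12_sqrt// ltW.
Qed.

Lemma Ck_scale k V W (U : set V) (f : V -> R) (w : W) :
  open U -> Ck k U f -> Ck k U (fun x => f x *: w).
Proof.
move=> oU; elim: k f => [|k IH] f [cf df].
  by split=> // x Ux; apply: cvgZr_tmp; exact: cf.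
apply: (@Ck_is_derive _ _ _ _ _ (fun v x => 'D_v f x *: w)) => //.
- by move=> x Ux; apply: cvgZr_tmp; exact: cf.
- move=> v x Ux; have [/(_ x Ux)/cvg_ex[l fl] _] := df v.
  have E : (fun h : R => h^-1 *: (((fun y => f y *: w) \o shift x) (h *: v)
      - f x *: w)) @ 0^' --> l *: w.
    apply: cvg_trans (cvgZr_tmp fl); apply: near_eq_cvg; near=> h.
    by rewrite /= -scalerBl scalerA.
  apply: DeriveDef; first by apply/cvg_ex; exists (l *: w).
  by rewrite /derive (cvg_lim _ E)// (cvg_lim _ fl).
- by move=> v; apply: IH; case: (df v).
Unshelve. all: by end_near. Qed.

Lemma Ck_sum k V W (U : set V) n (f : 'I_n -> V -> W) :
  open U -> (forall i, Ck k U (f i)) -> Ck k U (fun x => \sum_i f i x).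
Proof.
move=> oU fk; elim: n f fk => [|n IH] f fk.
  by apply: Ck_eq (Ck_cst _ _ (0 : W)) => // x _; rewrite big_ord0.
apply: (@Ck_eq _ _ _ _ (fun x => f ord0 x + \sum_i f (lift ord0 i) x)) => //.
  by move=> x _; rewrite big_ord_recl.
by apply: CkD => //; exact: IH.
Qed.

Lemma Ck_pair k V W W' (U : set V) (f : V -> W) (g : V -> W') :
  open U -> Ck k U f -> Ck k U g -> Ck k U (fun x => (f x, g x)).
Proof.
move=> oU; elim: k f g => [|k IH] f g [cf df] [cg dg].
  by split=> // x Ux; apply: cvg_pair; [exact: cf | exact: cg].
apply: (@Ck_is_derive _ _ _ _ _ (fun v x => ('D_v f x, 'D_v g x))) => //.
- by move=> x Ux; apply: cvg_pair; [exact: cf | exact: cg].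
- move=> v x Ux; apply: is_derive_pair; apply: derivableP.
    by case: (df v) => + _; apply.
  by case: (dg v) => + _; apply.
- by move=> v; apply: IH; [case: (df v) | case: (dg v)].
Qed.

Lemma Ck_mx k V m n (U : set V) (M : V -> 'M[R]_(m.+1, n.+1)) :
  open U -> (forall i j, Ck k U (fun x => M x i j)) -> Ck k U M.
Proof.
move=> oU Mk.
apply: (@Ck_eq _ _ _ _ (fun x => \sum_i \sum_j M x i j *: delta_mx i j)) => //.
  by move=> x _; rewrite -matrix_sum_delta.
by apply: Ck_sum => // i; apply: Ck_sum => // j; apply: Ck_scale.
Qed.

(** The derivative of a linear map along [v] is the constant [f v], so a single differentiation
    settles all orders. *)
Lemma Ck_linear k V W (U : set V) (f : V -> W) :
  open U -> continuous f -> (forall a x y, f (a *: x + y) = a *: f x + f y) ->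
  Ck k U f.
Proof.
move=> oU cf lf; have D v x : is_derive x v f (f v).
  have E : (fun h : R => h^-1 *: ((f \o shift x) (h *: v) - f x)) @ 0^' --> f v.
    apply: cvg_near_cst; near=> h.
    rewrite /= lf addrK scalerA mulVf ?scale1r//.
    by near: h; exact: nbhs_dnbhs_neq.
  apply: DeriveDef; first by apply/cvg_ex; exists (f v).
  by rewrite /derive (cvg_lim _ E).
case: k => [|k]; first by split=> // x _; exact: cf.
apply: (@Ck_is_derive _ _ _ _ _ (fun v _ => f v)) => // [x _|v]; first exact: cf.
exact: Ck_cst.
Unshelve. all: by end_near. Qed.

Lemma Ck_fst k m n (U : set (R * 'M[R]_(m.+1, n.+1))) :
  open U -> Ck k U (fun x => x.1).
Proof. by move=> oU; apply: Ck_linear => // x; exact: cvg_fst. Qed.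

Lemma continuous_fst_coord p q m n i j :
  continuous (fun x : 'M[R]_(p.+1, q.+1) * 'M[R]_(m.+1, n.+1) => x.1 i j).
Proof.
move=> x; apply: (@continuous_comp _ _ _ fst (fun M : 'M[R]_(p.+1, q.+1) => M i j)).
  exact: cvg_fst.
exact: coord_continuous.
Qed.

Lemma continuous_snd_coord (W : normedModType R) m n i j :
  continuous (fun x : W * 'M[R]_(m.+1, n.+1) => x.2 i j).
Proof.
move=> x; apply: (@continuous_comp _ _ _ snd (fun M : 'M[R]_(m.+1, n.+1) => M i j)).
  exact: cvg_snd.
exact: coord_continuous.
Qed.

Lemma Ck_fst_coord k p q m n (U : set ('M[R]_(p.+1, q.+1) * 'M[R]_(m.+1, n.+1))) i j :
  open U -> Ck k U (fun x => x.1 i j).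
Proof.
move=> oU; apply: Ck_linear => //; first exact: continuous_fst_coord.
by move=> a x y; rewrite !mxE.
Qed.

Lemma Ck_snd_coord k (W : normedModType R) m n (U : set (W * 'M[R]_(m.+1, n.+1))) i j :
  open U -> Ck k U (fun x => x.2 i j).
Proof.
move=> oU; apply: Ck_linear => //; first exact: continuous_snd_coord.
by move=> a x y; rewrite !mxE.
Qed.

End ClassCk.

(** * Symbol estimates *)

Section Symbols.
Context {R : realType} (I : set R).
Hypothesis oI : open I.
Hypothesis I0 : forall x, I x -> 0 < x.

(** The constants are uniform on [I] and no end is singled out, so the same classes serve for [I]
    near infinity and for [I] near 0. *)
Fixpoint symb (k : nat) (l : R) (f : R -> R) : Prop :=
  (exists C, forall x, I x -> `|f x| <= C * x `^ l) /\
  (if k is k'.+1 then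
     exists g, (forall x, I x -> is_derive x 1 f (g x)) /\ symb k' (l - 1) g
   else True).

(* f^(k) = O(x^(l - k)) on I, for all k. *)
Definition symbol (l : R) (f : R -> R) := forall k, symb k l f.

Lemma symb_eq k l f g :
  (forall x, I x -> f x = g x) -> symb k l f -> symb k l g.
Proof.
move=> fg; case: k => [|k] [[C fC] df].
  by split=> //; exists C => x Ix; rewrite -fg// fC.
split; first by exists C => x Ix; rewrite -fg// fC.
have [h [fh hk]] := df; exists h; split=> // x Ix.
exact: (@is_derive_near R R R f g I) (fh x Ix).
Qed.

Lemma symb_bound k l f : symb k l f ->
  exists C, forall x, I x -> `|f x| <= C * x `^ l.
Proof. by case: k => [|k] []. Qed.

Lemma symbS k l f : symb k.+1 l f -> symb k l f.
Proof.
elim: k l f => [|k IH] l f [fC [g [fg gk]]]; split=> //.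
by exists g; split=> //; exact: IH.
Qed.

(** The comparison of powers is a hypothesis because its direction depends on the end: [l <= l']
    beyond 1, [l' <= l] on (0, 1). It passes to derivatives with the same constant, after division
    by [x]. *)
Lemma symb_mono k l l' f : (exists C, forall x, I x -> x `^ l <= C * x `^ l') ->
  symb k l f -> symb k l' f.
Proof.
elim: k l l' f => [|k IH] l l' f [C lC] [[D fD] df]; split=> //.
- exists (`|D| * C) => x Ix; apply: le_trans (fD x Ix) _.
  rewrite -mulrA; apply: le_trans (ler_wpM2l (normr_ge0 D) (lC x Ix)).
  by rewrite ler_wpM2r ?powR_ge0// ler_norm.
- exists (`|D| * C) => x Ix; apply: le_trans (fD x Ix) _.
  rewrite -mulrA; apply: le_trans (ler_wpM2l (normr_ge0 D) (lC x Ix)).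
  by rewrite ler_wpM2r ?powR_ge0// ler_norm.
- have [g [fg gk]] := df; exists g; split=> //; apply: IH gk.
  exists C => x Ix; have x0 := I0 Ix.
  by rewrite !powRD ?mulrA ?(gt_eqF x0) ?implybT// ler_wpM2r ?powR_ge0// lC.
Qed.

Lemma symbD k l f g :
  symb k l f -> symb k l g -> symb k l (fun x => f x + g x).
Proof.
have B (C D : R) (f' g' : R -> R) : (forall x, I x -> `|f' x| <= C * x `^ l) ->
    (forall x, I x -> `|g' x| <= D * x `^ l) ->
    exists E, forall x, I x -> `|f' x + g' x| <= E * x `^ l.
  move=> fC gD; exists (C + D) => x Ix; apply: le_trans (ler_normD _ _) _.
  by rewrite mulrDl lerD// ?fC ?gD.
elim: k l f g B => [|k IH] l f g B [[C fC] df] [[D gD] dg].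
  by split=> //; exact: B fC gD.
split; first exact: B fC gD.
have [f' [ff' fk]] := df; have [g' [gg' gk]] := dg.
exists (fun x => f' x + g' x); split.
  by move=> x Ix; apply: is_deriveD; [exact: ff' | exact: gg'].
apply: IH => // C' D' f1 g1 fC' gD'.
exists (C' + D') => x Ix; apply: le_trans (ler_normD _ _) _.
by rewrite mulrDl lerD// ?fC' ?gD'.
Qed.

Lemma symbM k l l' f g :
  symb k l f -> symb k l' g -> symb k (l + l') (fun x => f x * g x).
Proof.
have B (m m' C D : R) (f' g' : R -> R) :
    (forall x, I x -> `|f' x| <= C * x `^ m) ->
    (forall x, I x -> `|g' x| <= D * x `^ m') ->
    exists E, forall x, I x -> `|f' x * g' x| <= E * x `^ (m + m').
  move=> fC gD; exists (C * D) => x Ix; rewrite normrM.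
  rewrite powRD ?(gt_eqF (I0 Ix)) ?implybT// mulrACA.
  by apply: ler_pM => //; [exact: fC | exact: gD].
elim: k l l' f g => [|k IH] l l' f g.
  by move=> [[C fC] _] [[D gD] _]; split=> //; exact: B fC gD.
move=> fk gk; have [[C fC] [f' [ff' fk']]] := fk.
have [[D gD] [g' [gg' gk']]] := gk.
split; first exact: B fC gD.
exists (fun x => f x * g' x + g x * f' x); split.
  by move=> x Ix; apply: is_deriveM; [exact: ff' | exact: gg'].
apply: symbD.
  by rewrite -addrA; apply: IH => //; exact: symbS.
have -> : l + l' - 1 = l' + (l - 1) by ring.
by apply: IH => //; exact: symbS.
Qed.

Lemma symb_cst0 k l : symb k l (fun _ => 0).
Proof.
elim: k l => [|k IH] l; split=> //.
- by exists 0 => x _; rewrite normr0 mul0r.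
- by exists 0 => x _; rewrite normr0 mul0r.
- by exists (fun=> 0); split=> [x _|//]; exact: is_derive_cst.
Qed.

Lemma symb_cst k c : symb k 0 (fun _ => c).
Proof.
have B : exists C, forall x, I x -> `|c| <= C * x `^ 0.
  by exists `|c| => x _; rewrite powRr0 mulr1.
case: k => [|k]; split=> //.
exists (fun=> 0); split=> [x _|]; first exact: is_derive_cst.
exact: symb_cst0.
Qed.

Lemma symb_pow k a : symb k a (fun x => x `^ a).
Proof.
have B b : exists C, forall x, I x -> `|x `^ b| <= C * x `^ b.
  by exists 1 => x _; rewrite mul1r ger0_norm ?powR_ge0.
elim: k a => [|k IH] a; split=> //.
exists (fun x => a * x `^ (a - 1)); split=> [x Ix|].
  exact: is_derive1_powR (I0 Ix).
by rewrite -[X in symb _ X _]add0r; apply: symbM => //; exact: symb_cst.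
Qed.

(** The values of [f] lie in an interval [e, C], on which every power is bounded: by [C^a] when
    [a >= 0], by [e^a] otherwise. *)
Lemma symb_powR k (a e : R) f : 0 < e -> (forall x, I x -> e <= f x) ->
  symb k 0 f -> symb k 0 (fun x => f x `^ a).
Proof.
move=> e0 ef; elim: k a => [|k IH] a fk.
  have [[C fC] _] := fk; split=> //; exists (e `^ a + C `^ a) => x Ix.
  have := fC x Ix; rewrite powRr0 !mulr1 => fxC.
  have efx := ef x Ix; have f0 := lt_le_trans e0 efx.
  rewrite ger0_norm ?powR_ge0//; have [a0|a0] := leP 0 a.
    apply: (@le_trans _ _ (C `^ a)); last by rewrite lerDr powR_ge0.
    apply: ge0_ler_powR => //; rewrite ?nnegrE ?(ltW f0)//.
      by apply: le_trans fxC; exact: normr_ge0.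
    by apply: le_trans fxC; exact: ler_norm.
  apply: (@le_trans _ _ (e `^ a)); last by rewrite lerDl powR_ge0.
  rewrite -[a]opprK powRN [leRHS]powRN lef_pV2 ?posrE ?powR_gt0//.
  by apply: ge0_ler_powR; rewrite ?nnegrE ?(ltW f0) ?(ltW e0)// oppr_ge0 ltW.
have [_ [f' [ff' fk']]] := fk; have B := symb_bound (IH a (symbS fk)).
split=> //; exists (fun x => a * f x `^ (a - 1) * f' x); split=> [x Ix|].
  apply: (@is_derive_comp_outer _ _ f ((@powR R) ^~ a)); last exact: ff'.
  by apply: is_derive1_powR; exact: lt_le_trans e0 (ef x Ix).
rewrite -[0 - 1]add0r; apply: symbM; last exact: fk'.
rewrite -[X in symb _ X _]add0r.
by apply: symbM; [exact: symb_cst | apply: IH; exact: symbS].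
Qed.

Lemma symbol_eq l f g :
  (forall x, I x -> f x = g x) -> symbol l f -> symbol l g.
Proof. by move=> fg fl k; apply: symb_eq (fl k). Qed.

Lemma symbol_mono l l' f : (exists C, forall x, I x -> x `^ l <= C * x `^ l') ->
  symbol l f -> symbol l' f.
Proof. by move=> ll' fl k; apply: symb_mono (fl k). Qed.

Lemma symbolD l f g :
  symbol l f -> symbol l g -> symbol l (fun x => f x + g x).
Proof. by move=> fl gl k; apply: symbD. Qed.

Lemma symbolM l l' f g :
  symbol l f -> symbol l' g -> symbol (l + l') (fun x => f x * g x).
Proof. by move=> fl gl k; apply: symbM. Qed.

Lemma symbol0 l : symbol l (fun _ => 0).
Proof. by move=> k; exact: symb_cst0. Qed.

Lemma symbol_cst c : symbol 0 (fun _ => c).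
Proof. by move=> k; exact: symb_cst. Qed.

Lemma symbol_pow a : symbol a (fun x => x `^ a).
Proof. by move=> k; exact: symb_pow. Qed.

Lemma symbol_exprn n : symbol n%:R (fun x => x ^+ n).
Proof.
apply: symbol_eq (symbol_pow n%:R) => x Ix.
by rewrite powR_mulrn// ltW// I0.
Qed.

Lemma symbol_id : symbol 1 id.
Proof. exact: (symbol_exprn 1). Qed.

Lemma symbol_inv : symbol (-1) (fun x => x^-1).
Proof.
by apply: symbol_eq (symbol_pow (-1)) => x Ix; rewrite powR_inv1// ltW// I0.
Qed.

Lemma symbolZ l c f : symbol l f -> symbol l (fun x => c * f x).
Proof. by move=> fl; rewrite -[l]add0r; apply: symbolM => //; exact: symbol_cst. Qed.

Lemma symbolN l f : symbol l f -> symbol l (fun x => - f x).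
Proof.
by move/(@symbolZ l (-1)); apply: symbol_eq => x _; rewrite mulN1r.
Qed.

Lemma symbolB l f g :
  symbol l f -> symbol l g -> symbol l (fun x => f x - g x).
Proof. by move=> fl /symbolN; exact: symbolD. Qed.

Lemma symbol_powR (a e : R) f : 0 < e -> (forall x, I x -> e <= f x) ->
  symbol 0 f -> symbol 0 (fun x => f x `^ a).
Proof. by move=> e0 ef fl k; apply: symb_powR ef (fl k). Qed.

Lemma symbolV (e : R) f : 0 < e -> (forall x, I x -> e <= f x) ->
  symbol 0 f -> symbol 0 (fun x => (f x)^-1).
Proof.
move=> e0 ef /(symbol_powR (-1) e0 ef); apply: symbol_eq => x /ef efx.
by rewrite powR_inv1// (le_trans (ltW e0)).
Qed.

Lemma symbol_sqrt (e : R) f : 0 < e -> (forall x, I x -> e <= f x) ->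
  symbol 0 f -> symbol 0 (fun x => Num.sqrt (f x)).
Proof.
move=> e0 ef /(symbol_powR 2^-1 e0 ef); apply: symbol_eq => x /ef efx.
by rewrite powR12_sqrt// (le_trans (ltW e0)).
Qed.

(** Uniqueness of the derivative identifies [f'] with the witness contained in the symbol. *)
Lemma symbol_derive l f f' : (forall x, I x -> is_derive x 1 f (f' x)) ->
  symbol l f -> symbol (l - 1) f'.
Proof.
move=> ff' fl k; have [_ [g [fg gk]]] := fl k.+1.
apply: symb_eq gk => x Ix; have [_ <-] := fg x Ix.
by have [_ <-] := ff' x Ix.
Qed.

Lemma symbol_is_derive l f : symbol l f -> exists f',
  (forall x, I x -> is_derive x 1 f (f' x)) /\ symbol (l - 1) f'.
Proof.
move=> fl; have [_ [g [fg _]]] := fl 1%N; exists g; split=> //.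
exact: symbol_derive fg fl.
Qed.

End Symbols.

(** * Laplace expansion *)

(* Unlike \det, this reduces by computation. *)
Fixpoint ldet (K : comNzRingType) (n : nat) (f : nat -> nat -> K) : K :=
  if n is m.+1 then
    foldr (fun k x => f 0 k * ((-1) ^+ k * ldet m (fun i j => f i.+1 (bump k j))) + x)
      0 (iota 0 n)
  else 1.

Lemma det_ldet (K : comNzRingType) (n : nat) (f : nat -> nat -> K) :
  \det (\matrix_(i < n, j < n) f i j) = ldet n f.
Proof.
elim: n f => [|n IH] f; first by rewrite det_mx00.
have foldE (r : seq nat) (F : nat -> K) :
    foldr (fun k x => F k + x) 0 r = \sum_(k <- r) F k.
  by elim: r => [|k r IHr]; rewrite ?big_nil// big_cons /= IHr.
have -> : ldet n.+1 f = \sum_(0 <= k < n.+1)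
    f 0 k * ((-1) ^+ k * ldet n (fun i j => f i.+1 (bump k j))) by exact: foldE.
rewrite (expand_det_row _ ord0) big_mkord.
apply: eq_bigr => k _; rewrite mxE /cofactor -IH; congr (_ * (_ * \det _)).
by apply/matrixP => i j; rewrite !mxE.
Qed.

(** * Rotations *)

Section Rotations.
Context {R : realType}.

Lemma ord3P (P : 'I_3 -> Prop) :
  P (@Ordinal 3 0 isT) -> P (@Ordinal 3 1 isT) -> P (@Ordinal 3 2 isT) ->
  forall i, P i.
Proof.
move=> P0 P1 P2 [[|[|[|//]]] lt]; rewrite (bool_irrelevance lt isT) //.
Qed.

Lemma ord4P (P : 'I_4 -> Prop) :
  P (@Ordinal 4 0 isT) -> P (@Ordinal 4 1 isT) -> P (@Ordinal 4 2 isT) ->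
  P (@Ordinal 4 3 isT) -> forall i, P i.
Proof.
move=> P0 P1 P2 P3 [[|[|[|[|//]]]] lt]; rewrite (bool_irrelevance lt isT) //.
Qed.

Lemma sum3 (V : nmodType) (F : 'I_3 -> V) :
  \sum_i F i = F (@Ordinal 3 0 isT) + F (@Ordinal 3 1 isT) + F (@Ordinal 3 2 isT).
Proof.
rewrite !big_ord_recl big_ord0 addr0 addrA.
by congr (F _ + F _ + F _); apply/val_inj.
Qed.

Lemma so3gen_table (i : 'I_3) : (so3gen i : 'M[R]_3) =
  \matrix_(a, b) nth 0 (nth [::] (nth [::] [::
    [:: [:: 0; 0; 0]; [:: 0; 0; 1]; [:: 0; -1; 0]];
    [:: [:: 0; 0; -1]; [:: 0; 0; 0]; [:: 1; 0; 0]];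
    [:: [:: 0; 1; 0]; [:: -1; 0; 0]; [:: 0; 0; 0]]] i) a) b.
Proof.
apply/matrixP => a b; rewrite !mxE.
by elim/ord3P: i; elim/ord3P: a; elim/ord3P: b => /=; ring.
Qed.

Lemma rot_SO3 (i : 'I_3) (e : R) : SO3 (Defs.rot i e).
Proof.
have E := sin2cos2 e.
pose f (a b : nat) : R := nth 0 (nth [::] (nth [::] [::
    [:: [:: 1; 0; 0]; [:: 0; cos e; sin e]; [:: 0; - sin e; cos e]];
    [:: [:: cos e; 0; - sin e]; [:: 0; 1; 0]; [:: sin e; 0; cos e]];
    [:: [:: cos e; sin e; 0]; [:: - sin e; cos e; 0]; [:: 0; 0; 1]]] i) a) b.
have -> : Defs.rot i e = \matrix_(a, b) f a b.
  rewrite /Defs.rot so3gen_table; apply/matrixP => a b; rewrite !mxE sum3 !mxE /f.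
  by elim/ord3P: i @f; elim/ord3P: a; elim/ord3P: b => /=; ring.
split.
  apply/matrixP => a b; rewrite !mxE sum3 !mxE /f.
  by elim/ord3P: i @f; elim/ord3P: a; elim/ord3P: b => /=; ring: E.
by rewrite det_ldet /f; elim/ord3P: i @f => /=; ring: E.
Qed.

Lemma SO3_mul (A B : 'M[R]_3) : SO3 A -> SO3 B -> SO3 (A *m B).
Proof.
move=> [A1 dA] [B1 dB]; split; last by rewrite det_mulmx dA dB mulr1.
by rewrite trmx_mul mulmxA -(mulmxA A) B1 mulmx1.
Qed.

Lemma is_derive_rot (i : 'I_3) : is_derive (0 : R) 1 (@Defs.rot R i) (so3gen i).
Proof.
apply: is_derive_mx => a b.
rewrite (_ : (fun y => _) = fun e : R => (1%:M : 'M[R]_3) a b + sin e * so3gen i a b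
  + (1 - cos e) * (so3gen i *m so3gen i) a b); last first.
  by apply/funext => e; rewrite !mxE.
move: (so3gen i a b) ((so3gen i *m so3gen i) a b) => x y.
by apply: is_derive_eq; rewrite /GRing.scale /= sin0 cos0; ring.
Qed.

End Rotations.

(** * Covariant derivatives on the cone *)

Section ConeTensors.
Context {R : realType} (I : set R).
Hypothesis oI : open I.
Hypothesis I0 : forall x, I x -> 0 < x.

Definition cyl : set (@cylpt R) := [set p | I p.1 /\ SO3 p.2].

(** The components of a left-invariant tensor in the left-invariant frame depend on R alone.
    Agreement with [F] is asked on [cyl] only, nothing being known about matrices outside SO(3). *)
Definition radial (l : R) (f : @cylpt R -> R) : Prop :=
  exists2 F, (forall p, cyl p -> f p = F p.1) & symbol I l F.

Lemma radial_eq l f g : (forall p, cyl p -> f p = g p) -> radial l f -> radial l g.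
Proof. by move=> fg [F fF Fl]; exists F => // p cp; rewrite -fg// fF. Qed.

Lemma radialD l f g : radial l f -> radial l g -> radial l (fun p => f p + g p).
Proof.
move=> [F fF Fl] [G gG Gl]; exists (fun x => F x + G x); last exact: symbolD.
by move=> p cp; rewrite fF// gG.
Qed.

Lemma radialM l l' f g :
  radial l f -> radial l' g -> radial (l + l') (fun p => f p * g p).
Proof.
move=> [F fF Fl] [G gG Gl]; exists (fun x => F x * G x); last exact: symbolM.
by move=> p cp; rewrite fF// gG.
Qed.

Lemma radial0 l : radial l (fun=> 0).
Proof. by exists (fun=> 0) => //; exact: symbol0. Qed.

Lemma radialZ l c f : radial l f -> radial l (fun p => c * f p).
Proof.
move=> [F fF Fl]; exists (fun x => c * F x); last exact: symbolZ.
by move=> p cp; rewrite fF.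
Qed.

Lemma radialN l f : radial l f -> radial l (fun p => - f p).
Proof.
by move/(@radialZ _ (-1)); apply: radial_eq => p _; rewrite mulN1r.
Qed.

Lemma radialB l f g : radial l f -> radial l g -> radial l (fun p => f p - g p).
Proof. by move=> fl /radialN; exact: radialD. Qed.

Lemma radial_sum l (J : Type) (r : seq J) (f : J -> @cylpt R -> R) :
  (forall i, radial l (f i)) -> radial l (fun p => \sum_(i <- r) f i p).
Proof.
move=> fl; elim: r => [|i r IH].
  by apply: radial_eq (radial0 l) => p _; rewrite big_nil.
by apply: radial_eq (radialD (fl i) IH) => p _; rewrite big_cons.
Qed.

Lemma radial_prod (J : Type) (r : seq J) (l : J -> R) (f : J -> @cylpt R -> R) :
  (forall i, radial (l i) (f i)) ->
  radial (\sum_(i <- r) l i) (fun p => \prod_(i <- r) f i p).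
Proof.
move=> fl; elim: r => [|i r IH].
  exists (fun=> 1); first by move=> p _; rewrite big_nil.
  by rewrite big_nil; exact: symbol_cst.
rewrite big_cons; apply: radial_eq (radialM (fl i) IH) => p _.
by rewrite big_cons.
Qed.

Lemma radial_bound l f : radial l f ->
  exists C, forall p, cyl p -> `|f p| <= C * p.1 `^ l.
Proof.
move=> [F fF /(_ 0%N)/symb_bound[C FC]]; exists C => p cp.
by rewrite fF//; apply: FC; case: cp.
Qed.

Lemma flow0 e (p : @cylpt R) : flow ord0 e p = (p.1 + e, p.2).
Proof. by rewrite /flow unlift_none. Qed.

Lemma flow_lift i e (p : @cylpt R) : flow (lift ord0 i) e p = (p.1, p.2 *m Defs.rot i e).
Proof. by rewrite /flow liftK. Qed.

(** Only the ray through [p] matters, as the flow of [X_0] fixes the rotation. Maps that do depend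
    on the rotation, such as the parametrization of an end, are thereby covered. *)
Lemma frame_der0 (V : normedModType R) (f : @cylpt R -> V) F p d :
  cyl p -> (forall q, cyl q -> q.2 = p.2 -> f q = F q.1) -> is_derive p.1 1 F d ->
  frame_der ord0 f p = d.
Proof.
move=> [Ip Sp] fF dF; rewrite /frame_der derive1E.
have : is_derive (0 : R) 1 (fun e => F (e *: (1 : R) + p.1)) d.
  exact/(derivable_lineE F p.1 1 d).1.
move=> dF'.
suff [_ <-] : is_derive (0 : R) 1 (fun e => f (flow ord0 e p)) d by [].
apply: (@is_derive_near R R V _ _ [set e | I (e + p.1)] 0 1 d _ _ _ dF').
- apply: (@open_comp _ _ (fun e : R => e + p.1)) => // x _.
  by apply: cvgD; [exact: cvg_id | exact: cvg_cst].
- by rewrite /= add0r.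
- move=> e /= Ie; rewrite flow0 fF//=; first by rewrite addrC [_ *: _]mulr1.
  by split; rewrite //= addrC.
Qed.

Lemma frame_der_lift (V : normedModType R) (f : @cylpt R -> V) F i p :
  cyl p -> (forall q, cyl q -> f q = F q.1) -> frame_der (lift ord0 i) f p = 0.
Proof.
move=> [Ip Sp] fF; rewrite /frame_der.
rewrite (_ : (fun e => _) = cst (F p.1)); last first.
  apply/funext => e; rewrite flow_lift fF//; split=> //=.
  by apply: SO3_mul => //; exact: rot_SO3.
by rewrite derive1_cst.
Qed.

(* The order of growth of the frame vector X_a in the metric of a cone. *)
Definition wt (a : 'I_4) : R := (a != ord0)%:R.

(** Along [X_0], of weight 0, the order drops by one. Along SO(3) the derivative is 0, which has
    every order, in particular [l + 1 - 1]. *)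
Lemma radial_frame_der l a f :
  radial l f -> radial (l + wt a - 1) (frame_der a f).
Proof.
move=> [F fF Fl]; case: (unliftP ord0 a) => [i|] ->.
  apply: radial_eq (radial0 _) => p cp.
  by rewrite (frame_der_lift _ cp fF).
have [F' [dF F'l]] := symbol_is_derive oI Fl.
exists F'; last by rewrite /wt eqxx addr0.
move=> p cp; apply: (frame_der0 cp) => [q cq _|]; first exact: fF.
by apply: dF; case: cp.
Qed.

Variables (q1 q2 q3 : R).
Hypotheses (q1_gt0 : 0 < q1) (q2_gt0 : 0 < q2) (q3_gt0 : 0 < q3).

Let g0 := cone_metric q1 q2 q3.

Let D (a : 'I_4) (x : R) : R := nth 0 [:: 1; x ^+ 2 * q1; x ^+ 2 * q2; x ^+ 2 * q3] a.

Let g0E p a b : g0 p a b = D a p.1 *+ (a == b).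
Proof. by rewrite /g0 /cone_metric !mxE. Qed.

Let D_gt0 a x : I x -> 0 < D a x.
Proof.
move=> /I0 x0.
by elim/ord4P: a; rewrite /D //= mulr_gt0// exprn_gt0.
Qed.

Let symbol_D a : symbol I (wt a + wt a) (D a).
Proof.
have H (b : R) : symbol I (1 + 1) (fun x => x ^+ 2 * b).
  rewrite -[1 + 1]addr0; apply: symbolM => //; last exact: symbol_cst.
  exact: (symbol_exprn oI I0 2).
elim/ord4P: a; rewrite /D /wt /=; try exact: H.
by rewrite addr0; exact: symbol_cst.
Qed.

Let symbol_DV a : symbol I (- wt a - wt a) (fun x => (D a x)^-1).
Proof.
have H (b : R) : symbol I (- 1 - 1) (fun x => (x ^+ 2 * b)^-1).
  rewrite -[-1 - 1]addr0.
  apply: (@symbol_eq _ _ oI _ (fun x => x^-1 * x^-1 * b^-1)).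
    by move=> x _; rewrite -!invfM expr2.
  apply: symbolM => //; last exact: symbol_cst.
  by apply: symbolM => //; exact: symbol_inv.
elim/ord4P: a; rewrite /D /wt /=; try exact: H.
by rewrite subr0 oppr0 invr1; exact: symbol_cst.
Qed.

Let radial_g0 a b : radial (wt a + wt b) (fun p => g0 p a b).
Proof.
have [<-|ab] := eqVneq a b.
  by exists (D a) => [p _|]; [rewrite g0E eqxx | exact: symbol_D].
by apply: radial_eq (radial0 _) => p _; rewrite g0E (negPf ab).
Qed.

Let invmx_g0 p : cyl p -> invmx (g0 p) = \matrix_(a, b) ((D a p.1)^-1 *+ (a == b)).
Proof.
move=> [Ip _]; set B := \matrix_(a, b) _.
have E : g0 p *m B = 1%:M.
  apply/matrixP => a b; rewrite !mxE (bigD1 a)//= big1 ?addr0.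
    rewrite g0E eqxx mxE mulr1n; have [_|_] := eqVneq a b; last by rewrite mulr0.
    by rewrite mulfV// gt_eqF// D_gt0.
  by move=> c /negPf ca; rewrite g0E eq_sym ca mul0r.
have [u _] := mulmx1_unit E.
by rewrite -[LHS]mulmx1 -E mulmxA mulVmx// mul1mx.
Qed.

Let radial_inv a b : radial (- wt a - wt b) (fun p => invmx (g0 p) a b).
Proof.
have [<-|ab] := eqVneq a b.
  exists (fun x => (D a x)^-1) => [p cp|]; last exact: symbol_DV.
  by rewrite invmx_g0// mxE eqxx.
by apply: radial_eq (radial0 _) => p cp; rewrite invmx_g0// mxE (negPf ab).
Qed.

(** A structure constant can be nonzero only when its three indices are tangent to SO(3); then
    [wt a + wt b - 1 = 1] is the weight of the index summed over. *)
Let radial_bracket a b d :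
  radial (wt a + wt b + wt d - 1) (bracket_metric g0 a b d).
Proof.
apply: radial_sum => f; rewrite /bracket_coef.
have Z l h : radial l (fun p : @cylpt R => 0 * h p).
  by apply: radial_eq (radial0 _) => p _; rewrite mul0r.
case: (unliftP ord0 a) => [i ->|_]; last exact: Z.
case: (unliftP ord0 b) => [j ->|_]; last exact: Z.
case: (unliftP ord0 f) => [k ->|_]; last exact: Z.
apply: radialZ; have := radial_g0 (lift ord0 k) d.
by rewrite /wt !(eq_sym _ ord0) !neq_lift; congr radial; rewrite /=; ring.
Qed.

(** Derivatives of the coefficients and bracket terms all have the same order, which is symmetric in
    the three indices. *)
Let radial_koszul a b d : radial (wt a + wt b + wt d - 1) (koszul g0 a b d).
Proof.
have F x y z : radial (wt x + wt y + wt z - 1)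
    (frame_der x (fun q => g0 q y z)).
  have := radial_frame_der x (radial_g0 y z).
  by congr radial; ring.
apply: radialZ.
apply: radialD; last first.
  by have := radial_bracket d a b; congr radial; ring.
apply: radialB; last first.
  by have := radial_bracket b d a; congr radial; ring.
apply: radialD; last exact: radial_bracket.
apply: radialB; last by have := F d a b; congr radial; ring.
apply: radialD; first exact: F.
by have := F b d a; congr radial; ring.
Qed.

Lemma radial_christoffel a b d :
  radial (wt a + wt b - wt d - 1) (christoffel g0 a b d).
Proof.
apply: radial_sum => f; have := radialM (radial_inv d f) (radial_koszul a b f).
by congr radial; ring.
Qed.

Definition wts (s : seq 'I_4) : R := \sum_(a <- s) wt a.

Lemma wts_set_nth (t : seq 'I_4) m d : (m < size t)%N ->
  wts (set_nth ord0 t m d) = wts t - wt (nth ord0 t m) + wt d.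
Proof.
elim: t m => [//|a t IH] [|m] /= lt_m; rewrite /wts !big_cons.
  by ring.
by have := IH m lt_m; rewrite /wts => ->; ring.
Qed.

Definition graded (l : R) (k : nat) (T : @tensor R) : Prop :=
  forall s, size s = k -> radial (l + wts s) (T s).

(** Replacing the index of position [m] by [d] changes the weight by [wt d - wt (nth ord0 t m)]; the
    order of the Christoffel symbol compensates this exactly and leaves [wt a - 1]. *)
Lemma graded_nabla l k T : graded l k T -> graded (l - 1) k.+1 (nabla g0 T).
Proof.
move=> Tl [//|a t] [tk]; rewrite /wts big_cons -/(wts t).
apply: (@radialB _ (frame_der a (T t))).
  by have := radial_frame_der a (Tl t tk); congr radial; ring.
apply: radial_sum => m; apply: radial_sum => d.
have st : size (set_nth ord0 t m d) = k.
  by rewrite size_set_nth (maxn_idPr _).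
have := radialM (radial_christoffel a (nth ord0 t m) d) (Tl _ st).
by rewrite wts_set_nth//; congr radial; ring.
Qed.

Lemma graded_nabla_iter l k T j :
  graded l k T -> graded (l - j%:R) (j + k) (iter j (nabla g0) T).
Proof.
move=> Tl; elim: j => [|j IH]; first by rewrite subr0.
by have := graded_nabla IH; congr graded; rewrite -natr1; ring.
Qed.

(** The inverse metric contributes minus the weights of both index sequences, so every term of the
    squared norm has order [2 l], whatever the indices. *)
Lemma tensor_norm_bound l k T : graded l k T ->
  exists C, forall p, cyl p -> tensor_norm g0 k T p <= C * p.1 `^ l.
Proof.
move=> Tl; set S := fun p => \sum_(s : k.-tuple 'I_4) \sum_(t : k.-tuple 'I_4)
    (\prod_(m < k) invmx (g0 p) (tnth s m) (tnth t m)) * T s p * T t p.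
have /radial_bound[C SC] : radial (l + l) S.
  apply: radial_sum => s; apply: radial_sum => t.
  have := radialM (radialM (radial_prod (index_enum 'I_k)
    (fun m => radial_inv (tnth s m) (tnth t m)))
    (Tl s (size_tuple s))) (Tl t (size_tuple t)).
  by rewrite sumrB sumrN /wts !big_tuple; congr radial; ring.
exists (Num.sqrt C) => p cp; rewrite /tensor_norm -/(S p).
have p0 : 0 < p.1 by apply: I0; case: cp.
have -> : p.1 `^ l = Num.sqrt (p.1 `^ (l + l)).
  rewrite powRD ?(gt_eqF p0) ?implybT// -expr2 sqrtr_sqr.
  by rewrite ger0_norm// powR_ge0.
(* The bound at [p] itself forces the constant to be nonnegative. *)
have C0 : 0 <= C.
  by rewrite -(pmulr_lge0 _ (powR_gt0 (l + l) p0)); apply: le_trans (SC p cp).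
rewrite -sqrtrM// ler_wsqrtr//.
by apply: le_trans (SC p cp); exact: ler_norm.
Qed.

Lemma metric_deviation_bound rate (G : @metric_field R) j :
  (forall a b, radial (rate + wt a + wt b) (fun p => G p a b - g0 p a b)) ->
  exists C, forall p, cyl p ->
    metric_deviation G g0 j p <= C * p.1 `^ (rate - j%:R).
Proof.
move=> Gr; have Gg : graded rate 2 (metric_tensor (fun q => G q - g0 q)).
  move=> [//|a [//|b [|//]]] _ /=; rewrite /wts !big_cons big_nil addr0 addrA.
  have subE (A B : 'M[R]_4) : (A - B) a b = A a b - B a b by rewrite !mxE.
  by apply: radial_eq (Gr a b) => p _; exact: (esym (subE (G p) (g0 p))).
by have := tensor_norm_bound (graded_nabla_iter (j := j) Gg); rewrite addn2.
Qed.

End ConeTensors.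

(** * The Hodge star on the four-sphere *)

Section HodgeStar.
Context {R : realType}.

Lemma ord5P (P : 'I_5 -> Prop) :
  P (@Ordinal 5 0 isT) -> P (@Ordinal 5 1 isT) -> P (@Ordinal 5 2 isT) ->
  P (@Ordinal 5 3 isT) -> P (@Ordinal 5 4 isT) -> forall i, P i.
Proof.
move=> P0 P1 P2 P3 P4 [[|[|[|[|[|//]]]]] lt]; rewrite (bool_irrelevance lt isT) //.
Qed.

Lemma sum5 (V : nmodType) (F : 'I_5 -> V) :
  \sum_i F i = F (@Ordinal 5 0 isT) + F (@Ordinal 5 1 isT) + F (@Ordinal 5 2 isT)
    + F (@Ordinal 5 3 isT) + F (@Ordinal 5 4 isT).
Proof.
rewrite !big_ord_recl big_ord0 addr0 !addrA.
by congr (F _ + F _ + F _ + F _ + F _); apply/val_inj.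
Qed.

(* Skipping the zero entries keeps the evaluation of levi_civita cheap. *)
Fixpoint sparse_det (n : nat) (f : nat -> nat -> int) : int :=
  if n is m.+1 then
    foldr (fun k x => if f 0 k == 0 then x else
        f 0 k * ((-1) ^+ k * sparse_det m (fun i j => f i.+1 (bump k j))) + x)
      0 (iota 0 n)
  else 1.

Lemma sparse_detE n f : sparse_det n f = ldet n f.
Proof.
elim: n f => [//|n IH] f; rewrite /sparse_det -/sparse_det /ldet -/ldet.
elim: (iota 0 n.+1) => [//|k r IHr] /=.
by rewrite IHr IH; case: eqP => // ->; rewrite mul0r add0r.
Qed.

Definition levi_civita (m i j k l : nat) : int :=
  sparse_det 5 (fun a b => (nth 0%N [:: m; i; j; k; l] a == b)%:R).

(** Linearity in the first row: the cofactors along it do not involve [x], so each is the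
    determinant with a basis vector as first row. *)
Lemma det_unit_rows (x : 'rV[R]_5) (i j k l : 'I_5) :
  \det (\matrix_(a < 5) nth (0 : 'rV[R]_5) [:: x; 'e_i; 'e_j; 'e_k; 'e_l] a)
  = \sum_m x ord0 m * (levi_civita m i j k l)%:~R.
Proof.
pose M (y : 'rV[R]_5) :=
  \matrix_(a < 5) nth (0 : 'rV[R]_5) [:: y; 'e_i; 'e_j; 'e_k; 'e_l] a.
have cofE (y z : 'rV[R]_5) m : cofactor (M y) ord0 m = cofactor (M z) ord0 m.
  congr (_ * \det _); apply/matrixP => a b; rewrite !mxE.
  by case: a => [[|[|[|[|//]]]] ?].
rewrite (expand_det_row _ ord0); apply: eq_bigr => m _.
rewrite mxE /=; congr (_ * _); transitivity (\det (M 'e_m)).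
  rewrite (expand_det_row _ ord0) (bigD1 m)//= big1 => [|m' /negPf m'm].
    by rewrite !mxE !eqxx mul1r addr0; exact: cofE.
  by rewrite !mxE /= m'm mul0r.
rewrite /levi_civita sparse_detE -det_ldet -det_map_mx; congr (\det _).
apply/matrixP => a b; rewrite !mxE.
by elim/ord5P: a => /=; rewrite mxE /= eq_sym -val_eqE /=; case: (_ == _).
Qed.

Lemma hodgeE (x : 'rV[R]_5) (w : 'M[R]_5) (i j : 'I_5) :
  hodge x w i j = 2^-1 * \sum_(k < 5) \sum_(l < 5)
    (\sum_(m < 5) x ord0 m * (levi_civita m i j k l)%:~R) * w k l.
Proof.
rewrite mxE; congr (_ * _); apply: eq_bigr => k _; apply: eq_bigr => l _.
by rewrite det_unit_rows.
Qed.

(** Antisymmetry of [levi_civita] in these two indices is checked on all index tuples by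
    evaluation. *)
Lemma hodge_skew (x : 'rV[R]_5) (w : 'M[R]_5) (i j : 'I_5) :
  hodge x w j i = - hodge x w i j.
Proof.
have E : all (fun m => all (fun i => all (fun j => all (fun k => all (fun l =>
    levi_civita m j i k l == - levi_civita m i j k l) (iota 0 5)) (iota 0 5))
    (iota 0 5)) (iota 0 5)) (iota 0 5) by vm_compute.
have mem (k : 'I_5) : (k : nat) \in iota 0 5 by rewrite mem_iota /= ltn_ord.
have lcN m i' j' k l : levi_civita (m : 'I_5) (j' : 'I_5) (i' : 'I_5) (k : 'I_5) (l : 'I_5)
    = - levi_civita m i' j' k l.
  move/allP: E => /(_ _ (mem m))/allP/(_ _ (mem i'))/allP/(_ _ (mem j')).
  by move=> /allP/(_ _ (mem k))/allP/(_ _ (mem l))/eqP.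
rewrite !hodgeE -mulrN -sumrN; congr (_ * _); apply: eq_bigr => k _.
rewrite -sumrN; apply: eq_bigr => l _; rewrite -mulNr -sumrN; congr (_ * _).
by apply: eq_bigr => m _; rewrite lcN rmorphN mulrN.
Qed.

(** For [i <> j], only the six orderings of the three remaining indices survive among the 125
    triples. *)
Definition levi_civita_support (i j : nat) : seq (nat * nat * nat * int) :=
  [seq t <- [seq (kl, m, levi_civita m i j kl.1 kl.2) |
      kl <- [seq (k, l) | k <- iota 0 5, l <- iota 0 5], m <- iota 0 5] | t.2 != 0].

Lemma hodge_sparse (x : 'rV[R]_5) (w : 'M[R]_5) (i j : 'I_5) :
  hodge x w i j = 2^-1 * \sum_(t <- levi_civita_support i j)
    x ord0 (inord t.1.2) * t.2%:~R * w (inord t.1.1.1) (inord t.1.1.2).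
Proof.
rewrite hodgeE big_filter [in RHS]big_rmcond; last first.
  by move=> t /=; case: eqP => // -> _; rewrite mulr0 mul0r.
have ordE (F : nat -> R) : \sum_(k <- iota 0 5) F k = \sum_(k < 5) F k.
  by rewrite -(big_mkord xpredT F).
rewrite 2!big_allpairs_dep /= ordE /=; congr (_ * _); apply: eq_bigr => k _.
rewrite ordE; apply: eq_bigr => l _; rewrite ordE mulr_suml.
by apply: eq_bigr => m _; rewrite !inord_val.
Qed.

(** Skewness of [w] pairs the six surviving terms into three, and the factor 2 so produced cancels
    [2^-1]. The entries below the diagonal follow from [hodge_skew]. *)
Lemma hodge_table (x : 'rV[R]_5) (w : 'M[R]_5) : w^T = - w ->
  let X k := x ord0 k in
  [/\ [/\ hodge x w '5_0 '5_1 =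
        X '5_2 * w '5_3 '5_4 - X '5_3 * w '5_2 '5_4 + X '5_4 * w '5_2 '5_3,
      hodge x w '5_0 '5_2 =
        - X '5_1 * w '5_3 '5_4 + X '5_3 * w '5_1 '5_4 - X '5_4 * w '5_1 '5_3
    & hodge x w '5_1 '5_2 =
        X '5_0 * w '5_3 '5_4 - X '5_3 * w '5_0 '5_4 + X '5_4 * w '5_0 '5_3],
    [/\ hodge x w '5_0 '5_3 =
        X '5_1 * w '5_2 '5_4 - X '5_2 * w '5_1 '5_4 + X '5_4 * w '5_1 '5_2,
      hodge x w '5_1 '5_3 =
        - X '5_0 * w '5_2 '5_4 + X '5_2 * w '5_0 '5_4 - X '5_4 * w '5_0 '5_2
    & hodge x w '5_2 '5_3 =
        X '5_0 * w '5_1 '5_4 - X '5_1 * w '5_0 '5_4 + X '5_4 * w '5_0 '5_1],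
    [/\ hodge x w '5_0 '5_4 =
        - X '5_1 * w '5_2 '5_3 + X '5_2 * w '5_1 '5_3 - X '5_3 * w '5_1 '5_2,
      hodge x w '5_1 '5_4 =
        X '5_0 * w '5_2 '5_3 - X '5_2 * w '5_0 '5_3 + X '5_3 * w '5_0 '5_2
    & hodge x w '5_2 '5_4 =
        - X '5_0 * w '5_1 '5_3 + X '5_1 * w '5_0 '5_3 - X '5_3 * w '5_0 '5_1]
  & hodge x w '5_3 '5_4 =
        X '5_0 * w '5_1 '5_2 - X '5_1 * w '5_0 '5_2 + X '5_2 * w '5_0 '5_1].
Proof.
move=> wT X.
have W2 (k l : 'I_5) : w l k = - w k l by have /matrixP/(_ k l) := wT; rewrite !mxE.
have wE := (W2 '5_0 '5_1, W2 '5_0 '5_2, W2 '5_0 '5_3, W2 '5_0 '5_4, W2 '5_1 '5_2,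
  W2 '5_1 '5_3, W2 '5_1 '5_4, W2 '5_2 '5_3, W2 '5_2 '5_4, W2 '5_3 '5_4).
have inE k (lt : (k < 5)%N) : inord k = Ordinal lt by apply/val_inj; rewrite /= inordK.
have o := (inE 0%N isT, inE 1%N isT, inE 2%N isT, inE 3%N isT, inE 4%N isT).
split; [split|split|split|]; rewrite hodge_sparse;
  match goal with |- context [levi_civita_support ?i ?j] =>
    let v := eval vm_compute in (levi_civita_support i j) in
    have -> : levi_civita_support i j = v by vm_compute
  end; by rewrite !big_cons big_nil /= !o !wE /X; field.
Qed.

End HodgeStar.

(** * Points of the bundle of anti-self-dual forms *)

Section Vectors.
Context {R : realType}.
Implicit Types (u v : 'I_3 -> R) (A : 'M[R]_3).

Definition vec3 (a b c : R) : 'I_3 -> R := fun j => nth 0 [:: a; b; c] j.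

Definition dot u v : R := u '3_0 * v '3_0 + u '3_1 * v '3_1 + u '3_2 * v '3_2.

Definition cross u v : 'I_3 -> R :=
  vec3 (u '3_1 * v '3_2 - u '3_2 * v '3_1) (u '3_2 * v '3_0 - u '3_0 * v '3_2)
       (u '3_0 * v '3_1 - u '3_1 * v '3_0).

Definition comb A u : 'I_3 -> R :=
  fun j => A j '3_0 * u '3_0 + A j '3_1 * u '3_1 + A j '3_2 * u '3_2.

Lemma SO3_dot A : SO3 A -> forall k l : 'I_3,
  dot (fun j => A j k) (fun j => A j l) = (k == l)%:R.
Proof.
move=> [/mulmx1C/matrixP AA _] k l; have := AA k l.
by rewrite !mxE sum3 !mxE.
Qed.

Lemma det3 A : \det A =
  dot (fun j => A j '3_0) (cross (fun j => A j '3_1) (fun j => A j '3_2)).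
Proof.
have inE k (lt : (k < 3)%N) : inord k = Ordinal lt :> 'I_3.
  by apply/val_inj; rewrite /= inordK.
have -> : A = \matrix_(i < 3, j < 3) A (inord i) (inord j).
  by apply/matrixP => i j; rewrite !mxE !inord_val.
rewrite (det_ldet 3 (fun i j => A (inord i) (inord j))) /= /bump /=.
rewrite (inE 0%N isT) (inE 1%N isT) (inE 2%N isT) /dot /cross /vec3 /= !mxE !inord_val.
by ring.
Qed.

(** The matrix [B] is the adjugate of [A]. By [det A = 1] it is the inverse of [A], hence equal to
    [A^T]: a rotation is its own cofactor matrix. *)
Lemma SO3_cross A : SO3 A ->
  [/\ cross (fun j => A j '3_0) (fun j => A j '3_1) =1 (fun j => A j '3_2),
      cross (fun j => A j '3_1) (fun j => A j '3_2) =1 (fun j => A j '3_0)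
    & cross (fun j => A j '3_2) (fun j => A j '3_0) =1 (fun j => A j '3_1)].
Proof.
move=> SA; have [_ dA] := SA.
pose B : 'M[R]_3 := \matrix_(i, j) nth (fun=> 0) [::
   cross (fun j => A j '3_1) (fun j => A j '3_2);
   cross (fun j => A j '3_2) (fun j => A j '3_0);
   cross (fun j => A j '3_0) (fun j => A j '3_1)] i j.
have BA : B *m A = 1%:M.
  have d := dA; rewrite det3 in d.
  apply/matrixP => i j; rewrite !mxE sum3 !mxE.
  elim/ord3P: i; elim/ord3P: j => /=; rewrite -?d /dot /cross /vec3 /=; ring.
have [AAT _] := SA.
have E : B = A^T by rewrite -[B]mulmx1 -AAT mulmxA BA mul1mx.
by split=> j; have := congr1 (fun M : 'M[R]_3 => M _ j) E => H;
  [have := H '3_2 | have := H '3_0 | have := H '3_1]; rewrite !mxE.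
Qed.

Lemma dot_comb A u v : SO3 A -> dot (comb A u) (comb A v) = dot u v.
Proof.
move=> /SO3_dot AA.
have -> : dot (comb A u) (comb A v) = \sum_(k < 3) \sum_(l < 3)
    dot (fun j => A j k) (fun j => A j l) * (u k * v l).
  by rewrite !sum3 /dot /comb; ring.
by rewrite !sum3 !AA /dot /=; ring.
Qed.

Lemma cross_comb A u v : SO3 A -> cross (comb A u) (comb A v) =1 comb A (cross u v).
Proof.
move=> /SO3_cross[c01 c12 c20] j; rewrite /comb -c01 -c12 -c20.
by elim/ord3P: j; rewrite /cross /vec3 /=; ring.
Qed.

End Vectors.

(** * Anti-self-dual forms in terms of dot and cross products, and their SO(3)-orbits *)

Section BundlePoints.
Context {R : realType} (n3 n4 : R).
Hypothesis n1 : n3 ^+ 2 + n4 ^+ 2 = 1.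
Implicit Types y N B P : 'I_3 -> R.

(* The base point is (y, z n3, z n4), and the 2-form w has w_45 = tau, the
   components of P in Lambda^2 R^3, while N and B are its contractions with the
   vectors (0, n3, n4) and (0, - n4, n3). *)
Definition bspoint y (z tau : R) N B P : @BSamb R :=
  let X3 j := n3 * N j - n4 * B j in
  let X4 j := n4 * N j + n3 * B j in
  (\row_j nth 0 [:: y '3_0; y '3_1; y '3_2; z * n3; z * n4] j,
   \matrix_(i, j) nth 0 (nth [::] [::
     [:: 0; P '3_2; - P '3_1; X3 '3_0; X4 '3_0];
     [:: - P '3_2; 0; P '3_0; X3 '3_1; X4 '3_1];
     [:: P '3_1; - P '3_0; 0; X3 '3_2; X4 '3_2];
     [:: - X3 '3_0; - X3 '3_1; - X3 '3_2; 0; tau];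
     [:: - X4 '3_0; - X4 '3_1; - X4 '3_2; - tau; 0]] i) j).

Lemma bspoint_ext y y' z z' tau tau' N N' B B' P P' :
  y =1 y' -> z = z' -> tau = tau' -> N =1 N' -> B =1 B' -> P =1 P' ->
  bspoint y z tau N B P = bspoint y' z' tau' N' B' P'.
Proof. by move=> yy -> -> NN BB PP; rewrite /bspoint !yy !NN !BB !PP. Qed.

Lemma bspoint_skew y z tau N B P :
  (bspoint y z tau N B P).2^T = - (bspoint y z tau N B P).2.
Proof.
apply/matrixP => i j; rewrite !mxE.
by elim/ord5P: i; elim/ord5P: j => /=; ring.
Qed.

Lemma inner_row (v v' : 'rV[R]_5) : inner v v' = \sum_j v ord0 j * v' ord0 j.
Proof. by rewrite /inner big_ord1. Qed.

Lemma bspoint_inner1 y z tau N B P y' z' tau' N' B' P' :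
  inner (bspoint y z tau N B P).1 (bspoint y' z' tau' N' B' P').1
  = dot y y' + z * z'.
Proof.
rewrite inner_row sum5 !mxE /dot /=.
have n1' : n3 ^+ 2 = 1 - n4 ^+ 2 by rewrite -n1 addrK.
by ring: n1'.
Qed.

Lemma bspoint_inner2 y z tau N B P y' z' tau' N' B' P' :
  inner (bspoint y z tau N B P).2 (bspoint y' z' tau' N' B' P').2
  = 2 * (tau * tau' + dot P P' + dot N N' + dot B B').
Proof.
rewrite /inner sum5 !sum5 !mxE /dot /=.
have n1' : n3 ^+ 2 = 1 - n4 ^+ 2 by rewrite -n1 addrK.
by ring: n1'.
Qed.

(** Contraction of a 2-form with a base point: a vector of R^3, and a vector of the last plane
    expressed in the basis (n3, n4), (- n4, n3). *)
Lemma bspoint_mul y z tau N B P y' z' tau' N' B' P' :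
  (bspoint y z tau N B P).1 *m (bspoint y' z' tau' N' B' P').2 =
  \row_j nth 0 [:: - cross y P' '3_0 - z * N' '3_0; - cross y P' '3_1 - z * N' '3_1;
    - cross y P' '3_2 - z * N' '3_2;
    n3 * dot y N' - n4 * (dot y B' + z * tau');
    n4 * dot y N' + n3 * (dot y B' + z * tau')] j.
Proof.
have n1' : n3 ^+ 2 = 1 - n4 ^+ 2 by rewrite -n1 addrK.
apply/rowP => j; rewrite mxE sum5 !mxE /dot /cross /vec3.
by elim/ord5P: j => /=; ring: n1'.
Qed.

(** Elimination by certificate: [x - y] is exhibited as a combination of two quantities known to
    vanish, which leaves a ring identity. *)
Lemma lin_comb2 (a b e1 e2 x y : R) :
  e1 = 0 -> e2 = 0 -> x - y = a * e1 + b * e2 -> x = y.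
Proof. by move=> -> ->; rewrite !mulr0 addr0 => /eqP; rewrite subr_eq0 => /eqP. Qed.

(** The hypotheses are the contraction with the base point and the Hodge equations, in
    rotation-invariant form. Entries with exactly one index among the last two mix [N] and [B]
    through (n3, n4), and are recovered from [hN] and [hB] by the corresponding rotation of the
    plane. *)
Lemma bspoint_Lambda y z tau N B P :
  dot y y + z ^+ 2 = 1 -> dot y N = 0 -> dot y B = - (z * tau) ->
  dot y P = - tau ->
  (forall j, N j + cross y B j = 0) -> (forall j, B j - cross y N j - z * P j = 0) ->
  (forall j, P j = z * B j - tau * y j) -> (forall j, cross y P j = - (z * N j)) ->
  Lambda2minus (bspoint y z tau N B P).
Proof.
move=> y1 yN yB yP hN hB hP yxP; split.
- by rewrite bspoint_inner1 -expr2.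
- exact: bspoint_skew.
- rewrite bspoint_mul !yxP yN yB; apply/rowP => j; rewrite !mxE.
  by elim/ord5P: j => /=; ring.
have n1' : n3 ^+ 2 = 1 - n4 ^+ 2 by rewrite -n1 addrK.
set p := bspoint _ _ _ _ _ _.
have [[h01 h02 h12] [h03 h13 h23] [h04 h14 h24] h34] :=
  hodge_table p.1 (bspoint_skew y z tau N B P).
have lt (i j : 'I_5) : (i < j)%N -> hodge p.1 p.2 i j = - p.2 i j.
  elim/ord5P: i; elim/ord5P: j => //= _;
    rewrite ?h01 ?h02 ?h12 ?h03 ?h13 ?h23 ?h04 ?h14 ?h24 ?h34 /p !mxE /=.
  - by rewrite !hP; ring: n1'.
  - by rewrite !hP; ring: n1'.
  - by apply: (@lin_comb2 n3 (- n4) _ _ _ _ (hN '3_0) (hB '3_0)); rewrite /cross /vec3 /=; ring.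
  - by apply: (@lin_comb2 n4 n3 _ _ _ _ (hN '3_0) (hB '3_0)); rewrite /cross /vec3 /=; ring.
  - by rewrite !hP; ring: n1'.
  - by apply: (@lin_comb2 n3 (- n4) _ _ _ _ (hN '3_1) (hB '3_1)); rewrite /cross /vec3 /=; ring.
  - by apply: (@lin_comb2 n4 n3 _ _ _ _ (hN '3_1) (hB '3_1)); rewrite /cross /vec3 /=; ring.
  - by apply: (@lin_comb2 n3 (- n4) _ _ _ _ (hN '3_2) (hB '3_2)); rewrite /cross /vec3 /=; ring.
  - by apply: (@lin_comb2 n4 n3 _ _ _ _ (hN '3_2) (hB '3_2)); rewrite /cross /vec3 /=; ring.
  - by move: yP; rewrite /dot => <-; ring.
apply/matrixP => i j; rewrite [RHS]mxE.
have pT k l : p.2 l k = - p.2 k l.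
  by have /matrixP/(_ k l) := bspoint_skew y z tau N B P; rewrite !mxE.
case: (ltngtP i j) => [/lt //|/lt ji|/val_inj ->].
  by rewrite hodge_skew ji opprK; exact: pT.
have Z (a : R) : a = - a -> a = 0.
  by move=> aN; apply/eqP; rewrite -[_ == 0](mulrn_eq0 a 2) mulr2n {2}aN subrr.
have hjj := Z _ (hodge_skew p.1 p.2 j j); have pjj := Z _ (pT j j).
exact: etrans hjj (esym (etrans (congr1 -%R pjj) (oppr0 R))).
Qed.

(** Pairing the equations of the last two coordinates with (n3, n4) or with (- n4, n3) undoes the
    mixing of [N] and [B]. Only the relations from which the frame of a point is recovered are
    extracted. *)
Lemma Lambda_bspoint y z tau N B P : Lambda2minus (bspoint y z tau N B P) ->
  [/\ [/\ dot y y + z ^+ 2 = 1, dot y N = 0 & dot y B = - (z * tau)],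
      forall j, P j = z * B j - tau * y j &
      forall j, B j = cross y N j + z * P j].
Proof.
have n1' : n3 ^+ 2 = 1 - n4 ^+ 2 by rewrite -n1 addrK.
set p := bspoint _ _ _ _ _ _ => -[p1 pT pw hw].
have pE : p = bspoint y z tau N B P by [].
have [[h01 h02 h12] [h03 h13 h23] [h04 h14 h24] _] := hodge_table p.1 pT.
have H i j : hodge p.1 p.2 i j = - p.2 i j by rewrite hw !mxE.
have a3 := congr1 (fun M : 'rV[R]_5 => M ord0 '5_3) pw.
have a4 := congr1 (fun M : 'rV[R]_5 => M ord0 '5_4) pw.
move: a3 a4; rewrite pE bspoint_mul !mxE /=.
set yN := dot y N; set yB := _ + z * tau => a3 a4.
have yN0 : yN = 0.
  apply: (@lin_comb2 n3 n4 _ _ _ _ a3 a4); rewrite subr0; by ring: n1'.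
have yB0 : yB = 0.
  apply: (@lin_comb2 (- n4) n3 _ _ _ _ a3 a4); rewrite subr0; by ring: n1'.
move: h01 h02 h12 h03 h13 h23 h04 h14 h24; rewrite !H pE !mxE /=.
move=> h01 h02 h12 h03 h13 h23 h04 h14 h24.
have hP j : P j = z * B j - tau * y j.
  elim/ord3P: j; [move: h12 | move: h02 | move: h01] => h; apply/eqP;
    rewrite -subr_eq0; move/eqP: h; rewrite -subr_eq0 => /eqP h; apply/eqP.
  - by apply: (@lin_comb2 (-1) 0 _ _ _ _ h h); ring: n1'.
  - by apply: (@lin_comb2 1 0 _ _ _ _ h h); ring: n1'.
  - by apply: (@lin_comb2 (-1) 0 _ _ _ _ h h); ring: n1'.
split=> //.
- split=> //; last by apply/eqP; rewrite -subr_eq0 opprK; apply/eqP.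
  by rewrite -p1 bspoint_inner1 expr2.
- have L (a b e f : R) : a = b -> e = f -> n3 * (e - f) - n4 * (a - b) = 0.
    by move=> -> ->; rewrite !subrr !mulr0 subr0.
  elim/ord3P => /=; [have := L _ _ _ _ h03 h04 | have := L _ _ _ _ h13 h14
    | have := L _ _ _ _ h23 h24] => h; apply: (@lin_comb2 (-1) 0 _ _ _ _ h h);
    by rewrite /cross /vec3 /=; ring: n1'.
Qed.

Definition emb3 (j : 'I_3) : 'I_5 := nth '5_0 [:: '5_0; '5_1; '5_2] j.

Lemma bspoint_of (p : @BSamb R) z : p.2^T = - p.2 ->
  p.1 ord0 '5_3 = z * n3 -> p.1 ord0 '5_4 = z * n4 ->
  p = bspoint (fun j => p.1 ord0 (emb3 j)) z (p.2 '5_3 '5_4)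
    (fun j => n3 * p.2 (emb3 j) '5_3 + n4 * p.2 (emb3 j) '5_4)
    (fun j => n3 * p.2 (emb3 j) '5_4 - n4 * p.2 (emb3 j) '5_3)
    (vec3 (p.2 '5_1 '5_2) (- p.2 '5_0 '5_2) (p.2 '5_0 '5_1)).
Proof.
have n1' : n3 ^+ 2 = 1 - n4 ^+ 2 by rewrite -n1 addrK.
case: p => x w /= wT x3 x4; congr (_, _).
  by apply/rowP => j; rewrite !mxE; elim/ord5P: j.
have W k l : w l k = - w k l by have /matrixP/(_ k l) := wT; rewrite !mxE.
have W0 k : w k k = 0.
  by apply/eqP; rewrite -[_ == 0](mulrn_eq0 _ 2) mulr2n {2}W subrr.
apply/matrixP => i j; rewrite !mxE.
have wE := (W '5_0 '5_1, W '5_0 '5_2, W '5_0 '5_3, W '5_0 '5_4, W '5_1 '5_2,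
  W '5_1 '5_3, W '5_1 '5_4, W '5_2 '5_3, W '5_2 '5_4, W '5_3 '5_4).
by elim/ord5P: i; elim/ord5P: j => /=; rewrite /emb3 /vec3 /= ?W0 // ?wE; ring: n1'.
Qed.

Definition fpoint (A : 'M[R]_3) y (z tau : R) N B P :=
  bspoint (comb A y) z tau (comb A N) (comb A B) (comb A P).

(* The point with alpha of cosine k and sine o, and with fibre coordinates
   (t, 0, - s) in the frame b_0, ..., b_3 rotated by A. *)
Definition psi (k o t s : R) (A : 'M[R]_3) : @BSamb R :=
  fpoint A (vec3 k 0 0) o (t * k) (vec3 0 0 (- (s * k))) (vec3 (- (o * t)) s 0)
    (vec3 (- t) (o * s) 0).

(** Rotations preserve dot and cross products, so that all relations reduce to identities at
    [A = 1]. *)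
Lemma psi_Lambda k o t s A : k ^+ 2 + o ^+ 2 = 1 -> SO3 A ->
  Lambda2minus (psi k o t s A).
Proof.
move=> k1 SA; have k1' : k ^+ 2 = 1 - o ^+ 2 by rewrite -k1 addrK.
apply: bspoint_Lambda.
- by rewrite dot_comb// /dot /vec3 /=; ring: k1'.
- by rewrite dot_comb// /dot /vec3 /=; ring.
- by rewrite dot_comb// /dot /vec3 /=; ring.
- by rewrite dot_comb// /dot /vec3 /=; ring.
- by move=> j; rewrite cross_comb// /comb /cross /vec3 /=; ring.
- by move=> j; rewrite cross_comb// /comb /cross /vec3 /=; ring: k1'.
- by move=> j; rewrite /comb /vec3 /=; ring: k1'.
- by move=> j; rewrite cross_comb// /comb /cross /vec3 /=; ring.
Qed.

Lemma rsq_psi k o t s A : k ^+ 2 + o ^+ 2 = 1 -> SO3 A ->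
  rsq (psi k o t s A).2 = t ^+ 2 + s ^+ 2.
Proof.
move=> k1 SA; have k1' : k ^+ 2 = 1 - o ^+ 2 by rewrite -k1 addrK.
rewrite /rsq bspoint_inner2 !dot_comb// /dot /vec3 /=.
by field: k1'.
Qed.

Lemma i4E : i4 = '5_3. Proof. by apply/val_inj; rewrite /= inordK. Qed.
Lemma i5E : i5 = '5_4. Proof. by apply/val_inj; rewrite /= inordK. Qed.

Lemma psi_coord k o t s A :
  [/\ (psi k o t s A).1 ord0 i4 = o * n3, (psi k o t s A).1 ord0 i5 = o * n4
    & (psi k o t s A).2 i4 i5 = t * k].
Proof. by rewrite i4E i5E !mxE. Qed.

(** The formula of [psi] solved for the columns of [A]: the first is [y / k], the second comes from
    [B = A (- o t, s, 0)], the third from [N = A (0, 0, - s k)]. *)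
Definition psi_frame (k o t s : R) (p : @BSamb R) : 'M[R]_3 :=
  let a j := k^-1 * p.1 ord0 (emb3 j) in
  \matrix_(j, l) nth 0 [:: a j;
    s^-1 * (n3 * p.2 (emb3 j) '5_4 - n4 * p.2 (emb3 j) '5_3 + o * t * a j);
    - ((s * k)^-1 * (n3 * p.2 (emb3 j) '5_3 + n4 * p.2 (emb3 j) '5_4))] l.

Lemma psi_frameK k o t s A : k != 0 -> s != 0 ->
  psi_frame k o t s (psi k o t s A) = A.
Proof.
have n1' : n3 ^+ 2 = 1 - n4 ^+ 2 by rewrite -n1 addrK.
move=> k0 s0; apply/matrixP => j l; rewrite !mxE.
elim/ord3P: j; elim/ord3P: l; rewrite /comb /vec3 /=; field: n1'; by rewrite ?k0 ?s0.
Qed.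

(** The prescribed data fix |y| = k and |N| = s k, and anti-self-duality makes y orthogonal to N.
    Hence y, y x N and - N, once normalized, are the columns of a rotation, and the points with
    these data form one orbit. *)
Lemma frame_psiK k o t s p : Lambda2minus p ->
  p.1 ord0 i4 = o * n3 -> p.1 ord0 i5 = o * n4 -> p.2 i4 i5 = t * k ->
  rsq p.2 = t ^+ 2 + s ^+ 2 -> 0 < k -> 0 < s -> k ^+ 2 + o ^+ 2 = 1 ->
  SO3 (psi_frame k o t s p) /\ psi k o t s (psi_frame k o t s p) = p.
Proof.
rewrite i4E i5E => Lp p3 p4 p34 pr k0 s0 k1.
have k1' : o ^+ 2 = 1 - k ^+ 2 by rewrite -k1 addrAC subrr add0r.
have [_ pT _ _] := Lp; have pE := bspoint_of pT p3 p4.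
rewrite p34 in pE.
set y := (fun j => p.1 ord0 (emb3 j)) in pE.
set N := (fun j => n3 * p.2 (emb3 j) '5_3 + _) in pE.
set B := (fun j => n3 * p.2 (emb3 j) '5_4 - _) in pE.
set P := vec3 _ _ _ in pE.
have [[y1 yN yB] hP hB] : [/\ [/\ dot y y + o ^+ 2 = 1, dot y N = 0
    & dot y B = - (o * (t * k))], forall j, P j = o * B j - t * k * y j &
      forall j, B j = cross y N j + o * P j].
  by apply: Lambda_bspoint; rewrite -pE.
have yy : dot y y = k ^+ 2 by apply/eqP; rewrite -(inj_eq (addIr (o ^+ 2))) y1 k1.
(* [P] is eliminated, using [1 - o^2 = k^2]. *)
have hB2 j : k ^+ 2 * B j = cross y N j - o * t * k * y j.
  have := hB j; rewrite hP => /eqP; rewrite -subr_eq0 => /eqP h.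
  by apply: (@lin_comb2 1 0 _ _ _ _ h h); ring: k1'.
have s0' := gt_eqF s0; have k0' := gt_eqF k0.
have NN : dot N N = k ^+ 2 * s ^+ 2.
  have bb : k ^+ 2 * dot B B = dot N N + o ^+ 2 * (t * k) ^+ 2.
    apply: (@mulfI R (k ^+ 2)); first by rewrite sqrf_eq0 k0'.
    have -> : k ^+ 2 * (k ^+ 2 * dot B B) =
        dot (fun j => k ^+ 2 * B j) (fun j => k ^+ 2 * B j) by rewrite /dot; ring.
    (* Lagrange's identity for |y x N|^2; the mixed term vanishes because y is orthogonal to y x
       N. *)
    transitivity (dot y y * dot N N - dot y N ^+ 2
      + o ^+ 2 * (t * k) ^+ 2 * dot y y); last by rewrite yy yN; ring.
    by rewrite /dot !hB2 /cross /vec3 /=; ring.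
  have pp : dot P P = (t * k) ^+ 2 * dot y y - 2 * (t * k) * o * dot y B
      + o ^+ 2 * dot B B by rewrite /dot !hP; ring.
  have := pr; rewrite /rsq pE bspoint_inner2 pp yy yB => e.
  have {}e : (t * k) ^+ 2 + (t * k) ^+ 2 * k ^+ 2 + 2 * (t * k) ^+ 2 * o ^+ 2
      + (1 + o ^+ 2) * dot B B + dot N N = 2 * (t ^+ 2 + s ^+ 2).
    by rewrite -e; field.
  have z (a b : R) : a = b -> a - b = 0 by move=> ->; rewrite subrr.
  (* The coefficients eliminate [dot B B] between [e] and [bb]. *)
  by apply: (@lin_comb2 (k ^+ 2 / 2) (- (1 + o ^+ 2) / 2) _ _ _ _ (z _ _ e) (z _ _ bb));
    field: k1'.
set A := psi_frame k o t s p.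
have A0 j : A j '3_0 = k^-1 * y j by rewrite !mxE.
have A1 j : A j '3_1 = s^-1 * (B j + o * t * (k^-1 * y j)) by rewrite !mxE.
have A2 j : A j '3_2 = - ((s * k)^-1 * N j) by rewrite !mxE.
(* The second column is the normalized cross product of the directions of the other two, from which
   orthogonality and orientation are immediate. *)
have A1' j : A j '3_1 = (s * k ^+ 2)^-1 * cross y N j.
  rewrite A1; apply: (@mulfI R (s * k ^+ 2)).
    by rewrite mulf_neq0 ?sqrf_eq0 ?s0' ?k0'.
  rewrite [RHS]mulrA mulfV ?mul1r; last by rewrite mulf_neq0 ?sqrf_eq0 ?s0' ?k0'.
  have := hB2 j => /eqP; rewrite -subr_eq0 => /eqP h.
  apply: (@lin_comb2 1 0 _ _ _ _ h h); field; by rewrite ?s0' ?k0'.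
have yyNN : dot (cross y N) (cross y N) = k ^+ 4 * s ^+ 2.
  transitivity (dot y y * dot N N - dot y N ^+ 2).
    by rewrite /dot /cross /vec3 /=; ring.
  by rewrite yy NN yN; ring.
have SA : SO3 A.
  have AA : A^T *m A = 1%:M.
    have d k' l : \sum_j A^T k' j * A j l = dot (fun j => A j k') (fun j => A j l).
      by rewrite sum3 /dot !mxE.
    apply/matrixP => k' l; rewrite mxE d mxE.
    elim/ord3P: k'; elim/ord3P: l; rewrite /dot ?A0 ?A1' ?A2 /=.
    - transitivity (k^-1 ^+ 2 * dot y y); first by rewrite /dot; ring.
      by rewrite yy; field; rewrite k0'.
    - by rewrite /cross /vec3 /=; ring.
    - transitivity (- (k^-1 * (s * k)^-1 * dot y N)); first by rewrite /dot; ring.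
      by rewrite yN mulr0 oppr0.
    - by rewrite /cross /vec3 /=; ring.
    - transitivity ((s * k ^+ 2)^-1 ^+ 2 * dot (cross y N) (cross y N)).
        by rewrite /dot; ring.
      by rewrite yyNN; field; rewrite k0' s0'.
    - by rewrite /cross /vec3 /=; ring.
    - transitivity (- (k^-1 * (s * k)^-1 * dot y N)); first by rewrite /dot; ring.
      by rewrite yN mulr0 oppr0.
    - by rewrite /cross /vec3 /=; ring.
    - transitivity ((s * k)^-1 ^+ 2 * dot N N); first by rewrite /dot; ring.
      by rewrite NN; field; rewrite k0' s0'.
  split; first exact: mulmx1C.
  rewrite det3.
  transitivity (k^-1 * (s * k ^+ 2)^-1 * (s * k)^-1 *
      (dot (cross y N) (cross y N))).
    by rewrite /dot /cross /vec3 /= !A0 !A1' !A2 /cross /vec3 /=; ring.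
  by rewrite yyNN; field; rewrite k0' s0'.
split=> //; rewrite [RHS]pE; apply: bspoint_ext => // j.
- by rewrite /comb /vec3 /= A0; field; rewrite k0'.
- by rewrite /comb /vec3 /= A2; field; rewrite k0' s0'.
- by rewrite /comb /vec3 /= A0 A1; field; rewrite k0' s0'.
- rewrite /comb /vec3 /= A0 A1 hP; field: k1'; by rewrite k0' s0'.
Qed.

End BundlePoints.

(** * The induced metric *)

Section InducedMetric.
Context {R : realType}.

Lemma innerE m n (A B : 'M[R]_(m, n)) : inner A B = \tr (A *m B^T).
Proof.
rewrite /mxtrace; apply: eq_bigr => i _; rewrite mxE.
by apply: eq_bigr => j _; rewrite mxE.
Qed.

(** Of the corrections produced by the two projections, the one containing [x a x^T] vanishes by
    skewness, and the other two both subtract [inner (x *m a) (x *m b)]. *)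
Lemma inner_covariant_part (x : 'rV[R]_5) (a b : 'M[R]_5) :
  inner x x = 1 -> a^T = - a -> b^T = - b ->
  inner (covariant_part x a) (covariant_part x b)
  = inner a b - 2 * inner (x *m a) (x *m b).
Proof.
move=> x1 aT bT; rewrite /covariant_part; set Pi := 1%:M - x^T *m x.
have xx : x *m x^T = 1%:M.
  by rewrite [LHS]mx11_scalar -x1 innerE /mxtrace big_ord1.
have PiT : Pi^T = Pi by rewrite /Pi linearB /= trmx1 trmx_mul trmxK.
have Pi2 : Pi *m Pi = Pi.
  rewrite {1}/Pi mulmxBl mul1mx -mulmxA (_ : x *m Pi = 0) ?mulmx0 ?subr0//.
  by rewrite /Pi mulmxBr mulmx1 mulmxA xx mul1mx subrr.
have xax : x *m a *m x^T = 0.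
  have e : (x *m a *m x^T)^T = - (x *m a *m x^T).
    by rewrite !trmx_mul trmxK aT mulNmx mulmxN mulmxA.
  have := congr1 (fun M : 'M[R]_1 => M ord0 ord0) e; rewrite [LHS]mxE [RHS]mxE.
  move=> /eqP; rewrite -subr_eq0 opprK -mulr2n mulrn_eq0 /= => /eqP z0.
  by rewrite [LHS]mx11_scalar z0 raddf0.
rewrite !innerE !trmx_mul PiT bT.
have -> : Pi *m a *m Pi *m (Pi *m (- b *m Pi)) = Pi *m (a *m Pi *m - b *m Pi).
  by rewrite !mulmxA -(mulmxA (Pi *m a)) Pi2.
rewrite mxtrace_mulC -(mulmxA _ Pi Pi) Pi2.
rewrite /Pi !mulmxBr !mulmxBl !mulmx1 !linearB /=.
have t1 (M : 'M[R]_5) : \tr (M *m (x^T *m x)) = \tr (x *m M *m x^T).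
  by rewrite mulmxA mxtrace_mulC mulmxA.
rewrite !t1 !mulmxA xax !mul0mx linear0 !oppr0 addr0.
have -> : \tr (a *m x^T *m x *m - b) = \tr (x *m a *m (- b *m x^T)).
  transitivity (\tr ((x *m - b) *m (a *m x^T))); first by rewrite -(mulmxA (a *m x^T)) mxtrace_mulC.
  rewrite -mxtrace_tr !trmx_mul trmxK linearN /= bT opprK aT.
  by rewrite mulmxN !mulNmx mulmxN.
by rewrite -!mulmxA; ring.
Qed.

Variables (n3 n4 : R).
Hypothesis n1 : n3 ^+ 2 + n4 ^+ 2 = 1.
Implicit Types (A : 'M[R]_3) (y N B P : 'I_3 -> R).

(** The right-hand side does not see [A], because SO(3) acts by isometries: the components are those
    at the identity. *)
Lemma BSmetric_fpoint c A y z tau N B P y1 z1 tau1 N1 B1 P1 y2 z2 tau2 N2 B2 P2 :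
  SO3 A -> dot y y + z ^+ 2 = 1 ->
  let p := fpoint n3 n4 A y z tau N B P in
  BSmetric c p (fpoint n3 n4 A y1 z1 tau1 N1 B1 P1) (fpoint n3 n4 A y2 z2 tau2 N2 B2 P2)
  = (c + rsq p.2) `^ (- 2^-1) * (2^-1 * (tau1 * tau2 + dot P1 P2 + dot N1 N2 + dot B1 B2
      - dot (fun j => cross y P1 j + z * N1 j) (fun j => cross y P2 j + z * N2 j)
      - dot y N1 * dot y N2
      - (dot y B1 + z * tau1) * (dot y B2 + z * tau2)))
    + 2 * (c + rsq p.2) `^ 2^-1 * (dot y1 y2 + z1 * z2).
Proof.
have n1' : n3 ^+ 2 = 1 - n4 ^+ 2 by rewrite -n1 addrK.
move=> SA yz p; rewrite /BSmetric -/p.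
congr (_ * _ + _ * _); last by rewrite bspoint_inner1// dot_comb.
rewrite inner_covariant_part; first last.
- exact: bspoint_skew.
- exact: bspoint_skew.
- by rewrite bspoint_inner1// dot_comb// -expr2.
rewrite bspoint_inner2// !bspoint_mul// inner_row sum5 !mxE /= !dot_comb//.
rewrite !cross_comb//.
have E u1 v1 u2 v2 : dot (fun j => u1 j + z * v1 j) (fun j => u2 j + z * v2 j)
    = dot (fun j => comb A u1 j + z * comb A v1 j) (fun j => comb A u2 j + z * comb A v2 j).
  rewrite -(dot_comb _ _ SA) /dot /comb; ring.
by rewrite E /dot; field: n1'.
Qed.

Lemma is_derive_bspoint (y N B P : R -> 'I_3 -> R) (z tau : R -> R) (x : R)
    y' N' B' P' (z' tau' : R) :
  (forall j, is_derive x 1 (fun e => y e j) (y' j)) -> is_derive x 1 z z' ->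
  is_derive x 1 tau tau' -> (forall j, is_derive x 1 (fun e => N e j) (N' j)) ->
  (forall j, is_derive x 1 (fun e => B e j) (B' j)) ->
  (forall j, is_derive x 1 (fun e => P e j) (P' j)) ->
  is_derive x 1 (fun e => bspoint n3 n4 (y e) (z e) (tau e) (N e) (B e) (P e))
    (bspoint n3 n4 y' z' tau' N' B' P').
Proof.
move=> dy dz dtau dN dB dP; apply: is_derive_pair; apply: is_derive_mx => i j.
  rewrite mxE (_ : (fun e => _) = fun e => nth 0 [:: y e '3_0; y e '3_1; y e '3_2;
    z e * n3; z e * n4] j); last by apply/funext => e; rewrite mxE.
  elim/ord5P: j => /=; try exact: dy.
    by apply: is_derive_eq; rewrite /GRing.scale /=; ring.
  by apply: is_derive_eq; rewrite /GRing.scale /=; ring.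
rewrite mxE; pose f e := (bspoint n3 n4 (y e) (z e) (tau e) (N e) (B e) (P e)).2.
rewrite (_ : (fun e => _) = fun e => f e i j)//.
have fE : (fun e => f e i j) = fun e => nth 0 (nth [::] [::
     [:: 0; P e '3_2; - P e '3_1; n3 * N e '3_0 - n4 * B e '3_0; n4 * N e '3_0 + n3 * B e '3_0];
     [:: - P e '3_2; 0; P e '3_0; n3 * N e '3_1 - n4 * B e '3_1; n4 * N e '3_1 + n3 * B e '3_1];
     [:: P e '3_1; - P e '3_0; 0; n3 * N e '3_2 - n4 * B e '3_2; n4 * N e '3_2 + n3 * B e '3_2];
     [:: - (n3 * N e '3_0 - n4 * B e '3_0); - (n3 * N e '3_1 - n4 * B e '3_1);
         - (n3 * N e '3_2 - n4 * B e '3_2); 0; tau e];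
     [:: - (n4 * N e '3_0 + n3 * B e '3_0); - (n4 * N e '3_1 + n3 * B e '3_1);
         - (n4 * N e '3_2 + n3 * B e '3_2); - tau e; 0]] i) j.
  by apply/funext => e; rewrite mxE.
rewrite {}fE; clear f; have dN0 := dN '3_0; have dN1 := dN '3_1; have dN2 := dN '3_2.
have dB0 := dB '3_0; have dB1 := dB '3_1; have dB2 := dB '3_2.
have dP0 := dP '3_0; have dP1 := dP '3_1; have dP2 := dP '3_2.
by elim/ord5P: i; elim/ord5P: j => /=; (exact: is_derive_cst || exact: dP || exact: dtau ||
  (apply: is_derive_eq; rewrite /GRing.scale /=; ring)).
Qed.

Definition unit3 (i : 'I_3) : 'I_3 -> R := fun j => (j == i)%:R.

(* [comb (A F_i) c = comb A (cross c e_i)]. *)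
Lemma is_derive_comb_rot A u i j :
  is_derive (0 : R) 1 (fun e => comb (A *m Defs.rot i e) u j)
    (comb A (cross u (unit3 i)) j).
Proof.
have d l : is_derive (0 : R) 1 (fun e => (A *m Defs.rot i e) j l)
    (A j '3_0 * so3gen i '3_0 l + A j '3_1 * so3gen i '3_1 l + A j '3_2 * so3gen i '3_2 l).
  have r k' : is_derive (0 : R) 1 (fun e => Defs.rot i e k' l) (so3gen i k' l).
    have [dr dE] := is_derive_rot (R := R) i; apply: DeriveDef.
      by have /derivable_mxP := dr; apply.
    by rewrite -dE derive_mx// mxE.
  have r0 := r '3_0; have r1 := r '3_1; have r2 := r '3_2.
  rewrite (_ : (fun e => _) = fun e => A j '3_0 * Defs.rot i e '3_0 l
    + A j '3_1 * Defs.rot i e '3_1 l + A j '3_2 * Defs.rot i e '3_2 l); last first.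
    by apply/funext => e; rewrite mxE sum3.
  by apply: is_derive_eq; rewrite /GRing.scale /=; ring.
have d0 := d '3_0; have d1 := d '3_1; have d2 := d '3_2; rewrite /comb.
apply: is_derive_eq; rewrite !so3gen_table !mxE /cross /unit3 /vec3 /GRing.scale /=.
clear d d0 d1 d2; by elim/ord3P: i => /=; ring.
Qed.

Lemma is_derive_fpoint_rot A y z tau N B P i :
  is_derive (0 : R) 1 (fun e => fpoint n3 n4 (A *m Defs.rot i e) y z tau N B P)
    (fpoint n3 n4 A (cross y (unit3 i)) 0 0 (cross N (unit3 i)) (cross B (unit3 i))
      (cross P (unit3 i))).
Proof.
by apply: is_derive_bspoint; (exact: is_derive_cst || (move=> j; exact: is_derive_comb_rot)).
Qed.

Definition psi_derive (k o t s k' o' t' s' : R) A : @BSamb R :=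
  fpoint n3 n4 A (vec3 k' 0 0) o' (t' * k + t * k') (vec3 0 0 (- (s' * k + s * k')))
    (vec3 (- (o' * t + o * t')) s' 0) (vec3 (- t') (o' * s + o * s') 0).

Lemma is_derive_psi (k o t s : R -> R) (x k' o' t' s' : R) A :
  is_derive x 1 k k' -> is_derive x 1 o o' -> is_derive x 1 t t' ->
  is_derive x 1 s s' ->
  is_derive x 1 (fun e => psi n3 n4 (k e) (o e) (t e) (s e) A)
    (psi_derive (k x) (o x) (t x) (s x) k' o' t' s' A).
Proof.
move=> dk do_ dt ds.
have dtk : is_derive x 1 (fun e => t e * k e) (t' * k x + t x * k').
  by apply: is_derive_eq; rewrite /GRing.scale /=; ring.
have dy j : is_derive x 1 (fun e => comb A (vec3 (k e) 0 0) j)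
    (comb A (vec3 k' 0 0) j).
  by rewrite /comb /vec3 /=; apply: is_derive_eq; rewrite /GRing.scale /=; ring.
have dN j : is_derive x 1 (fun e => comb A (vec3 0 0 (- (s e * k e))) j)
    (comb A (vec3 0 0 (- (s' * k x + s x * k'))) j).
  by rewrite /comb /vec3 /=; apply: is_derive_eq; rewrite /GRing.scale /=; ring.
have dB j : is_derive x 1 (fun e => comb A (vec3 (- (o e * t e)) (s e) 0) j)
    (comb A (vec3 (- (o' * t x + o x * t')) s' 0) j).
  by rewrite /comb /vec3 /=; apply: is_derive_eq; rewrite /GRing.scale /=; ring.
have dP j : is_derive x 1 (fun e => comb A (vec3 (- t e) (o e * s e) 0) j)
    (comb A (vec3 (- t') (o' * s x + o x * s') 0) j).
  by rewrite /comb /vec3 /=; apply: is_derive_eq; rewrite /GRing.scale /=; ring.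
exact: (is_derive_bspoint dy do_ dtk dN dB dP).
Qed.

Definition psi_tangent (k o t s k' o' t' s' : R) A (a : 'I_4) : @BSamb R :=
  if unlift ord0 a is Some i then
    fpoint n3 n4 A (cross (vec3 k 0 0) (unit3 i)) 0 0 (cross (vec3 0 0 (- (s * k))) (unit3 i))
      (cross (vec3 (- (o * t)) s 0) (unit3 i)) (cross (vec3 (- t) (o * s) 0) (unit3 i))
  else psi_derive k o t s k' o' t' s' A.

End InducedMetric.

(** * Components of the induced metric along an orbit of curves *)

Section MetricTable.
Context {R : realType} (n3 n4 : R).
Hypothesis n1 : n3 ^+ 2 + n4 ^+ 2 = 1.

(* The parts of the metric coming from the fibres and from the base. *)
Definition psi_vertical (k o t s k' o' t' s' : R) (a b : 'I_4) : R :=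
  nth 0 (nth [::] [::
    [:: t' ^+ 2 + s' ^+ 2; 0; 0; o * (t * s' - s * t')];
    [:: 0; s ^+ 2; s * t * o; 0];
    [:: 0; s * t * o; o ^+ 2 * t ^+ 2; 0];
    [:: o * (t * s' - s * t'); 0; 0; o ^+ 2 * (t ^+ 2 + s ^+ 2)]] a) b.

Definition psi_horizontal (k k' o' : R) (a b : 'I_4) : R :=
  nth 0 (nth [::] [::
    [:: k' ^+ 2 + o' ^+ 2; 0; 0; 0]; [:: 0; 0; 0; 0];
    [:: 0; 0; k ^+ 2; 0]; [:: 0; 0; 0; k ^+ 2]] a) b.

Definition psi_metric (q k o t s k' o' t' s' : R) (a b : 'I_4) : R :=
  psi_vertical k o t s k' o' t' s' a b / q + 2 * q * psi_horizontal k k' o' a b.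

(** Since [k k' + o o' = 0], the derivative of (k, o) is a multiple of (- o, k); substituting it
    turns every component into a polynomial identity modulo [k^2 + o^2 = 1]. *)
Lemma BSmetric_psi_tangent c q k o t s k' o' t' s' (A : 'M[R]_3) a b :
  SO3 A -> k ^+ 2 + o ^+ 2 = 1 -> k * k' + o * o' = 0 -> 0 < q ->
  c + (t ^+ 2 + s ^+ 2) = q ^+ 2 ->
  BSmetric c (psi n3 n4 k o t s A) (psi_tangent n3 n4 k o t s k' o' t' s' A a)
    (psi_tangent n3 n4 k o t s k' o' t' s' A b)
  = psi_metric q k o t s k' o' t' s' a b.
Proof.
move=> SA k1 kk' q0 cq.
have rE : c + rsq (psi n3 n4 k o t s A).2 = q ^+ 2 by rewrite rsq_psi.
have p2 : (c + rsq (psi n3 n4 k o t s A).2) `^ 2^-1 = q.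
  by rewrite rE powR12_sqrt ?sqr_ge0// sqrtr_sqr gtr0_norm.
have pN2 : (c + rsq (psi n3 n4 k o t s A).2) `^ (- 2^-1) = q^-1 by rewrite powRN p2.
have yz : dot (vec3 k 0 0) (vec3 k 0 0) + o ^+ 2 = 1.
  by rewrite -k1 /dot /vec3 /=; ring.
have o1 : o ^+ 2 = 1 - k ^+ 2 by rewrite -k1 addrAC subrr add0r.
(* th is the derivative of alpha *)
have [th k'E o'E] : exists2 th, k' = - (o * th) & o' = k * th.
  exists (k * o' - o * k').
    by apply: (@lin_comb2 _ k k' _ _ _ _ kk' (subrr 1)); ring: o1.
  by apply: (@lin_comb2 _ o o' _ _ _ _ kk' (subrr 1)); ring: o1.
have l1 (lt : (1 < 4)%N) : Ordinal lt = lift ord0 '3_0 by apply/val_inj.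
have l2 (lt : (2 < 4)%N) : Ordinal lt = lift ord0 '3_1 by apply/val_inj.
have l3 (lt : (3 < 4)%N) : Ordinal lt = lift ord0 '3_2 by apply/val_inj.
have l0 (lt : (0 < 4)%N) : Ordinal lt = ord0 by apply/val_inj.
rewrite {}k'E {}o'E {kk'} /psi_tangent /psi_metric.
have E (X Y Z W : R) : X = 2 * Z -> Y = W ->
    q^-1 * (2^-1 * X) + 2 * q * Y = Z / q + 2 * q * W.
  by move=> -> ->; rewrite mulKf// mulrC.
elim/ord4P: a; elim/ord4P: b;
  rewrite ?l0 ?l1 ?l2 ?l3 ?liftK ?unlift_none BSmetric_fpoint// -/(psi n3 n4 k o t s A);
  rewrite p2 pN2; apply: E;
  rewrite /dot /cross /unit3 /vec3 /psi_vertical /psi_horizontal /=; by ring: o1.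
Qed.

End MetricTable.

(** * Parametrization of the ends of the fibres *)

Section SmoothCoordinates.
Context {R : realType} (n3 n4 : R).

Lemma Ck_bspoint k (V : normedModType R) (U : set V) (y N B P : V -> 'I_3 -> R)
    (z tau : V -> R) :
  open U -> (forall j, Ck k U (fun e => y e j)) -> Ck k U z -> Ck k U tau ->
  (forall j, Ck k U (fun e => N e j)) -> (forall j, Ck k U (fun e => B e j)) ->
  (forall j, Ck k U (fun e => P e j)) ->
  Ck k U (fun e => bspoint n3 n4 (y e) (z e) (tau e) (N e) (B e) (P e)).
Proof.
move=> oU dy dz dtau dN dB dP.
have c (a : R) : Ck k U (fun=> a) by exact: Ck_cst.
have X3 j : Ck k U (fun e => n3 * N e j - n4 * B e j).
  by apply: CkD => //; [|apply: CkN => //]; apply: CkM.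
have X4 j : Ck k U (fun e => n4 * N e j + n3 * B e j).
  by apply: CkD => //; apply: CkM.
apply: Ck_pair => //; apply: Ck_mx => // i j.
  apply: (@Ck_eq _ _ _ _ _ (fun e => nth 0 [:: y e '3_0; y e '3_1; y e '3_2;
    z e * n3; z e * n4] j)) => //; first by move=> e _; rewrite mxE.
  by elim/ord5P: j => /=; try exact: dy; apply: CkM.
apply: (@Ck_eq _ _ _ _ _ (fun e => nth 0 (nth [::] [::
     [:: 0; P e '3_2; - P e '3_1; n3 * N e '3_0 - n4 * B e '3_0; n4 * N e '3_0 + n3 * B e '3_0];
     [:: - P e '3_2; 0; P e '3_0; n3 * N e '3_1 - n4 * B e '3_1; n4 * N e '3_1 + n3 * B e '3_1];
     [:: P e '3_1; - P e '3_0; 0; n3 * N e '3_2 - n4 * B e '3_2; n4 * N e '3_2 + n3 * B e '3_2];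
     [:: - (n3 * N e '3_0 - n4 * B e '3_0); - (n3 * N e '3_1 - n4 * B e '3_1);
         - (n3 * N e '3_2 - n4 * B e '3_2); 0; tau e];
     [:: - (n4 * N e '3_0 + n3 * B e '3_0); - (n4 * N e '3_1 + n3 * B e '3_1);
         - (n4 * N e '3_2 + n3 * B e '3_2); - tau e; 0]] i) j)) => //.
  by move=> e _; rewrite mxE.
by elim/ord5P: i; elim/ord5P: j => /=; do ?[exact: c | exact: dP | exact: X3 |
  exact: X4 | exact: dtau | apply: CkN => //].
Qed.

Lemma Ck_psi k (ka o t s : R -> R) (U : set (@cylpt R)) : open U ->
  Ck k U (fun p => ka p.1) -> Ck k U (fun p => o p.1) ->
  Ck k U (fun p => t p.1) -> Ck k U (fun p => s p.1) ->
  Ck k U (fun p => psi n3 n4 (ka p.1) (o p.1) (t p.1) (s p.1) p.2).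
Proof.
move=> oU hk ho ht hs.
have c (a : R) : Ck k U (fun=> a) by exact: Ck_cst.
have cA i j : Ck k U (fun p => p.2 i j) by exact: Ck_snd_coord.
have hcomb (u : @cylpt R -> 'I_3 -> R) : (forall j, Ck k U (fun p => u p j)) ->
    forall j, Ck k U (fun p => comb p.2 (u p) j).
  by move=> hu j; apply: CkD => //; [apply: CkD => //|]; apply: CkM.
have hts : Ck k U (fun p => t p.1 * ka p.1) by exact: CkM.
apply: Ck_bspoint => //; apply: hcomb => j; elim/ord3P: j; rewrite /vec3 /= //.
- by apply: CkN => //; exact: CkM.
- by apply: CkN => //; exact: CkM.
- exact: CkN.
- exact: CkM.
Qed.

Lemma Ck_rsq k (U : set (@BSamb R)) : open U -> Ck k U (fun p => rsq p.2).
Proof.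
move=> oU; apply: CkM => //; first exact: Ck_cst.
apply: Ck_sum => // i; apply: Ck_sum => // j.
by apply: CkM => //; exact: Ck_snd_coord.
Qed.

Lemma continuous_rsq : continuous (fun p : @BSamb R => rsq p.2).
Proof. by move=> p; have [+ _] := @Ck_rsq 0 setT openT; apply. Qed.

Lemma rsq_ge0 (w : 'M[R]_5) : 0 <= rsq w.
Proof.
apply: mulr_ge0; first by rewrite invr_ge0.
by apply: sumr_ge0 => i _; apply: sumr_ge0 => j _; rewrite -expr2 sqr_ge0.
Qed.

Lemma rsq_eq0 (w : 'M[R]_5) : rsq w = 0 -> w = 0.
Proof.
move=> /eqP; rewrite mulf_eq0 invr_eq0 pnatr_eq0 /= => w0; apply/matrixP => i j.
rewrite mxE; move: w0; rewrite psumr_eq0 => [/allP/(_ i)|i' _]; last first.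
  by apply: sumr_ge0 => j' _; rewrite -expr2 sqr_ge0.
rewrite mem_index_enum => /(_ isT); rewrite psumr_eq0 => [/allP/(_ j)|j' _]; last first.
  by rewrite -expr2 sqr_ge0.
by rewrite mem_index_enum => /(_ isT); rewrite -expr2 sqrf_eq0 => /eqP.
Qed.

Lemma rsq0 : rsq (0 : 'M[R]_5) = 0.
Proof.
by rewrite /rsq /inner big1 ?mulr0// => i _; rewrite big1// => j _; rewrite mxE mul0r.
Qed.

End SmoothCoordinates.

(** * An end of a fibre as a cylinder over SO(3) *)

Section FibreEnd.
Context {R : realType} (n3 n4 c u v m : R).
Hypothesis n1 : n3 ^+ 2 + n4 ^+ 2 = 1.

(* R^2 = 4 (q - m), where q = (c + r^2)^(1/2). *)
Definition fq (x : R) : R := x ^+ 2 / 4 + m.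
Definition fsin (x : R) : R := v / 2 * (Num.sqrt (fq x))^-1.
Definition fcos2 (x : R) : R := 1 - v ^+ 2 / 4 * (fq x)^-1.
Definition fcos (x : R) : R := Num.sqrt (fcos2 x).
Definition ft (x : R) : R := u * (fcos x)^-1.
Definition fs2 (x : R) : R := fq x ^+ 2 - c - ft x ^+ 2.
Definition fs (x : R) : R := Num.sqrt (fs2 x).

Definition end_map (p : @cylpt R) : @BSamb R :=
  psi n3 n4 (fcos p.1) (fsin p.1) (ft p.1) (fs p.1) p.2.

Definition end_radius (p : @BSamb R) : R :=
  2 * Num.sqrt (Num.sqrt (c + rsq p.2) - m).

(** On [I] both cos alpha and s are positive. These are the denominators of [psi_frame], and they
    make the orbits copies of SO(3). *)
Variable I : set R.
Hypotheses (oI : open I) (c_ge0 : 0 <= c) (m_ge0 : 0 <= m).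
Hypothesis I0 : forall x, I x -> 0 < x.
Hypothesis Icos : forall x, I x -> 0 < fcos2 x.
Hypothesis Is : forall x, I x -> 0 < fs2 x.

Lemma fq_gt0 x : I x -> 0 < fq x.
Proof.
by move=> /I0 x0; rewrite ltr_pwDl// divr_gt0// exprn_gt0.
Qed.

Lemma fsin_sqr x : I x -> fsin x ^+ 2 = v ^+ 2 / 4 * (fq x)^-1.
Proof.
move=> Ix; rewrite /fsin exprMn exprVn sqr_sqrtr ?(ltW (fq_gt0 Ix))//.
by congr (_ * _); field.
Qed.

Lemma fcos_sqr x : I x -> fcos x ^+ 2 = fcos2 x.
Proof. by move=> Ix; rewrite sqr_sqrtr// ltW// Icos. Qed.

Lemma fcos_gt0 x : I x -> 0 < fcos x.
Proof. by move=> Ix; rewrite sqrtr_gt0 Icos. Qed.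

Lemma fs_gt0 x : I x -> 0 < fs x.
Proof. by move=> Ix; rewrite sqrtr_gt0 Is. Qed.

Lemma fcos2Dfsin2 x : I x -> fcos x ^+ 2 + fsin x ^+ 2 = 1.
Proof. by move=> Ix; rewrite fcos_sqr// fsin_sqr// subrK. Qed.

Lemma ft_cos x : I x -> ft x * fcos x = u.
Proof. by move=> Ix; rewrite /ft mulfVK// gt_eqF// fcos_gt0. Qed.

Lemma ft2Dfs2 x : I x -> c + (ft x ^+ 2 + fs x ^+ 2) = fq x ^+ 2.
Proof. by move=> Ix; rewrite /fs sqr_sqrtr ?(ltW (Is Ix))// /fs2; ring. Qed.

(** Stated for a composite with [f], so as to apply both to the radial coordinate of the cylinder
    and to [end_radius] on the ambient space. *)
Lemma Ck_profile k (V : normedModType R) (U : set V) (f : V -> R) : open U ->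
  (forall x, U x -> I (f x)) -> Ck k U f ->
  [/\ Ck k U (fun x => fcos (f x)), Ck k U (fun x => fsin (f x)),
      Ck k U (fun x => ft (f x)) & Ck k U (fun x => fs (f x))].
Proof.
move=> oU UI fk; have cst (a : R) : Ck k U (fun=> a) by exact: Ck_cst.
have hq : Ck k U (fun x => fq (f x)).
  by apply: CkD => //; apply: CkM => //; exact: CkM.
have q0 x : U x -> 0 < fq (f x) by move=> Ux; apply: fq_gt0; exact: UI.
have hsin : Ck k U (fun x => fsin (f x)).
  apply: CkM => //; apply: CkV => //; last exact: Ck_sqrt.
  by move=> x Ux; rewrite sqrtr_gt0 q0.
have hcos2 : Ck k U (fun x => fcos2 (f x)).
  by apply: CkD => //; apply: CkN => //; apply: CkM => //; exact: CkV.
have hcos : Ck k U (fun x => fcos (f x)).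
  by apply: Ck_sqrt => // x Ux; apply: Icos; exact: UI.
have ht : Ck k U (fun x => ft (f x)).
  apply: CkM => //; apply: CkV => // x Ux; apply: fcos_gt0; exact: UI.
split=> //; apply: Ck_sqrt => //; first by move=> x Ux; apply: Is; exact: UI.
apply: CkD => //; first apply: CkD => //; first exact: CkM.
by apply: CkN => //; exact: CkM.
Qed.

Lemma fq_powR x : I x -> (fq x ^+ 2) `^ 4^-1 = Num.sqrt (fq x).
Proof.
move=> Ix; have q0 := fq_gt0 Ix.
rewrite -powR_mulrn ?(ltW q0)// -powRrM -powR12_sqrt ?(ltW q0)//.
by congr (_ `^ _); field.
Qed.

Definition end_set : set (@BSamb R) := [set p |
  [/\ BSfibre c (u, v * n3, v * n4) p, 0 < Num.sqrt (c + rsq p.2) - m & I (end_radius p)]].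

Lemma end_map_radius p : cyl I p ->
  Num.sqrt (c + rsq (end_map p).2) = fq p.1 /\ end_radius (end_map p) = p.1.
Proof.
move=> [Ix SA].
have E : Num.sqrt (c + rsq (end_map p).2) = fq p.1.
  rewrite rsq_psi// ?fcos2Dfsin2// ft2Dfs2// sqrtr_sqr gtr0_norm//.
  exact: fq_gt0.
split=> //; rewrite /end_radius E /fq addrK.
have -> : p.1 ^+ 2 / 4 = (p.1 / 2) ^+ 2 by field.
by rewrite sqrtr_sqr gtr0_norm; [field | rewrite divr_gt0//; exact: I0].
Qed.

Lemma end_map_fibre p : cyl I p -> BSfibre c (u, v * n3, v * n4) (end_map p).
Proof.
move=> [Ix SA]; have L : Lambda2minus (end_map p).
  by apply: psi_Lambda => //; exact: fcos2Dfsin2.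
have r : rsq (end_map p).2 = ft p.1 ^+ 2 + fs p.1 ^+ 2.
  by rewrite rsq_psi// fcos2Dfsin2.
(* Positivity of s keeps the point off the zero section, which is removed from the space when c =
   0. *)
have r0 : 0 < rsq (end_map p).2.
  by rewrite r ltr_wpDl ?sqr_ge0// exprn_gt0// fs_gt0.
split; first rewrite /BSspace.
  case: ifP => // _; split=> // -[_ w0].
  by move: r0; rewrite (w0 : (end_map p).2 = 0) rsq0 ltxx.
rewrite /= /BSfibration.
have [-> -> ->] := psi_coord n3 n4 (fcos p.1) (fsin p.1) (ft p.1) (fs p.1) p.2.
rewrite r ft2Dfs2// fq_powR// ft_cos//.
have s0 : Num.sqrt (fq p.1) != 0 by rewrite gt_eqF// sqrtr_gt0 fq_gt0.
by congr (_, _, _); rewrite /fsin; field.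
Qed.

(** The radius gives q; the three components of the fibration then give t cos alpha and both
    coordinates of sin alpha (n3, n4), so that [frame_psiK] applies. *)
Lemma end_set_psi p : end_set p -> let x := end_radius p in
  let A := psi_frame n3 n4 (fcos x) (fsin x) (ft x) (fs x) p in
  SO3 A /\ end_map (x, A) = p.
Proof.
move=> [[Bp fp] pm Ix] x A.
have L : Lambda2minus p.
  by move: Bp; rewrite /BSspace; case: ifP => // _ [].
have cr : 0 <= c + rsq p.2 by rewrite addr_ge0// rsq_ge0.
have qE : fq x = Num.sqrt (c + rsq p.2).
  by rewrite /fq /x /end_radius exprMn sqr_sqrtr ?(ltW pm)//; field.
have crE : c + rsq p.2 = fq x ^+ 2 by rewrite qE sqr_sqrtr.
have s0 : Num.sqrt (fq x) != 0 by rewrite gt_eqF// sqrtr_gt0 fq_gt0.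
move: fp; rewrite /= /BSfibration crE fq_powR// => -[fu f3 f4].
apply: frame_psiK => //.
- rewrite /fsin; apply: (@mulfI R (2 * Num.sqrt (fq x))); first by rewrite mulf_neq0.
  by rewrite f3; field.
- rewrite /fsin; apply: (@mulfI R (2 * Num.sqrt (fq x))); first by rewrite mulf_neq0.
  by rewrite f4; field.
- by rewrite fu ft_cos.
- by apply: (@addrI R c); rewrite crE ft2Dfs2.
- exact: fcos_gt0.
- exact: fs_gt0.
- exact: fcos2Dfsin2.
Qed.

Lemma continuous_end_radius : continuous end_radius.
Proof.
move=> p; apply: cvgM; first exact: cvg_cst.
apply: (@continuous_comp _ _ _ (fun p : @BSamb R => Num.sqrt (c + rsq p.2) - m) Num.sqrt);
  last exact: sqrt_continuous.
apply: cvgB; last exact: cvg_cst.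
apply: (@continuous_comp _ _ _ (fun p : @BSamb R => c + rsq p.2) Num.sqrt);
  last exact: sqrt_continuous.
by apply: cvgD; [exact: cvg_cst | exact: continuous_rsq].
Qed.

Lemma open_cylinder : open [set p : @cylpt R | I p.1].
Proof.
by apply: (@open_comp _ _ (fun p : @cylpt R => p.1)) => // p _; exact: cvg_fst.
Qed.

(** The inverse reads the radius off [rsq] and the rotation off [psi_frame]. Both formulas are
    smooth on an open set [U] of the ambient space, irrespective of the equations of the fibre,
    which yields the local extension. *)
Lemma end_diffeomorphism : diffeomorphism (cyl I) end_set end_map.
Proof.
pose g p := let x := end_radius p in
  (x, psi_frame n3 n4 (fcos x) (fsin x) (ft x) (fs x) p).
exists g; split.
- move=> [x A] cp; have [Ix _] := cp; have [E1 E2] := end_map_radius cp; split.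
    split; first exact: end_map_fibre.
      by rewrite E1 /fq addrK divr_gt0// exprn_gt0// I0.
    by rewrite E2.
  rewrite /g /= E2 /=; congr (_, _); apply: psi_frameK => //.
    by rewrite gt_eqF// fcos_gt0.
  by rewrite gt_eqF// fs_gt0.
- move=> p Yp; have [SA gK] := end_set_psi Yp; split=> //.
  by split=> //=; case: Yp.
- move=> p [Ip _]; exists [set p : @cylpt R | I p.1], end_map; split=> //.
    exact: open_cylinder.
  move=> k; have oc := open_cylinder.
  have [h1 h2 h3 h4] := @Ck_profile k _ _ (fun p : @cylpt R => p.1) oc
    (fun p Ip => Ip) (Ck_fst k oc).
  exact: Ck_psi.
move=> p Yp.
pose U := [set p : @BSamb R | 0 < c + rsq p.2] `&`
  ([set p : @BSamb R | 0 < Num.sqrt (c + rsq p.2) - m] `&` [set p | I (end_radius p)]).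
have oU : open U.
  have cc : continuous (fun p : @BSamb R => c + rsq p.2).
    by move=> q; apply: cvgD; [exact: cvg_cst | exact: continuous_rsq].
  apply: openI; last apply: openI.
  - by apply: (@open_comp _ _ _ [set y : R | 0 < y]) => [q _|]; [exact: cc | exact: open_gt].
  - apply: (@open_comp _ _ (fun p : @BSamb R => Num.sqrt (c + rsq p.2) - m)
      [set y : R | 0 < y]) => [q _|]; last exact: open_gt.
    apply: cvgB; last exact: cvg_cst.
    apply: (@continuous_comp _ _ _ (fun p : @BSamb R => c + rsq p.2) Num.sqrt).
      exact: cc.
    exact: sqrt_continuous.
  - by apply: open_comp => [q _|//]; exact: continuous_end_radius.
exists U, g; split=> //.
  have [_ pm Ip] := Yp; split=> //; rewrite /=.
  by rewrite -sqrtr_gt0; apply: le_lt_trans m_ge0 _; rewrite -subr_gt0.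
move=> k; have cst (a : R) : Ck k U (fun=> a) by exact: Ck_cst.
have hr : Ck k U end_radius.
  apply: CkM => //; apply: Ck_sqrt => //; first by move=> q [_ []].
  apply: CkD => //.
  apply: Ck_sqrt => //; first by move=> q [].
  by apply: CkD => //; exact: Ck_rsq.
have UI q : U q -> I (end_radius q) by case=> _ [].
have [hc hs ht hS] := Ck_profile oU UI hr.
have c1 i j : Ck k U (fun q => q.1 i j) by exact: Ck_fst_coord.
have c2 i j : Ck k U (fun q => q.2 i j) by exact: Ck_snd_coord.
apply: Ck_pair => //; apply: Ck_mx => // j l.
have hcV : Ck k U (fun q => (fcos (end_radius q))^-1).
  by apply: CkV => // q Uq; apply: fcos_gt0; exact: UI.
have hSV : Ck k U (fun q => (fs (end_radius q))^-1).
  by apply: CkV => // q Uq; apply: fs_gt0; exact: UI.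
have hScV : Ck k U (fun q => (fs (end_radius q) * fcos (end_radius q))^-1).
  apply: CkV => //; last exact: CkM.
  by move=> q Uq; rewrite mulr_gt0//; [apply: fs_gt0 | apply: fcos_gt0]; exact: UI.
pose a q := (fcos (end_radius q))^-1 * q.1 ord0 (emb3 j).
have ha : Ck k U a by apply: CkM.
apply: (@Ck_eq _ _ _ _ _ (fun q => nth 0 [:: a q;
    (fs (end_radius q))^-1 * (n3 * q.2 (emb3 j) '5_4 - n4 * q.2 (emb3 j) '5_3
      + fsin (end_radius q) * ft (end_radius q) * a q);
    - ((fs (end_radius q) * fcos (end_radius q))^-1 *
      (n3 * q.2 (emb3 j) '5_3 + n4 * q.2 (emb3 j) '5_4))] l)) => //.
  by move=> q _; rewrite mxE.
elim/ord3P: l => //=.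
  apply: CkM => //; apply: CkD => //; last by apply: CkM => //; exact: CkM.
  by apply: CkD => //; [|apply: CkN => //]; exact: CkM.
by apply: CkN => //; apply: CkM => //; apply: CkD => //; exact: CkM.
Qed.

Lemma pullback_end_map (k' o' t' s' : R -> R) p a b :
  (forall x, I x -> is_derive x 1 fcos (k' x)) ->
  (forall x, I x -> is_derive x 1 fsin (o' x)) ->
  (forall x, I x -> is_derive x 1 ft (t' x)) ->
  (forall x, I x -> is_derive x 1 fs (s' x)) -> cyl I p ->
  pullback (BSmetric c) end_map p a b =
  psi_metric (fq p.1) (fcos p.1) (fsin p.1) (ft p.1) (fs p.1)
    (k' p.1) (o' p.1) (t' p.1) (s' p.1) a b.
Proof.
move=> dk do_ dt ds cp; have [Ix SA] := cp.
have dE d : frame_der d end_map p = psi_tangent n3 n4 (fcos p.1) (fsin p.1) (ft p.1)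
    (fs p.1) (k' p.1) (o' p.1) (t' p.1) (s' p.1) p.2 d.
  rewrite /psi_tangent; case: (unliftP ord0 d) => [i|] ->.
    rewrite /frame_der (_ : (fun e => _) = fun e => fpoint n3 n4 (p.2 *m Defs.rot i e)
      (vec3 (fcos p.1) 0 0) (fsin p.1) (ft p.1 * fcos p.1)
      (vec3 0 0 (- (fs p.1 * fcos p.1))) (vec3 (- (fsin p.1 * ft p.1)) (fs p.1) 0)
      (vec3 (- ft p.1) (fsin p.1 * fs p.1) 0)); last first.
      by apply/funext => e; rewrite flow_lift.
    by rewrite derive1E; have [_ ->] := is_derive_fpoint_rot n3 n4 p.2 (vec3 (fcos p.1) 0 0)
      (fsin p.1) (ft p.1 * fcos p.1) (vec3 0 0 (- (fs p.1 * fcos p.1)))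
      (vec3 (- (fsin p.1 * ft p.1)) (fs p.1) 0) (vec3 (- ft p.1) (fsin p.1 * fs p.1) 0) i.
  apply: (@frame_der0 _ _ oI _ _
    (fun e => psi n3 n4 (fcos e) (fsin e) (ft e) (fs e) p.2)) => //.
    by move=> q _ qp; rewrite /end_map qp.
  by apply: is_derive_psi; [exact: dk | exact: do_ | exact: dt | exact: ds].
rewrite mxE !dE; apply: BSmetric_psi_tangent => //.
- exact: fcos2Dfsin2.
- have d1 : is_derive p.1 1 (fun x => fcos x * fcos x + fsin x * fsin x)
      (2 * (fcos p.1 * k' p.1 + fsin p.1 * o' p.1)).
    have := dk _ Ix; have := do_ _ Ix => ? ?.
    by apply: is_derive_eq; rewrite /GRing.scale /=; ring.
  have d2 : is_derive p.1 1 (fun x => fcos x * fcos x + fsin x * fsin x) 0.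
    apply: (@is_derive_near R R R (cst 1) _ I) => //.
    by move=> x Ix' /=; rewrite -!expr2 fcos2Dfsin2.
  have [_ e1] := d1; have [_ e2] := d2.
  by move/eqP: e1; rewrite e2 eq_sym mulf_eq0 pnatr_eq0 /= => /eqP.
- exact: fq_gt0.
- exact: ft2Dfs2.
Qed.

End FibreEnd.

(** * Asymptotics of the metric *)

Section ProfileDerivative.
Context {R : realType} (c u v m : R) (I : set R).
Hypotheses (oI : open I) (m_ge0 : 0 <= m).
Hypothesis I0 : forall x, I x -> 0 < x.
Hypothesis Icos : forall x, I x -> 0 < fcos2 v m x.
Hypothesis Is : forall x, I x -> 0 < fs2 c u v m x.

Lemma is_derive_profile x : I x ->
  [/\ is_derive x 1 (fcos v m) ('D_1 (fcos v m) x),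
      is_derive x 1 (fsin v m) ('D_1 (fsin v m) x),
      is_derive x 1 (ft u v m) ('D_1 (ft u v m) x) &
      is_derive x 1 (fs c u v m) ('D_1 (fs c u v m) x)].
Proof.
move=> Ix; have idk : Ck 1 I (fun y : R => y).
  by apply: Ck_linear => // y; exact: cvg_id.
have [h1 h2 h3 h4] := Ck_profile m_ge0 I0 Icos Is oI (fun y Iy => Iy) idk.
by split; apply: derivableP; [have [_ /(_ 1)[+ _]] := h1 | have [_ /(_ 1)[+ _]] := h2
  | have [_ /(_ 1)[+ _]] := h3 | have [_ /(_ 1)[+ _]] := h4]; apply.
Qed.

(** Differentiates [s^2 = q^2 - c - t^2], with [q' = x / 2], instead of the square root. *)
Lemma fs_derive x : I x ->
  2 * (fs c u v m x * 'D_1 (fs c u v m) x) =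
  fq m x * x - 2 * (ft u v m x * 'D_1 (ft u v m) x).
Proof.
move=> Ix; have [_ _ dt ds] := is_derive_profile Ix.
have d1 : is_derive x 1 (fun y => fs c u v m y * fs c u v m y)
    (2 * (fs c u v m x * 'D_1 (fs c u v m) x)).
  by apply: is_derive_eq; rewrite /GRing.scale /=; ring.
have d2 : is_derive x 1 (fun y => fs c u v m y * fs c u v m y)
    (fq m x * x - 2 * (ft u v m x * 'D_1 (ft u v m) x)).
  apply: (@is_derive_near R R R (fun y => (y * y / 4 + m) * (y * y / 4 + m) - c
    - ft u v m y * ft u v m y) _ I) => //.
    move=> y Iy; rewrite -!expr2; have := ft2Dfs2 Is Iy.
    by rewrite /fq => /(congr1 (fun z => z - c)) e; rewrite -e; ring.
  by apply: is_derive_eq; rewrite /GRing.scale /= /fq; field.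
by have [_ <-] := d1; have [_ ->] := d2.
Qed.

Lemma fcos_derive x : I x ->
  fcos v m x * 'D_1 (fcos v m) x = - (fsin v m x * 'D_1 (fsin v m) x).
Proof.
move=> Ix; have [dk do_ _ _] := is_derive_profile Ix.
have d1 : is_derive x 1 (fun y => fcos v m y * fcos v m y + fsin v m y * fsin v m y)
    (2 * (fcos v m x * 'D_1 (fcos v m) x + fsin v m x * 'D_1 (fsin v m) x)).
  by apply: is_derive_eq; rewrite /GRing.scale /=; ring.
have d2 : is_derive x 1 (fun y => fcos v m y * fcos v m y + fsin v m y * fsin v m y) 0.
  apply: (@is_derive_near R R R (cst 1) _ I) => //.
  by move=> y Iy /=; rewrite -!expr2 (fcos2Dfsin2 m_ge0 I0 Icos).
have [_ e1] := d1; have [_ e2] := d2; apply/eqP; rewrite -addr_eq0.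
by move/eqP: e1; rewrite e2 eq_sym mulf_eq0 pnatr_eq0.
Qed.

Definition end_metric x : 'I_4 -> 'I_4 -> R :=
  psi_metric (fq m x) (fcos v m x) (fsin v m x) (ft u v m x) (fs c u v m x)
    ('D_1 (fcos v m) x) ('D_1 (fsin v m) x) ('D_1 (ft u v m) x) ('D_1 (fs c u v m) x).

Variables (n3 n4 : R).
Hypothesis n1 : n3 ^+ 2 + n4 ^+ 2 = 1.

Lemma pullback_end_metric p a b : cyl I p ->
  pullback (BSmetric c) (end_map n3 n4 c u v m) p a b = end_metric p.1 a b.
Proof.
move=> cp; apply: (pullback_end_map (k' := 'D_1 (fcos v m)) (o' := 'D_1 (fsin v m))
  (t' := 'D_1 (ft u v m)) (s' := 'D_1 (fs c u v m)) n1 oI m_ge0 I0 Icos Is) => //;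
  by move=> x /is_derive_profile[].
Qed.

Lemma end_deviation rate q1 q2 q3 j : 0 < q1 -> 0 < q2 -> 0 < q3 ->
  (forall a b, symbol I (rate + wt a + wt b) (fun x =>
    end_metric x a b - nth 0 [:: 1; x ^+ 2 * q1; x ^+ 2 * q2; x ^+ 2 * q3] a *+ (a == b))) ->
  exists C, forall p, cyl I p ->
    metric_deviation (pullback (BSmetric c) (end_map n3 n4 c u v m))
      (cone_metric q1 q2 q3) j p <= C * p.1 `^ (rate - j%:R).
Proof.
move=> q10 q20 q30 H; apply: metric_deviation_bound => // a b.
exists (fun x => end_metric x a b
  - nth 0 [:: 1; x ^+ 2 * q1; x ^+ 2 * q2; x ^+ 2 * q3] a *+ (a == b)) => // p cp.
by rewrite pullback_end_metric// /cone_metric !mxE.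
Qed.

End ProfileDerivative.

(** * The infinite end: m = 0 and large radius *)

Section AsymptoticallyConical.
Context {R : realType} (c u v : R).
Hypothesis c_ge0 : 0 <= c.

(* Chosen such that fcos2 >= 1/2 and fs2 >= x^4 / 32 beyond it. *)
Definition ac_radius : R := 1 + 2 * v ^+ 2 + 32 * (c + 2 * u ^+ 2).
Definition ac_domain : set R := [set x | ac_radius < x].

Lemma open_ac_domain : open ac_domain.
Proof. exact: open_gt. Qed.

Lemma ac_radius_ge1 : 1 <= ac_radius.
Proof.
have u2 : 0 <= u ^+ 2 := sqr_ge0 u; have v2 : 0 <= v ^+ 2 := sqr_ge0 v.
by move: c_ge0; rewrite /ac_radius; lra.
Qed.

Lemma ac_domain_gt1 x : ac_domain x -> 1 < x.
Proof. exact: le_lt_trans ac_radius_ge1. Qed.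

Lemma ac_domain_gt0 x : ac_domain x -> 0 < x.
Proof. by move/ac_domain_gt1; exact: lt_trans. Qed.

Let leX2 x : ac_domain x -> x <= x ^+ 2.
Proof. by move/ac_domain_gt1/ltW => x1; rewrite ler_eXnr. Qed.

Let leX4 x : ac_domain x -> x <= x ^+ 4.
Proof. by move/ac_domain_gt1/ltW => x1; rewrite ler_eXnr. Qed.

(** With m = 0 one has sin^2 alpha = v^2 / x^2, and [x^2 >= x > 2 v^2] on the domain. *)
Lemma ac_fcos2 x : ac_domain x -> 2^-1 <= fcos2 v 0 x.
Proof.
move=> Ix; have x0 := ac_domain_gt0 Ix.
have E : v ^+ 2 / 4 * (fq 0 x)^-1 = v ^+ 2 / x ^+ 2.
  by rewrite /fq; field; rewrite gt_eqF.
have : v ^+ 2 / x ^+ 2 <= 2^-1.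
  rewrite ler_pdivrMr ?exprn_gt0//.
  have := leX2 Ix; have : ac_radius < x := Ix; rewrite /ac_radius.
  by have := sqr_ge0 u; move: c_ge0; lra.
by rewrite /fcos2 E; lra.
Qed.

Lemma ac_fcos2_gt0 x : ac_domain x -> 0 < fcos2 v 0 x.
Proof. by move=> /ac_fcos2; apply: lt_le_trans; rewrite invr_gt0. Qed.

(** The quotient [s^2 / x^4]. It tends to 1/16, and 1/32 bounds it from below on the domain. *)
Let e (x : R) : R := 16^-1 - (c + ft u v 0 x * ft u v 0 x) * (x^-1 * x^-1 * (x^-1 * x^-1)).

Let fs2E x : ac_domain x -> fs2 c u v 0 x = x ^+ 2 * x ^+ 2 * e x.
Proof.
move=> Ix; have x0 := ac_domain_gt0 Ix.
by rewrite /fs2 /e /fq; field; rewrite gt_eqF.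
Qed.

Let e32 : 0 < 32^-1 :> R. Proof. by rewrite invr_gt0. Qed.

Let e_ge x : ac_domain x -> 32^-1 <= e x.
Proof.
move=> Ix; have x0 := ac_domain_gt0 Ix; have k2 := ac_fcos2 Ix.
have t2 : ft u v 0 x * ft u v 0 x <= 2 * u ^+ 2.
  have -> : ft u v 0 x * ft u v 0 x = u ^+ 2 * (fcos2 v 0 x)^-1.
    by rewrite -(@fcos_sqr _ v 0 ac_domain ac_fcos2_gt0 x Ix) /ft -exprVn; ring.
  rewrite [leRHS]mulrC ler_wpM2l ?sqr_ge0//.
  rewrite -[2]invrK lef_pV2 ?posrE ?invr_gt0//; first exact: ac_fcos2_gt0.
have E : (c + ft u v 0 x * ft u v 0 x) * (x^-1 * x^-1 * (x^-1 * x^-1))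
    = (c + ft u v 0 x * ft u v 0 x) / x ^+ 4 by field; rewrite gt_eqF.
have : (c + ft u v 0 x * ft u v 0 x) / x ^+ 4 <= 32^-1.
  rewrite ler_pdivrMr ?exprn_gt0//.
  have := leX4 Ix; have : ac_radius < x := Ix; rewrite /ac_radius.
  by have := sqr_ge0 v; move: c_ge0; lra.
by rewrite /e E; lra.
Qed.

Lemma ac_fs2_gt0 x : ac_domain x -> 0 < fs2 c u v 0 x.
Proof.
move=> Ix; rewrite fs2E// mulr_gt0//.
  by rewrite -expr2 !exprn_gt0// ac_domain_gt0.
by apply: lt_le_trans (e_ge Ix); rewrite invr_gt0.
Qed.

Local Notation sym := (symbol ac_domain).
Let oI := open_ac_domain.
Let I0 := ac_domain_gt0.
Let M l l' f g (fl : sym l f) (gl : sym l' g) := symbolM I0 fl gl.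

Let symbol_le l l' f : l <= l' -> sym l f -> sym l' f.
Proof.
move=> ll'; apply: symbol_mono => //; exists 1 => x Ix; rewrite mul1r.
by apply: ler_powR => //; exact: ltW (ac_domain_gt1 Ix).
Qed.

Let k := fcos v 0.
Let o := fsin v 0.
Let t := ft u v 0.
Let s := fs c u v 0.
Let q := fq (0 : R).

Let Sx : sym 1 id := symbol_id oI I0.
Let SxV : sym (-1) (fun x => x^-1) := symbol_inv oI I0.
Let Sc (a : R) : sym 0 (fun _ => a) := symbol_cst ac_domain a.

Let Sq : sym (1 + 1) q.
Proof.
apply: (symbol_eq oI _ (symbolZ I0 4^-1 (M Sx Sx))) => x _.
by rewrite /q /fq addr0 mulrC expr2.
Qed.

Let SqV : sym (- 1 - 1) (fun x => (q x)^-1).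
Proof.
apply: (symbol_eq oI _ (symbolZ I0 4 (M SxV SxV))) => x Ix.
by rewrite /q /fq addr0; field; rewrite gt_eqF// I0.
Qed.

(** Here sin alpha is exactly [v / x], as [sqrt q = x / 2]. *)
Let So : sym (-1) o.
Proof.
apply: (symbol_eq oI _ (symbolZ I0 v SxV)) => x Ix; have x0 := I0 Ix.
rewrite /o /fsin /fq addr0.
have -> : x ^+ 2 / 4 = (x / 2) ^+ 2 by field.
by rewrite sqrtr_sqr gtr0_norm ?divr_gt0//; field; rewrite gt_eqF.
Qed.

Let Sk2 : sym 0 (fcos2 v 0).
Proof.
apply: symbolB => //.
apply: (@symbol_le (0 + (- 1 - 1))); first lra.
by apply: M => //; exact: Sc.
Qed.

Let Sk : sym 0 k.
Proof. by apply: symbol_sqrt ac_fcos2 Sk2 => //; rewrite invr_gt0. Qed.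

Let SkV : sym 0 (fun x => (k x)^-1).
Proof.
apply: (@symbolV _ _ oI I0 (Num.sqrt 2^-1)) => //.
by move=> x Ix; rewrite ler_wsqrtr// ac_fcos2.
Qed.

Let St : sym 0 t.
Proof. by apply: symbolZ. Qed.

Let Se : sym 0 e.
Proof.
apply: symbolB => //.
apply: (@symbol_le (0 + 0 + (- 1 + - 1 + (- 1 + - 1)))); first lra.
apply: M; last by apply: M; exact: M.
by have := M St St; rewrite !addr0 => Stt; exact: symbolD.
Qed.

Let Ss : sym (1 + 1) s.
Proof.
have h := symbol_sqrt oI I0 e32 e_ge Se.
rewrite -[1 + 1]addr0; apply: (symbol_eq oI _ (M (M Sx Sx) h)) => x Ix.
rewrite /s /fs fs2E// sqrtrM; last by rewrite mulr_ge0// sqr_ge0.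
by rewrite -expr2 sqrtr_sqr ger0_norm ?sqr_ge0.
Qed.

Let Ss2V : sym (- 1 - 1 - 1 - 1) (fun x => (fs2 c u v 0 x)^-1).
Proof.
have h := symbolV oI I0 e32 e_ge Se.
apply: (@symbol_le (- 1 + - 1 + (- 1 + - 1) + 0)); first lra.
apply: (symbol_eq oI _ (M (M (M SxV SxV) (M SxV SxV)) h)) => x Ix.
by rewrite fs2E// !invfM !mulrA.
Qed.

Let D := is_derive_profile oI (lexx 0) I0 ac_fcos2_gt0 ac_fs2_gt0.

Let So' : sym (-1 - 1) ('D_1 o).
Proof. by apply: symbol_derive So => // x /D[]. Qed.

Let St' : sym (0 - 1) ('D_1 t).
Proof. by apply: symbol_derive St => // x /D[]. Qed.

Let Ss' : sym (1 + 1 - 1) ('D_1 s).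
Proof. by apply: symbol_derive Ss => // x /D[]. Qed.

(** The relation [k k' = - o o'] gives order -3. Order -1, which is all that [Sk] implies, would not
    suffice for the radial coefficient. *)
Let Sk' : sym (-1 + (- 1 - 1) + 0) ('D_1 k).
Proof.
apply: (symbol_eq oI _ (symbolN oI I0 (M (M So So') SkV))) => x Ix.
have kx : k x != 0 by rewrite gt_eqF// (fcos_gt0 ac_fcos2_gt0).
apply: (@mulfI R (k x)) => //.
rewrite (fcos_derive oI (lexx 0) I0 ac_fcos2_gt0 ac_fs2_gt0)// -/o.
by field.
Qed.

Let q0 x : ac_domain x -> q x != 0.
Proof. by move=> Ix; rewrite gt_eqF// (fq_gt0 (lexx 0) I0). Qed.

Let s2 x : ac_domain x -> s x ^+ 2 = fs2 c u v 0 x.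
Proof. by move=> Ix; rewrite sqr_sqrtr// ltW// ac_fs2_gt0. Qed.

Let k2 x : ac_domain x -> k x ^+ 2 = 1 - o x ^+ 2.
Proof. by move=> Ix; rewrite -(fcos2Dfsin2 (lexx 0) I0 ac_fcos2_gt0 Ix) addrK. Qed.

(** The leading part [q x^2 / (4 s^2)] of [s'^2 / q] differs from 1 by [(c + t^2) / s^2], thanks to
    [x^2 = 4 q] and [q^2 = c + t^2 + s^2]. Order -2 comes only from [2 q o'^2 = v^2 / (2 x^2)]; the
    other summands are estimated at order -4 or below. *)
Let S00 : sym (-2) (fun x => end_metric c u v 0 x ord0 ord0 - 1).
Proof.
have h1 : sym (-2) (fun x => 'D_1 t x * 'D_1 t x * (q x)^-1).
  by apply: (symbol_le _ (M (M St' St') SqV)); lra.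
have h2 : sym (-2) (fun x => 2 * (q x * ('D_1 k x * 'D_1 k x))).
  by apply: (symbol_le _ (symbolZ I0 2 (M Sq (M Sk' Sk')))); lra.
have h3 : sym (-2) (fun x => 2 * (q x * ('D_1 o x * 'D_1 o x))).
  by apply: (symbol_le _ (symbolZ I0 2 (M Sq (M So' So')))); lra.
have w : sym (- 1 - 1 + (- 1 - 1 - 1 - 1)) (fun x => (q x)^-1 * (fs2 c u v 0 x)^-1).
  exact: M.
have h4 : sym (-2) (fun x => - (q x * id x * (t x * 'D_1 t x) *
    ((q x)^-1 * (fs2 c u v 0 x)^-1))).
  by apply: (symbol_le _ (symbolN oI I0 (M (M (M Sq Sx) (M St St')) w))); lra.
have h5 : sym (-2) (fun x => t x * 'D_1 t x * (t x * 'D_1 t x) *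
    ((q x)^-1 * (fs2 c u v 0 x)^-1)).
  by apply: (symbol_le _ (M (M (M St St') (M St St')) w)); lra.
have h6 : sym (-2) (fun x => c * q x * ((q x)^-1 * (fs2 c u v 0 x)^-1)).
  by apply: (symbol_le _ (M (symbolZ I0 c Sq) w)); lra.
have h7 : sym (-2) (fun x => q x * (t x * t x) * ((q x)^-1 * (fs2 c u v 0 x)^-1)).
  by apply: (symbol_le _ (M (M Sq (M St St)) w)); lra.
have h := symbolD (symbolD (symbolD h1 h2) (symbolD h3 h4))
  (symbolD (symbolD h5 h6) h7).
apply: (symbol_eq oI _ h) => x Ix.
have s'E : 'D_1 s x ^+ 2 = (q x * x - 2 * (t x * 'D_1 t x)) ^+ 2 / 4 * (fs2 c u v 0 x)^-1.
  rewrite -(fs_derive oI (lexx 0) I0 ac_fcos2_gt0 ac_fs2_gt0)// -/s -s2//.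
  have s0 : s x != 0 by rewrite gt_eqF// (fs_gt0 ac_fs2_gt0).
  by field.
have f0 : fs2 c u v 0 x != 0 by rewrite gt_eqF// ac_fs2_gt0.
rewrite /end_metric /psi_metric /psi_vertical /psi_horizontal /= -/k -/o -/t -/s -/q s'E.
have x0 : x != 0 by rewrite gt_eqF// I0.
have cE : c = (x ^+ 2 / 4) ^+ 2 - t x ^+ 2 - fs2 c u v 0 x.
  by rewrite /fs2 -/t /fq addr0; ring.
move: (fs2 c u v 0 x) f0 cE => F f0 cE; rewrite cE /q /fq addr0.
by field; rewrite x0 f0.
Qed.

Let S03 : sym (-1) (fun x => end_metric c u v 0 x ord0 (lift ord0 '3_2)).
Proof.
have h1 : sym (-1) (fun x => o x * (t x * 'D_1 s x) * (q x)^-1).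
  by apply: (symbol_le _ (M (M So (M St Ss')) SqV)); lra.
have h2 : sym (-1) (fun x => o x * (s x * 'D_1 t x) * (q x)^-1).
  by apply: (symbol_le _ (M (M So (M Ss St')) SqV)); lra.
apply: (symbol_eq oI _ (symbolB oI I0 h1 h2)) => x Ix.
rewrite /end_metric /psi_metric /psi_vertical /psi_horizontal /= -/k -/o -/t -/s -/q.
by ring.
Qed.

Let S12 : sym 0 (fun x => s x * t x * o x / q x).
Proof. by apply: (symbol_le _ (M (M (M Ss St) So) SqV)); lra. Qed.

(** From [s^2 / q = q - (c + t^2) / q], whence the coefficient 1/4 of the cone. *)
Let S11 : sym 0 (fun x => s x ^+ 2 / q x - x ^+ 2 / 4).
Proof.
have h1 : sym 0 (fun x => - (c * (q x)^-1)).
  by apply: (symbol_le _ (symbolN oI I0 (symbolZ I0 c SqV))); lra.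
have h2 : sym 0 (fun x => - (t x * t x * (q x)^-1)).
  by apply: (symbol_le _ (symbolN oI I0 (M (M St St) SqV))); lra.
apply: (symbol_eq oI _ (symbolD h1 h2)) => x Ix.
rewrite s2// /fs2 -/t -/q; have := q0 Ix; rewrite /q /fq addr0 => q0x.
by field; rewrite gt_eqF// I0.
Qed.

(** From [2 q k^2 = 2 q - 2 q o^2] and [2 q = x^2 / 2]: the base part of the metric produces the
    coefficients 1/2 of the cone. *)
Let Sqk : sym 0 (fun x => 2 * q x * k x ^+ 2 - x ^+ 2 / 2).
Proof.
have h1 : sym 0 (fun x => - (2 * (q x * (o x * o x)))).
  by apply: (symbol_le _ (symbolN oI I0 (symbolZ I0 2 (M Sq (M So So))))); lra.
apply: (symbol_eq oI _ h1) => x Ix.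
by rewrite k2// /q /fq addr0; field.
Qed.

Let S22 : sym 0 (fun x => o x ^+ 2 * t x ^+ 2 / q x + 2 * q x * k x ^+ 2 - x ^+ 2 / 2).
Proof.
have h1 : sym 0 (fun x => o x * o x * (t x * t x) * (q x)^-1).
  by apply: (symbol_le _ (M (M (M So So) (M St St)) SqV)); lra.
by apply: (symbol_eq oI _ (symbolD h1 Sqk)) => x Ix; ring.
Qed.

Let S33 : sym 0 (fun x => o x ^+ 2 * (t x ^+ 2 + s x ^+ 2) / q x + 2 * q x * k x ^+ 2
  - x ^+ 2 / 2).
Proof.
have h1 : sym 0 (fun x => o x * o x * (s x * s x) * (q x)^-1).
  by apply: (symbol_le _ (M (M (M So So) (M Ss Ss)) SqV)); lra.
by apply: (symbol_eq oI _ (symbolD h1 S22)) => x Ix; ring.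
Qed.

(** Up to symmetry, the off-diagonal components that need an estimate are those of indices (0, 3)
    and (1, 2). *)
Lemma ac_end_metric a b : sym (- 2 + wt a + wt b) (fun x => end_metric c u v 0 x a b
  - nth 0 [:: 1; x ^+ 2 * 4^-1; x ^+ 2 * 2^-1; x ^+ 2 * 2^-1] a *+ (a == b)).
Proof.
have Z l f : (forall x, f x = 0) -> sym l f.
  by move=> f0; apply: (symbol_eq oI _ (symbol0 ac_domain l)) => x _; rewrite f0.
elim/ord4P: a; elim/ord4P: b; rewrite /wt /= ?mulr1n ?mulr0n.
- by apply: (symbol_le _ S00); lra.
- by apply: Z => x; rewrite /end_metric /psi_metric /psi_vertical /psi_horizontal /=; ring.
- by apply: Z => x; rewrite /end_metric /psi_metric /psi_vertical /psi_horizontal /=; ring.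
- by apply: (symbol_le (l := -1)); [lra | apply: (symbol_eq oI _ S03) => x _;
    rewrite /end_metric /psi_metric /psi_vertical /psi_horizontal /= subr0].
- by apply: Z => x; rewrite /end_metric /psi_metric /psi_vertical /psi_horizontal /=; ring.
- by apply: (symbol_le (l := 0)); [lra | apply: (symbol_eq oI _ S11) => x _;
    rewrite /end_metric /psi_metric /psi_vertical /psi_horizontal /= mulr0 addr0].
- by apply: (symbol_le (l := 0)); [lra | apply: (symbol_eq oI _ S12) => x _;
    rewrite /end_metric /psi_metric /psi_vertical /psi_horizontal /= mulr0 addr0 subr0].
- by apply: Z => x; rewrite /end_metric /psi_metric /psi_vertical /psi_horizontal /=; ring.
- by apply: Z => x; rewrite /end_metric /psi_metric /psi_vertical /psi_horizontal /=; ring.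
- by apply: (symbol_le (l := 0)); [lra | apply: (symbol_eq oI _ S12) => x _;
    rewrite /end_metric /psi_metric /psi_vertical /psi_horizontal /= mulr0 addr0 subr0].
- by apply: (symbol_le (l := 0)); [lra | apply: (symbol_eq oI _ S22) => x _;
    rewrite /end_metric /psi_metric /psi_vertical /psi_horizontal /=].
- by apply: Z => x; rewrite /end_metric /psi_metric /psi_vertical /psi_horizontal /=; ring.
- by apply: (symbol_le (l := -1)); [lra | apply: (symbol_eq oI _ S03) => x _;
    rewrite /end_metric /psi_metric /psi_vertical /psi_horizontal /= subr0].
- by apply: Z => x; rewrite /end_metric /psi_metric /psi_vertical /psi_horizontal /=; ring.
- by apply: Z => x; rewrite /end_metric /psi_metric /psi_vertical /psi_horizontal /=; ring.
- by apply: (symbol_le (l := 0)); [lra | apply: (symbol_eq oI _ S33) => x _;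
    rewrite /end_metric /psi_metric /psi_vertical /psi_horizontal /=].
Qed.

End AsymptoticallyConical.

(** * The singular end for c > 0 *)

Section ConicallySingular.
Context {R : realType} (m v : R).
(** With [c = m^2], the circle v = 2 c^(1/4) of singular values is [v^2 = 4 m]. *)
Hypotheses (m_gt0 : 0 < m) (v2 : v ^+ 2 = 4 * m).

Definition cs_domain : set R := [set x | 0 < x < 1].

Let c : R := m ^+ 2.
Let m_ge0 : 0 <= m. Proof. exact: ltW. Qed.

Lemma open_cs_domain : open cs_domain.
Proof.
rewrite (_ : cs_domain = [set x | 0 < x] `&` [set x | x < 1]).
  by apply: openI; [exact: open_gt | exact: open_lt].
by apply/seteqP; split=> x /=; [move/andP | move=> h; apply/andP].
Qed.

Lemma cs_domain_gt0 x : cs_domain x -> 0 < x.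
Proof. by move=> /andP[]. Qed.

Let q := fq m.

Let q_ge x : m <= q x.
Proof. by rewrite /q /fq lerDr divr_ge0// sqr_ge0. Qed.

Let q_gt0 x : 0 < q x. Proof. exact: lt_le_trans (q_ge x). Qed.

Let x2E x : x ^+ 2 = 4 * (q x - m).
Proof. by rewrite /q /fq; field. Qed.

(** Since [v^2 / 4 = m], the cosine squared is [(q - m) / q], which tends to 0 at the singular
    point. *)
Lemma cs_fcos2 x : fcos2 v m x = x ^+ 2 / 4 / q x.
Proof.
have qx : q x != 0 by rewrite gt_eqF.
by rewrite /fcos2 v2 -/q x2E; field.
Qed.

Lemma cs_fcos2_gt0 x : cs_domain x -> 0 < fcos2 v m x.
Proof. by move=> /cs_domain_gt0 x0; rewrite cs_fcos2 !divr_gt0// exprn_gt0. Qed.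

Lemma cs_ft x : ft 0 v m x = 0. Proof. by rewrite /ft mul0r. Qed.

Lemma cs_fs2 x : fs2 c 0 v m x = x ^+ 2 / 4 * (q x + m).
Proof. by rewrite /fs2 cs_ft /q /fq /c; ring. Qed.

Lemma cs_fs2_gt0 x : cs_domain x -> 0 < fs2 c 0 v m x.
Proof.
move=> /cs_domain_gt0 x0; rewrite cs_fs2; apply: mulr_gt0; last exact: addr_gt0.
by rewrite divr_gt0// exprn_gt0.
Qed.

Local Notation sym := (symbol cs_domain).
Let oI := open_cs_domain.
Let I0 := cs_domain_gt0.
Let M l l' f g (fl : sym l f) (gl : sym l' g) := symbolM I0 fl gl.

(** Below 1 the comparison of orders is reversed with respect to the infinite end. *)
Let symbol_ge l l' f : l' <= l -> sym l f -> sym l' f.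
Proof.
move=> ll'; apply: symbol_mono => //; exists 1 => x /andP[x0 x1]; rewrite mul1r.
rewrite -[l]opprK -[l']opprK !(powRN _ (- _)) -!powR_inv1 ?powR_ge0// -!powRrM.
rewrite !mulrN1 !opprK.
rewrite -(subrK l' l) powRD ?(gt_eqF x0) ?implybT//.
rewrite ler_piMl ?powR_ge0// -(powRr0 x); apply: ger_powR; rewrite ?subr_ge0//.
by rewrite x0 ltW.
Qed.

Let k := fcos v m.
Let o := fsin v m.
Let t := ft (0 : R) v m.
Let s := fs c 0 v m.

Let Sc (a : R) : sym 0 (fun _ => a) := symbol_cst cs_domain a.
Let Sx2 : sym 2 (fun x => x ^+ 2) := symbol_exprn oI I0 2.

Let Sq : sym 0 q.
Proof.
apply: symbolD => //; apply: (@symbol_ge (2 + 0)); first by lra.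
by apply: M => //; exact: Sc.
Qed.

Let SqV : sym 0 (fun x => (q x)^-1).
Proof. by apply: (symbolV oI I0 m_gt0) => // x _. Qed.

Let SqmV : sym 0 (fun x => (q x + m)^-1).
Proof.
apply: (symbolV oI I0 m_gt0) => [x _|]; last exact: symbolD.
by rewrite lerDr ltW.
Qed.

Let D := is_derive_profile oI m_ge0 I0 cs_fcos2_gt0 cs_fs2_gt0.

Let q0 x : q x != 0. Proof. by rewrite gt_eqF. Qed.
Let qm0 x : q x + m != 0. Proof. by rewrite gt_eqF// addr_gt0. Qed.

(** As t = 0, the nonzero components of the metric involve only the squares of k, o, s and of their
    derivatives. These are rational in x and q, so no root has to be estimated. *)
Let k2 x : cs_domain x -> k x ^+ 2 = x ^+ 2 / 4 / q x.
Proof. by move=> Ix; rewrite (fcos_sqr cs_fcos2_gt0)// cs_fcos2. Qed.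

Let o2 x : cs_domain x -> o x ^+ 2 = m / q x.
Proof.
by move=> Ix; rewrite (fsin_sqr v m_ge0 I0)// v2 -/q; field.
Qed.

Let s2 x : cs_domain x -> s x ^+ 2 = x ^+ 2 / 4 * (q x + m).
Proof. by move=> Ix; rewrite /s /fs sqr_sqrtr ?cs_fs2// -cs_fs2 ltW// cs_fs2_gt0. Qed.

Let t'E x : cs_domain x -> 'D_1 t x = 0.
Proof.
move=> Ix; have -> : t = cst 0 by apply/funext => y; exact: cs_ft.
exact: derive_cst.
Qed.

Let s'2 x : cs_domain x -> 'D_1 s x ^+ 2 = q x ^+ 2 / (q x + m).
Proof.
move=> Ix; have x0 : x != 0 by rewrite gt_eqF// I0.
have := fs_derive oI m_ge0 I0 cs_fcos2_gt0 cs_fs2_gt0 Ix.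
rewrite -/s -/q cs_ft mul0r mulr0 subr0 => e.
have s0 : s x ^+ 2 != 0 by rewrite s2// mulf_neq0// mulf_neq0// sqrf_eq0.
apply: (@mulfI R (4 * s x ^+ 2)); first by rewrite mulf_neq0// s0.
transitivity ((2 * (s x * 'D_1 s x)) ^+ 2); first by ring.
by rewrite e s2//; field; rewrite qm0.
Qed.

(** Differentiates [q o^2 = m]. *)
Let oo' x : cs_domain x -> o x * 'D_1 o x = - (m * x / (4 * q x ^+ 2)).
Proof.
move=> Ix; have do_ : is_derive x 1 o ('D_1 o x) by case: (D Ix).
have d1 : is_derive x 1 (fun y => (y * y / 4 + m) * (o y * o y))
    (x / 2 * o x ^+ 2 + 2 * q x * (o x * 'D_1 o x)).
  apply: is_derive_eq; by rewrite /GRing.scale /= /q /fq; field.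
have d2 : is_derive x 1 (fun y => (y * y / 4 + m) * (o y * o y)) 0.
  apply: (@is_derive_near R R R (cst m) _ cs_domain) => //.
  move=> y Iy; have := o2 Iy; rewrite expr2 => -> /=.
  by rewrite -expr2 -[_ / 4 + m]/(q y) mulrC mulfVK// q0.
have [_ e1] := d1; have [_ e2] := d2; move: e1; rewrite e2 o2// => e.
apply: (@mulfI R (2 * q x)); first by rewrite mulf_neq0.
apply: (@addrI R (x / 2 * (m / q x))); rewrite -e; field; exact: q0.
Qed.

Let o'2 x : cs_domain x -> 'D_1 o x ^+ 2 = m * x ^+ 2 / (16 * q x ^+ 3).
Proof.
move=> Ix; have m0 : m != 0 by rewrite gt_eqF.
apply: (@mulfI R (o x ^+ 2)); first by rewrite o2// mulf_neq0// invr_eq0.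
by rewrite -exprMn oo'// o2//; field; rewrite q0.
Qed.

Let k'2 x : cs_domain x -> 'D_1 k x ^+ 2 = m ^+ 2 / (4 * q x ^+ 3).
Proof.
move=> Ix; have x0 : x != 0 by rewrite gt_eqF// I0.
apply: (@mulfI R (k x ^+ 2)).
  by rewrite k2// mulf_neq0 ?invr_eq0// mulf_neq0 ?sqrf_eq0.
rewrite -exprMn (fcos_derive oI m_ge0 I0 cs_fcos2_gt0 cs_fs2_gt0)// -/o sqrrN oo'// k2//.
by field; rewrite q0.
Qed.

(** The fibre part is [q / (q + m)] and the base part [m / (2 q)], both tending to 1/2; their sum
    minus 1 is [- m x^2 / (8 q (q + m))]. *)
Let S00 : sym 2 (fun x => end_metric c 0 v m x ord0 ord0 - 1).
Proof.
have h : sym 2 (fun x => - (m / 8) * (x ^+ 2 * ((q x)^-1 * (q x + m)^-1))).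
  have := symbolZ I0 (- (m / 8)) (M Sx2 (M SqV SqmV)).
  by congr (sym _ _); ring.
apply: (symbol_eq oI _ h) => x Ix.
rewrite /end_metric /psi_metric /psi_vertical /psi_horizontal /= -/k -/o -/t -/s -/q.
rewrite t'E// s'2// k'2// o'2//.
by rewrite x2E; field; rewrite q0 qm0.
Qed.

Let S11 : sym 4 (fun x => s x ^+ 2 / q x - x ^+ 2 / 2).
Proof.
have h : sym 4 (fun x => - 16^-1 * (x ^+ 2 * x ^+ 2 * (q x)^-1)).
  have := symbolZ I0 (- 16^-1) (M (M Sx2 Sx2) SqV).
  by congr (sym _ _); ring.
apply: (symbol_eq oI _ h) => x Ix; rewrite s2//.
by rewrite x2E; field; rewrite q0.
Qed.

(** The terms [o^2 s^2 / q] and [2 q k^2] each contribute x^2 / 2 to leading order, whence the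
    coefficient 1 of sigma_3^2. *)
Let S33 : sym 4 (fun x => o x ^+ 2 * s x ^+ 2 / q x + 2 * q x * k x ^+ 2 - x ^+ 2).
Proof.
have h1 : sym 4 (fun x => x ^+ 2 * x ^+ 2 * ((q x)^-1 * (q x)^-1) *
    (- (3 * m / 16) + - 32^-1 * x ^+ 2)).
  have h2 : sym 0 (fun x => - (3 * m / 16) + - 32^-1 * x ^+ 2).
    apply: symbolD; first exact: Sc.
    by apply: (symbol_ge _ (symbolZ I0 (- 32^-1) Sx2)); lra.
  by have := M (M (M Sx2 Sx2) (M SqV SqV)) h2; congr (sym _ _); ring.
apply: (symbol_eq oI _ h1) => x Ix; rewrite s2// o2// k2//.
by rewrite x2E; field; rewrite q0.
Qed.

Lemma cs_end_metric a b : sym (2 + wt a + wt b) (fun x => end_metric c 0 v m x a b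
  - nth 0 [:: 1; x ^+ 2 * 2^-1; x ^+ 2 * 2^-1; x ^+ 2 * 1] a *+ (a == b)).
Proof.
have Z l f : (forall x, cs_domain x -> f x = 0) -> sym l f.
  by move=> f0; apply: (symbol_eq oI _ (symbol0 cs_domain l)) => x Ix; rewrite f0.
elim/ord4P: a; elim/ord4P: b; rewrite /wt /= ?mulr1n ?mulr0n.
- by apply: (symbol_ge _ S00); lra.
all: try (by apply: Z => x Ix; rewrite /end_metric /psi_metric /psi_vertical
  /psi_horizontal /= ?t'E// ?cs_ft; ring).
- apply: (symbol_ge (l := 4)); [lra | apply: (symbol_eq oI _ S11) => x _].
  by rewrite /end_metric /psi_metric /psi_vertical /psi_horizontal /= mulr0 addr0.
(* In this component [2 q k^2 = x^2 / 2] holds exactly, so there is no deviation at all. *)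
- apply: Z => x Ix; rewrite /end_metric /psi_metric /psi_vertical /psi_horizontal /=.
  rewrite cs_ft -/k -/q k2//; field; exact: q0.
- apply: (symbol_ge (l := 4)); [lra | apply: (symbol_eq oI _ S33) => x _].
  rewrite /end_metric /psi_metric /psi_vertical /psi_horizontal /=.
  by rewrite cs_ft -/k -/o -/s -/q mulr1n; ring.
Qed.

End ConicallySingular.

(** * Topology of the fibres *)

Section FibreTopology.
Context {R : realType}.

Lemma closure_eq0 (T : topologicalType) (A : set T) (f : T -> R) p :
  continuous f -> (forall q, A q -> f q = 0) -> closure A p -> f p = 0.
Proof.
move=> cf Af Ap; have cl : closed (f @^-1` [set 0]).
  by apply: preimage_closed => [q _|]; [exact: cf | exact: closed_eq].
by apply: cl; apply: closure_subset Ap => q Aq /=; exact: Af.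
Qed.

Let cont (f : @BSamb R -> R) : Ck 0 setT f -> continuous f.
Proof. by move=> [+ _] p; apply. Qed.

Let c1 i j : Ck 0 setT (fun p : @BSamb R => p.1 i j).
Proof. exact: Ck_fst_coord openT. Qed.

Let c2 i j : Ck 0 setT (fun p : @BSamb R => p.2 i j).
Proof. exact: Ck_snd_coord openT. Qed.

(** All four defining conditions are equations between continuous functions. *)
Lemma closure_Lambda (A : set (@BSamb R)) : A `<=` @Lambda2minus R ->
  closure A `<=` @Lambda2minus R.
Proof.
have oT : open [set: @BSamb R] := openT; move=> AL p clp; split.
- apply/eqP; rewrite -subr_eq0; apply/eqP.
  apply: (@closure_eq0 _ A (fun q => inner q.1 q.1 - 1)) clp => [|q /AL[-> _ _ _]].
    apply: cont; apply: CkD => //; last exact: Ck_cst.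
    by apply: Ck_sum => // i; apply: Ck_sum => // j; exact: CkM.
  by rewrite subrr.
- apply/matrixP => i j; apply/eqP; rewrite -subr_eq0; apply/eqP.
  rewrite !mxE opprK.
  apply: (@closure_eq0 _ A (fun q => q.2 j i + q.2 i j)) clp => [|q /AL[_ qT _ _]].
    by apply: cont; exact: CkD.
  by have := congr1 (fun M : 'M[R]_5 => M i j) qT; rewrite !mxE => ->; rewrite addNr.
- apply/rowP => j; rewrite [LHS]mxE [RHS]mxE.
  apply: (@closure_eq0 _ A (fun q => \sum_k q.1 ord0 k * q.2 k j)) clp => [|q /AL[_ _ qm _]].
    by apply: cont; apply: Ck_sum => // k; exact: CkM.
  by have := congr1 (fun M : 'rV[R]_5 => M ord0 j) qm; rewrite !mxE.
- apply/matrixP => i j; apply/eqP; rewrite -subr_eq0; apply/eqP.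
  rewrite [X in _ - X]mxE opprK hodgeE.
  apply: (@closure_eq0 _ A (fun q => 2^-1 * (\sum_(k < 5) \sum_(l < 5)
    (\sum_(m < 5) q.1 ord0 m * (levi_civita m i j k l)%:~R) * q.2 k l) + q.2 i j)) clp.
    apply: cont; apply: CkD => //; apply: CkM => //; first exact: Ck_cst.
    apply: Ck_sum => // k; apply: Ck_sum => // l; apply: CkM => //.
    by apply: Ck_sum => // m; apply: CkM => //; exact: Ck_cst.
  move=> q /AL[_ _ _ qh]; rewrite -hodgeE.
  by have := congr1 (fun M : 'M[R]_5 => M i j) qh; rewrite [RHS]mxE => ->; rewrite addNr.
Qed.

Lemma powR_inv4 (x : R) : 0 <= x -> x `^ 4^-1 = Num.sqrt (Num.sqrt x).
Proof.
move=> x0; rewrite -!powR12_sqrt ?powR_ge0// -powRrM.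
by congr (_ `^ _); field.
Qed.

Lemma BSfibre_Lambda c b : BSfibre c b `<=` @Lambda2minus R.
Proof. by move=> p [+ _]; rewrite /BSspace; case: ifP => // _ []. Qed.

(** Writing the fourth root as an iterated square root gives continuity also at the zeros of
    [c + r^2]. *)
Lemma closure_BSfibration (c : R) (b : R * R * R) (p : @BSamb R) : 0 <= c ->
  closure (BSfibre c b) p -> BSfibration c p = b.
Proof.
move=> c0 clp; have oT : open [set: @BSamb R] := openT.
have cr (q : @BSamb R) : 0 <= c + rsq q.2 by rewrite addr_ge0// rsq_ge0.
have cs : continuous (fun q : @BSamb R => Num.sqrt (Num.sqrt (c + rsq q.2))).
  move=> q; apply: (@continuous_comp _ _ _ (fun q : @BSamb R => Num.sqrt (c + rsq q.2)) Num.sqrt);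
    last exact: sqrt_continuous.
  apply: (@continuous_comp _ _ _ (fun p : @BSamb R => c + rsq p.2) Num.sqrt);
    last exact: sqrt_continuous.
  by apply: cvgD; [exact: cvg_cst | exact: continuous_rsq].
case: b clp => [[u b4] b5] clp; rewrite /BSfibration powR_inv4//.
have sub0 (x y : R) : x - y = 0 -> x = y by move/eqP; rewrite subr_eq0 => /eqP.
congr (_, _, _); apply: sub0.
- apply: (@closure_eq0 _ _ (fun q : @BSamb R => q.2 i4 i5 - u) _ _ _ clp).
    by apply: cont; apply: CkD => //; exact: Ck_cst.
  by move=> q [_ [-> _ _]]; rewrite subrr.
- apply: (@closure_eq0 _ _ (fun q : @BSamb R =>
    2 * Num.sqrt (Num.sqrt (c + rsq q.2)) * q.1 ord0 i4 - b4) _ _ _ clp).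
    move=> q; apply: cvgB; last exact: cvg_cst.
    by apply: cvgM; [apply: cvgM; [exact: cvg_cst | exact: cs] | exact: cont].
  by move=> q [_ [_ + _]]; rewrite powR_inv4// => ->; rewrite subrr.
- apply: (@closure_eq0 _ _ (fun q : @BSamb R =>
    2 * Num.sqrt (Num.sqrt (c + rsq q.2)) * q.1 ord0 i5 - b5) _ _ _ clp).
    move=> q; apply: cvgB; last exact: cvg_cst.
    by apply: cvgM; [apply: cvgM; [exact: cvg_cst | exact: cs] | exact: cont].
  by move=> q [_ [_ _]]; rewrite powR_inv4// => ->; rewrite subrr.
Qed.

(** A limit of the fibre can leave the space only when c = 0, by reaching the zero section. Its
    image is then the origin, so [b] is singular and the limit lies in [singular_part]. *)
Lemma closure_BSfibre (c : R) (b : R * R * R) (p : @BSamb R) : 0 <= c -> closure (BSfibre c b) p ->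
  ~ singular_part c b p -> BSfibre c b p.
Proof.
move=> c0 clp nZ; have fp := closure_BSfibration c0 clp.
have Lp := closure_Lambda (@BSfibre_Lambda c b) clp.
split=> //; rewrite /BSspace; case: eqP => // cE; split=> // zp.
apply: nZ; split=> //; have [_ /= w0] := zp.
rewrite -fp /BSfibration /singular_value /= cE w0 rsq0 addr0 mxE.
by rewrite powR0 ?invr_eq0// !mulr0 !mul0r expr0n /= addr0.
Qed.

Lemma compact_box (C : R) : compact [set p : @BSamb R |
  (forall j, `|p.1 ord0 j| <= C) /\ forall i j, `|p.2 i j| <= C].
Proof.
have B1 n : compact [set x : 'rV[R]_n | forall j, `[- C, C]%classic (x ord0 j)].
  apply: (@rV_compact _ n (fun=> `[- C, C]%classic)) => _; exact: segment_compact.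
have B2 : compact (vec_mx @` [set x : 'rV[R]_(5 * 5) | forall j, `[- C, C]%classic (x ord0 j)]
    : set 'M[R]_5).
  apply: continuous_compact (B1 _); apply: continuous_subspaceT => x.
  have h : Ck 0 setT (fun x : 'rV[R]_(5 * 5) => vec_mx x : 'M[R]_5).
    apply: Ck_mx => [|i j]; first exact: openT.
    apply: Ck_linear; first exact: openT.
      rewrite (_ : (fun x => _) = fun x : 'rV[R]_(5 * 5) => x ord0 (mxvec_index i j)).
        exact: coord_continuous.
      by apply/funext => y; rewrite mxE.
    by move=> a y z; rewrite !mxE.
  by have [+ _] := h; apply.
have := compact_setX (B1 5%N) B2; congr compact.
apply/seteqP; split=> -[x w] /=.
  move=> [hx [y hy <-]]; split=> [j|i j].
    by have := hx j; rewrite /= in_itv /= ler_norml.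
  by rewrite mxE; have := hy (mxvec_index i j); rewrite /= in_itv /= ler_norml.
move=> [hx hw]; split=> [j|]; first by rewrite /= in_itv /= -ler_norml.
exists (mxvec w); last exact: mxvecK.
move=> j; case/mxvec_indexP: j => i j; rewrite mxvecE.
by rewrite /= in_itv /= -ler_norml.
Qed.

Lemma entry_rsq (w : 'M[R]_5) i j : w i j ^+ 2 <= 4 * rsq w.
Proof.
rewrite /rsq mulrA divff// mul1r /inner (bigD1 i)//= (bigD1 j)//= -addrA -expr2.
rewrite lerDl addr_ge0// ?sumr_ge0// => [j' _|i' _]; first by rewrite -expr2 sqr_ge0.
by apply: sumr_ge0 => j' _; rewrite -expr2 sqr_ge0.
Qed.

Lemma entry_unit (x : 'rV[R]_5) j : inner x x = 1 -> `|x ord0 j| <= 1.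
Proof.
rewrite inner_row (bigD1 j)//= => x1.
rewrite -(ler_pXn2r (n := 2))// ?nnegrE// real_normK ?num_real// expr1n -x1 expr2.
by rewrite lerDl sumr_ge0// => j' _; rewrite -expr2 sqr_ge0.
Qed.

(** Closed and bounded: base points are unit vectors, and a bound on the radius bounds [rsq], hence
    all entries of the 2-form. *)
Lemma compact_fibre_part (c : R) (b : R * R * R) (r : R) : 0 <= c ->
  compact (closure (BSfibre c b) `&` [set p | end_radius c 0 p <= r]).
Proof.
move=> c0; set X := _ `&` _.
have clX : closed X.
  apply: closedI; first exact: closed_closure.
  apply: (@preimage_closed _ _ (end_radius c 0) [set y | y <= r]) => [q _|].
    exact: continuous_end_radius.
  exact: closed_le.
(* A radius at most [r] gives [rsq <= (r / 2)^4], squares of entries are at most [4 rsq], and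
   [C >= 1] allows replacing [C] by [C^2]. *)
pose C := 1 + 4 * ((r / 2) ^+ 2) ^+ 2.
apply: (subclosed_compact clX (@compact_box C)) => p [clp rp].
have [p1 _ _ _] := closure_Lambda (@BSfibre_Lambda c b) clp.
have C1 : 1 <= C by rewrite lerDl mulr_ge0// sqr_ge0.
have rsq_le : rsq p.2 <= ((r / 2) ^+ 2) ^+ 2.
  have cr : 0 <= c + rsq p.2 by rewrite addr_ge0// rsq_ge0.
  apply: (@le_trans _ _ (c + rsq p.2)); first by rewrite lerDr.
  rewrite -[leLHS]sqr_sqrtr// ler_pXn2r ?nnegrE ?sqrtr_ge0 ?sqr_ge0//.
  rewrite -[leLHS]sqr_sqrtr ?sqrtr_ge0//.
  have h : Num.sqrt (Num.sqrt (c + rsq p.2)) <= r / 2.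
    by move: rp; rewrite /= /end_radius subr0 ler_pdivlMr// mulrC.
  by rewrite ler_pXn2r ?nnegrE ?sqrtr_ge0// (le_trans _ h) ?sqrtr_ge0.
split=> [j|i j]; first exact: le_trans (entry_unit j p1) C1.
have w2 := entry_rsq p.2 i j.
rewrite -(ler_pXn2r (n := 2))// ?nnegrE ?(le_trans _ C1)//.
rewrite real_normK ?num_real//; apply: le_trans w2 _.
have CC : C <= C ^+ 2 by rewrite ler_eXnr.
apply: le_trans CC; rewrite /C; move: rsq_le; set y := _ ^+ 2; lra.
Qed.

Lemma polar_decomposition (x y : R) : exists v n3 n4 : R,
  [/\ 0 <= v, n3 ^+ 2 + n4 ^+ 2 = 1, x = v * n3 & y = v * n4].
Proof.
have s0 : 0 <= x ^+ 2 + y ^+ 2 by rewrite addr_ge0// sqr_ge0.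
pose v := Num.sqrt (x ^+ 2 + y ^+ 2).
have v2 : v ^+ 2 = x ^+ 2 + y ^+ 2 by rewrite sqr_sqrtr.
have [v0|v0] := eqVneq v 0.
  have : x ^+ 2 + y ^+ 2 == 0 by rewrite -v2 v0 expr0n.
  rewrite paddr_eq0 ?sqr_ge0// !sqrf_eq0 => /andP[/eqP -> /eqP ->].
  exists 0, 1, 0; split; rewrite ?lexx ?mul0r//.
  by rewrite expr1n expr0n addr0.
exists v, (x / v), (y / v); split; first exact: sqrtr_ge0.
- by rewrite !expr_div_n -mulrDl -v2 divff// sqrf_eq0.
- by rewrite mulrC mulfVK.
- by rewrite mulrC mulfVK.
Qed.

Lemma SO3_entry (A : 'M[R]_3) i j : SO3 A -> `|A i j| <= 1.
Proof.
move=> /SO3_dot/(_ j j); rewrite eqxx /dot => A1.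
rewrite -(ler_pXn2r (n := 2))// ?nnegrE// real_normK ?num_real// expr1n -[1]/(true%:R) -A1.
have := sqr_ge0 (A '3_0 j); have := sqr_ge0 (A '3_1 j); have := sqr_ge0 (A '3_2 j).
by rewrite -!expr2; elim/ord3P: i => ? ? ?; lra.
Qed.

End FibreTopology.

(** * Conical ends of the fibres *)

Section MainParts.
Context {R : realType}.

(** The compact part is cut out by [end_radius <= r0]. Adding the singular part back gives the
    closure of the fibre up to that radius, so smooth and singular fibres need no separate
    treatment. *)
Lemma fibre_asymptotically_conical (c : R) (b : R * R * R) : 0 <= c ->
  asymptotically_conical (BSmetric c) (BSfibre c b) (singular_part c b) g_AC (- 2).
Proof.
move=> c0; case: b => [[u b4] b5].
have [v [n3 [n4 [v0 n1 -> ->]]]] := polar_decomposition b4 b5.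
set b := (u, v * n3, v * n4); set r0 := ac_radius c u v.
have r0_gt0 : 0 < r0 by apply: lt_le_trans (ac_radius_ge1 u v c0).
(* On the zero section the radius is 2 c^(1/4), which is at most 1 + 32 c. *)
have Zr p : singular_part c b p -> end_radius c 0 p <= r0.
  move=> [_ [_ [_ /= w0]]]; rewrite /end_radius w0 rsq0 addr0 subr0.
  set y := Num.sqrt (Num.sqrt c).
  have cE : c = (y ^+ 2) ^+ 2 by rewrite /y !sqr_sqrtr// sqrtr_ge0.
  rewrite /r0 /ac_radius {1}cE; have := sqr_ge0 u; have := sqr_ge0 v.
  have : 0 <= (y ^+ 2 - 4^-1) ^+ 2 by exact: sqr_ge0.
  have : 0 <= (y - 1) ^+ 2 by exact: sqr_ge0.
  by nra.
pose K := [set p | (BSfibre c b `\` singular_part c b) p /\ end_radius c 0 p <= r0].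
exists K, r0, (end_map n3 n4 c u v 0) => dom.
have I0 := ac_domain_gt0 (u := u) (v := v) c0.
have Ic := ac_fcos2_gt0 (u := u) (v := v) c0.
have Is := ac_fs2_gt0 (u := u) (v := v) c0.
have oI := @open_ac_domain R c u v.
split=> //.
- by move=> p [].
- have -> : K `|` singular_part c b = closure (BSfibre c b) `&`
      [set p | end_radius c 0 p <= r0]; last exact: compact_fibre_part.
  apply/seteqP; split=> [p [[[Np _] rp]|Zp]|p [clp rp]].
  + by split=> //; exact: subset_closure.
  + by split; [case: Zp => _ [] | exact: Zr].
  + have [Zp|nZ] := pselect (singular_part c b p); first by right.
    by left; split=> //; split=> //; exact: closure_BSfibre.
- have -> : (BSfibre c b `\` singular_part c b) `\` K =
      end_set n3 n4 c u v 0 (ac_domain c u v).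
    apply/seteqP; split=> [p [Np nK]|p [Np pm rp]].
      have rp : r0 < end_radius c 0 p.
        by rewrite ltNge; apply/negP => rp; apply: nK.
      split=> //; first by case: Np.
      rewrite -sqrtr_gt0 -(pmulr_rgt0 (x := 2))//; exact: lt_trans rp.
    have rp' : r0 < end_radius c 0 p := rp.
    split; last by move=> [_]; rewrite leNgt rp'.
    by split=> // /Zr; rewrite leNgt rp'.
  exact: end_diffeomorphism.
- move=> j; have [C HC] := end_deviation oI (lexx 0) I0 Ic Is n1 j
    (q1 := 4^-1) (q2 := 2^-1) (q3 := 2^-1) (rate := -2)
    ltac:(by rewrite invr_gt0) ltac:(by rewrite invr_gt0) ltac:(by rewrite invr_gt0)
    (ac_end_metric u v c0).
  by exists C, 0 => p dp _; exact: HC.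
Qed.

(** The limit is the zero form above (0, 0, 0, n3, n4). With t = 0 the coordinates of the base point
    move by at most k and 1 - o, and the entries of the 2-form by at most 2 s. *)
Lemma psi_near (n3 n4 k o s e : R) (A : 'M[R]_3) : `|n3| <= 1 -> `|n4| <= 1 ->
  0 < k -> 0 < s -> k <= 1 -> 0 <= o -> o <= 1 ->
  k < e -> 1 - o < e -> 2 * s < e -> (forall i j, `|A i j| <= 1) ->
  ball (bspoint n3 n4 (fun=> 0) 1 0 (fun=> 0) (fun=> 0) (fun=> 0)) e (psi n3 n4 k o 0 s A).
Proof.
move=> n31 n41 k0 s0 k1 o0 o1 ke oe se A1; have e0 : 0 < e by exact: lt_trans ke.
have mulB (a x y : R) : `|a| <= 1 -> `|x| <= y -> `|a * x| <= y.
  move=> a1 xy; rewrite normrM; apply: le_trans xy.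
  by rewrite ler_piMl.
have combB u1 u2 u3 y j : (u2 = 0 /\ u3 = 0 /\ `|u1| <= y) \/ (u1 = 0 /\ u3 = 0 /\ `|u2| <= y)
    \/ (u1 = 0 /\ u2 = 0 /\ `|u3| <= y) -> `|comb A (vec3 u1 u2 u3) j| <= y.
  by rewrite /comb /vec3 /= => -[[-> [-> h]]|[[-> [-> h]]|[-> [-> h]]]];
    rewrite !mulr0 ?addr0 ?add0r; exact: mulB.
have s1 x : 0 <= x -> x <= 1 -> `|x * s| <= s.
  by move=> x0 x1; apply: mulB; rewrite ?ger0_norm// ltW.
have HP j : `|comb A (vec3 (- 0) (o * s) 0) j| <= s.
  by apply: combB; right; left; rewrite oppr0; do 2?split=> //; exact: s1.
have HN j : `|comb A (vec3 0 0 (- (s * k))) j| <= s.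
  apply: combB; right; right; do 2?split=> //.
  by rewrite normrN mulrC; apply: s1 => //; exact: ltW.
have HB j : `|comb A (vec3 (- (o * 0)) s 0) j| <= s.
  apply: combB; right; left; rewrite mulr0 oppr0; do 2?split=> //.
  by rewrite ger0_norm// ltW.
have HX (a b x y : R) : `|a| <= 1 -> `|b| <= 1 -> `|x| <= s -> `|y| <= s ->
    `|a * x + b * y| < e.
  move=> a1 b1 xs ys; apply: le_lt_trans se; apply: le_trans (ler_normD _ _) _.
  by rewrite mulr2n mulrDl mul1r lerD// mulB.
have HX' (a b x y : R) : `|a| <= 1 -> `|b| <= 1 -> `|x| <= s -> `|y| <= s ->
    `|a * x - b * y| < e by move=> a1 b1 xs ys; rewrite -mulrN; apply: HX; rewrite ?normrN.
have sX (x : R) : `|x| <= s -> `|x| < e.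
  by move=> xs; apply: le_lt_trans xs _; apply: lt_trans se; rewrite ltr_pMl// ltr1n.
set z := bspoint _ _ _ _ _ _ _ _; set p := psi _ _ _ _ _ _ _.
have zw i j : z.2 i j = 0.
  by rewrite mxE; elim/ord5P: i; elim/ord5P: j => /=; ring.
split; split=> // i j.
  rewrite !mxE /ball /=; elim/ord5P: j => /=; rewrite ?sub0r ?normrN.
  - by apply: le_lt_trans ke; apply: combB; left; do 2?split=> //; rewrite ger0_norm// ltW.
  - by apply: le_lt_trans ke; apply: combB; left; do 2?split=> //; rewrite ger0_norm// ltW.
  - by apply: le_lt_trans ke; apply: combB; left; do 2?split=> //; rewrite ger0_norm// ltW.
  - rewrite -mulrBl mulrC; apply: le_lt_trans oe; apply: mulB => //.
    by rewrite ger0_norm// subr_ge0.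
  - rewrite -mulrBl mulrC; apply: le_lt_trans oe; apply: mulB => //.
    by rewrite ger0_norm// subr_ge0.
suff pe : `|p.2 i j| < e by rewrite /ball /= [z.2 i j]zw sub0r normrN.
rewrite mxE; elim/ord5P: i; elim/ord5P: j => /=; rewrite ?normrN ?mul0r ?normr0//;
  by (exact: sX || exact: HX || exact: HX').
Qed.

(** The radius vanishes on the singular part, so [K], where it is at least 1, avoids it. Closedness
    of [K] follows, since a limit of the fibre outside the singular part belongs to the fibre. *)
Lemma singular_fibre_conically_singular (c : R) (b : R * R * R) :
  0 < c -> singular_value c b ->
  conically_singular (BSmetric c) (BSfibre c b) (singular_part c b) g_CS 2.
Proof.
move=> c0 sv; have := sv; case: b sv => [[u b4] b5] sv [/= u0].
have [v [n3 [n4 [v0 n1 b4E b5E]]]] := polar_decomposition b4 b5.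
rewrite powR_inv4 ?ltW// exprMn sqr_sqrtr ?sqrtr_ge0// => bE.
pose m := Num.sqrt c; have m0 : 0 < m by rewrite sqrtr_gt0.
have cE : c = m ^+ 2 by rewrite sqr_sqrtr// ltW.
have v2 : v ^+ 2 = 4 * m.
  have -> : v ^+ 2 = b4 ^+ 2 + b5 ^+ 2.
    by rewrite b4E b5E !exprMn -mulrDr n1 mulr1.
  by rewrite bE -/m; ring.
have vE : v = 2 * Num.sqrt m.
  apply/eqP; rewrite -(@eqrXn2 _ 2)// ?mulr_ge0 ?sqrtr_ge0//.
  by rewrite v2 exprMn sqr_sqrtr ?ltW//; apply/eqP; ring.
rewrite {}b4E {}b5E {}u0 {bE} in sv *.
set b := (0, v * n3, v * n4) in sv *.
have I0 := @cs_domain_gt0 R.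
have Ic := cs_fcos2_gt0 m0 v2; have Is := @cs_fs2_gt0 R m v m0.
rewrite -cE in Is.
have oI := @open_cs_domain R; have m0' := ltW m0; have c0' := ltW c0.
have Zw p : singular_part c b p -> p.2 = 0 by move=> [_ [_ []]].
have Nw p : BSfibre c b p -> ~ singular_part c b p -> 0 < rsq p.2.
  move=> Np nZ; rewrite lt_def rsq_ge0 andbT; apply/eqP => /rsq_eq0 w0; apply: nZ.
  by split=> //; split; [exact: subset_closure | split=> //; exact: BSfibre_Lambda Np].
have rad_gt0 (p : @BSamb R) : 0 < rsq p.2 -> 0 < Num.sqrt (c + rsq p.2) - m.
  by move=> r0; rewrite subr_gt0 /m ltr_sqrt ?ltrDl// addr_gt0.
have Zrad p : singular_part c b p -> end_radius c m p = 0.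
  by move=> /Zw w0; rewrite /end_radius w0 rsq0 addr0 /m subrr sqrtr0 mulr0.
pose K := [set p | BSfibre c b p /\ 1 <= end_radius c m p].
exists K, 1, (end_map n3 n4 c 0 v m) => dom; split=> //.
- split=> [p [Np rp]|].
    by split=> // /Zrad r0; move: rp; rewrite r0 ler10.
  have clR : closed [set p | 1 <= end_radius c m p].
    apply: (@preimage_closed _ _ (end_radius c m) [set y | 1 <= y]) => [q _|].
      exact: continuous_end_radius.
    exact: closed_ge.
  move=> p clp.
  have rp : 1 <= end_radius c m p by apply: clR; apply: closure_subset clp => q [].
  split=> //; apply: closure_BSfibre => //.
    by apply: closure_subset clp => q [].
  by move/Zrad => r0; move: rp; rewrite r0 ler10.
- have -> : (BSfibre c b `\` singular_part c b) `\` K =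
      end_set n3 n4 c 0 v m (@cs_domain R).
    apply/seteqP; split=> [p [[Np nZ] nK]|p [Np pm /andP[rp0 rp1]]].
      have pm := rad_gt0 p (Nw p Np nZ); split=> //.
      apply/andP; split; first by rewrite mulr_gt0// sqrtr_gt0.
      by rewrite ltNge; apply/negP => r1; apply: nK.
    split; last by move=> [_]; rewrite leNgt rp1.
    by split=> // /Zrad r0; move: rp0; rewrite r0 ltxx.
  exact: end_diffeomorphism.
- move=> U oU ZU.
  (* One point of the singular part suffices: [U] contains it, and the end map converges to it. *)
  pose z : @BSamb R := bspoint n3 n4 (fun=> 0) 1 0 (fun=> 0) (fun=> 0) (fun=> 0).
  have w0 : z.2 = 0.
    apply/matrixP => i j; rewrite !mxE.
    by elim/ord5P: i; elim/ord5P: j => /=; ring.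
  have Lz : Lambda2minus z.
    apply: bspoint_Lambda => //; try move=> j; rewrite /dot /cross /vec3 /=;
      by [ring | elim/ord3P: j => /=; ring].
  have Nz : BSfibre c b z.
    split; first by rewrite /BSspace gt_eqF.
    rewrite /= /BSfibration w0 rsq0 addr0 powR_inv4// -/m mxE i4E i5E !mxE /= !mul1r.
    by rewrite /b vE.
  have Uz : U z.
    apply: ZU; split=> //; split; first exact: subset_closure.
    by split.
  have /nbhs_ballP[e e0 be] : nbhs z U by exact: open_nbhs_nbhs.
  (* One has [k^2 <= x^2 / (4 m)] and [4 s^2 = x^2 (q + m)] with [q <= 1/4 + m], so [x^2 D]
     dominates both [k^2] and [(2 s)^2]. *)
  pose D := (4 * m)^-1 + (2 * m + 1).
  have m41 : 0 < (4 * m)^-1 by rewrite invr_gt0 mulr_gt0.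
  have D0 : 0 < D by rewrite addr_gt0// addr_gt0// mulr_gt0.
  exists (e / Num.sqrt D); first by rewrite divr_gt0// sqrtr_gt0.
  move=> p dp pd; apply: be.
  have [Ip SA] : cyl (@cs_domain R) p := dp.
  have x0 := I0 _ Ip; have x1 : p.1 < 1 by case/andP: Ip.
  have xD : p.1 ^+ 2 * D < e ^+ 2.
    rewrite -(sqr_sqrtr (ltW D0)) -exprMn ltr_pXn2r ?nnegrE ?mulr_ge0 ?sqrtr_ge0 ?ltW//.
    by rewrite -ltr_pdivlMr// sqrtr_gt0.
  have ltr_sq (y : R) : 0 <= y -> y ^+ 2 < e ^+ 2 -> y < e.
    by move=> y0; rewrite ltr_pXn2r ?nnegrE// ltW.
  have q0 := fq_gt0 m0' I0 Ip; have qm : m <= fq m p.1 by rewrite lerDr divr_ge0// sqr_ge0.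
  have x2 : p.1 ^+ 2 <= 1 by rewrite expr_le1// ltW.
  have k2 : fcos v m p.1 ^+ 2 < e ^+ 2.
    rewrite (fcos_sqr Ic)// cs_fcos2//; apply: le_lt_trans xD.
    rewrite -mulrA ler_wpM2l ?sqr_ge0//.
    apply: (@le_trans _ _ ((4 * m)^-1)); last by rewrite lerDl addr_ge0// mulr_ge0.
    by rewrite invfM ler_wpM2l ?invr_ge0// lef_pV2.
  have ke : fcos v m p.1 < e by apply: ltr_sq => //; exact: sqrtr_ge0.
  have se : 2 * fs c 0 v m p.1 < e.
    apply: ltr_sq; first by rewrite mulr_ge0// sqrtr_ge0.
    rewrite exprMn sqr_sqrtr ?(ltW (Is _ Ip))// cE cs_fs2//; apply: le_lt_trans xD.
    have -> : 2 ^+ 2 * (p.1 ^+ 2 / 4 * (fq m p.1 + m)) = p.1 ^+ 2 * (fq m p.1 + m).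
      by field.
    rewrite ler_wpM2l ?sqr_ge0// /fq /D; lra.
  have k1 := fcos2Dfsin2 m0' I0 Ic Ip.
  have kg := fcos_gt0 Ic Ip; have sg := fs_gt0 Is Ip.
  have og : 0 <= fsin v m p.1.
    by rewrite /fsin mulr_ge0// ?divr_ge0// invr_ge0 sqrtr_ge0.
  have o1 : fsin v m p.1 <= 1.
    by rewrite -(ler_pXn2r (n := 2))// ?nnegrE// expr1n -k1 lerDr sqr_ge0.
  have kc1 : fcos v m p.1 <= 1.
    by rewrite -(ler_pXn2r (n := 2))// ?nnegrE ?(ltW kg)// expr1n -k1 lerDl sqr_ge0.
  have n31 : `|n3| <= 1.
    by rewrite -(ler_pXn2r (n := 2))// ?nnegrE// real_normK ?num_real// expr1n -n1 lerDl sqr_ge0.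
  have n41 : `|n4| <= 1.
    by rewrite -(ler_pXn2r (n := 2))// ?nnegrE// real_normK ?num_real// expr1n -n1 lerDr sqr_ge0.
  rewrite /end_map cs_ft; apply: psi_near => // [|i j]; last exact: SO3_entry.
  (* The chain is [1 - o <= 1 - o^2 = k^2 <= k]. *)
  apply: le_lt_trans ke; apply: (@le_trans _ _ (fcos v m p.1 ^+ 2)).
    have oo : fsin v m p.1 ^+ 2 <= fsin v m p.1 by rewrite expr2 ler_piMl.
    by move: k1 oo; lra.
  by rewrite ler_iXnr ?(ltW kg).
- move=> j; have Hm := cs_end_metric m0 v2; rewrite -cE in Hm.
  have [C HC] := end_deviation oI m0' I0 Ic Is n1 j
    (q1 := 2^-1) (q2 := 2^-1) (q3 := 1) (rate := 2)
    ltac:(by rewrite invr_gt0) ltac:(by rewrite invr_gt0) ltac:(by []) Hm.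
  by exists C, 1; split=> // p dp _; exact: HC.
Qed.

Lemma singular_value0 (b : R * R * R) : singular_value 0 b <-> b = (0, 0, 0).
Proof.
case: b => [[u x] y]; rewrite /singular_value /= powR0 ?invr_eq0// mulr0 expr0n /=.
split=> [[-> /eqP]|[-> -> ->]]; last by rewrite expr0n addr0.
by rewrite paddr_eq0 ?sqr_ge0// !sqrf_eq0 => /andP[/eqP -> /eqP ->].
Qed.

(** For c = u = v = 0 the curve has alpha = 0, t = 0 and s = q = x^2 / 4 for all x > 0, so the whole
    fibre is a single end and the metric is computed exactly. *)
Lemma singular_fibre_isometric_to_cone :
  isometric_to_cone (BSmetric (0 : R)) (BSfibre 0 (0, 0, 0)) g_AC.
Proof.
pose I : set R := [set x | 0 < x].
have oI : open I by exact: open_gt.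
have I0 x : I x -> 0 < x by [].
have n1 : (1 : R) ^+ 2 + 0 ^+ 2 = 1 by rewrite expr1n expr0n addr0.
have c2E x : fcos2 (0 : R) 0 x = 1 by rewrite /fcos2 expr0n /= !mul0r subr0.
have kE x : fcos (0 : R) 0 x = 1 by rewrite /fcos c2E sqrtr1.
have oE x : fsin (0 : R) 0 x = 0 by rewrite /fsin !mul0r.
have tE x : ft (0 : R) 0 0 x = 0 by rewrite /ft mul0r.
have Ic x : I x -> 0 < fcos2 (0 : R) 0 x by rewrite c2E.
have s2E x : fs2 (0 : R) 0 0 0 x = (x ^+ 2 / 4) ^+ 2.
  by rewrite /fs2 tE /fq addr0 expr0n !subr0.
have Is x : I x -> 0 < fs2 (0 : R) 0 0 0 x.
  by move=> x0; rewrite s2E exprn_gt0// divr_gt0// exprn_gt0.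
have sE x : fs (0 : R) 0 0 0 x = x ^+ 2 / 4.
  by rewrite /fs s2E sqrtr_sqr ger0_norm// divr_ge0// sqr_ge0.
(* As v = 0, the choice of (1, 0) among the unit vectors (n3, n4) is arbitrary. *)
exists (end_map 1 0 0 0 0 0) => dom; split.
  have -> : BSfibre 0 (0, 0, 0) = end_set 1 0 0 0 0 0 I.
    apply/seteqP; split=> [p Np|p []]; last by rewrite mulr1 mulr0.
    have r0 : 0 < Num.sqrt (0 + rsq p.2) - 0.
      rewrite subr0 add0r sqrtr_gt0 lt_def rsq_ge0 andbT; apply/eqP => /rsq_eq0 w0.
      have := BSfibre_Lambda Np; case: Np; rewrite /BSspace eqxx => -[_ nz] _ L.
      exact: nz.
    split=> //; first by rewrite mulr1 mulr0.
    by rewrite /I /= /end_radius mulr_gt0// sqrtr_gt0.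
  exact: end_diffeomorphism.
move=> p dp; apply/matrixP => a b.
have [Ip _] : cyl I p := dp.
rewrite (pullback_end_metric oI (lexx 0) I0 Ic Is n1)//.
have x0 : p.1 != 0 by rewrite gt_eqF.
have kE' : 'D_1 (fcos (0 : R) 0) p.1 = 0.
  by rewrite (_ : fcos 0 0 = cst 1); [exact: derive_cst | exact/funext].
have oE' : 'D_1 (fsin (0 : R) 0) p.1 = 0.
  by rewrite (_ : fsin 0 0 = cst 0); [exact: derive_cst | exact/funext].
have tE' : 'D_1 (ft (0 : R) 0 0) p.1 = 0.
  by rewrite (_ : ft 0 0 0 = cst 0); [exact: derive_cst | exact/funext].
have sE' : 'D_1 (fs (0 : R) 0 0 0) p.1 = p.1 / 2.
  have := fs_derive oI (lexx 0) I0 Ic Is Ip; rewrite tE mul0r mulr0 subr0 sE /fq addr0 => e.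
  apply: (@mulfI R (2 * (p.1 ^+ 2 / 4))).
    by rewrite !mulf_neq0 ?invr_eq0// sqrf_eq0.
  by rewrite -mulrA e; field.
rewrite /end_metric /psi_metric kE' oE' tE' sE' kE oE tE sE /fq /g_AC /cone_metric !mxE.
by elim/ord4P: a; elim/ord4P: b; rewrite /psi_vertical /psi_horizontal /= ?mulr1n ?mulr0n;
  field.
Qed.

End MainParts.

Theorem proposition5p12 (R : realType) :
  (forall (c : R) (b : R * R * R), 0 <= c ->
     asymptotically_conical (BSmetric c) (BSfibre c b) (singular_part c b)
       g_AC (- 2))
  /\
  (forall (c : R) (b : R * R * R), 0 < c -> singular_value c b ->
     exists2 mu : R, 0 < mu &
       conically_singular (BSmetric c) (BSfibre c b) (singular_part c b)
         g_CS mu)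
  /\
  ((forall b : R * R * R, singular_value (0 : R) b <-> b = (0, 0, 0)) /\
   isometric_to_cone (BSmetric (0 : R)) (BSfibre 0 (0, 0, 0)) g_AC).
Proof.
split; first by move=> c b c0; exact: fibre_asymptotically_conical.
split; last by split; [exact: singular_value0 | exact: singular_fibre_isometric_to_cone].
by move=> c b c0 sv; exists 2; [|exact: singular_fibre_conically_singular].
Qed.
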